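(* Let $\gamma$ be a (smooth, Riemannian) metric on a 3-dimensional manifold whose Ricci tensor $R$ is nowhere zero, let $\nabla$ be its Levi-Civita connection, and put $s = \operatorname{tr} R^2$, $t = \operatorname{tr} R^3$. Then $\gamma$ is locally the spatial metric of a $B$-metric if and only if the following conditions hold, at every point: $$\operatorname{tr} R = 0, \qquad 6 t^2 = s^3, \qquad P(\mathrm{d} s) = 0, \qquad \text{where } P = 6 R^2 - s\,\gamma,$$ and $$R = \Omega^{-\frac13}\, \nabla \mathrm{d}\, \Omega^{\frac13} - 2\left[\Omega + (\mathrm{d}\Omega)^2\right] P, \qquad \text{where } \Omega = -\frac{s}{18\,t}.$$
   Context: All objects are smooth. Considerations are local: ''$\gamma$ is locally the spatial metric of...'' means that every point has an open neighbourhood on which the property holds. Indices are raised and lowered with $\gamma$. $R^2$ and $R^3$ denote the powers of $R$ viewed as an endomorphism, i.e. $(R^2)_{ij} = R_{ik}R^{k}{}_{j}$, etc.; $\operatorname{tr}$ is the trace with respect to $\gamma$. $P(\mathrm{d}s)$ is the contraction $P_i{}^{j}\partial_j s$. $(\mathrm{d}\Omega)^2 = \gamma^{ij}\partial_i\Omega\,\partial_j\Omega$, $\Omega^{1/3}$ is the real cube root, and $\nabla \mathrm{d} f$ is the Hessian of $f$. (When $R\neq 0$ and $6t^2=s^3$ one has $s>0$ and $t \neq 0$, so $\Omega$ is well defined and nonzero.) Static vacuum solution: a Lorentzian metric $g = -e^{2U(x^k)}\mathrm{d}T^2 + \gamma_{ij}(x^k)\,\mathrm{d}x^i \mathrm{d}x^j$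 which is Ricci-flat. Equivalently, the 3-metric $\gamma$ (the spatial metric of $g$) and the function $U$ (the potential) satisfy $$\operatorname{tr} R = 0, \qquad R = \nabla\chi + \chi\otimes\chi, \qquad \chi = \mathrm{d}U .$$ The electric part of the Weyl tensor of $g$ relative to the static observer equals $R$, and the magnetic part vanishes. A static vacuum solution $g$ is of Petrov-Bel type $D$ when, at every point, $R$ has exactly one double eigenvalue $\mu \neq 0$ and a simple eigenvalue $-2\mu$; $\mu$ is called the (double) Weyl eigenvalue. Let $e$ be a unit eigenvector of $R$ for the simple eigenvalue. The time-like principal plane of $g$ is the plane spanned by $\partial_T$ and $e$; the space-like principal plane is its orthogonal complement. A $B$-metric (in the Ehlers-Kundt classification) is a type $D$ static vacuum solution for which the gradient of the Weyl eigenvalue $\mu$ lies in the space-like principal plane at every point, i.e. $e(\mu)=0$. *)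

(* Defs.v *)
From HB Require Import structures.
From mathcomp Require Import all_boot all_order all_algebra.
From mathcomp Require Import all_classical all_reals all_analysis.

Set Implicit Arguments.
Unset Strict Implicit.
Unset Printing Implicit Defensive.

Import Order.TTheory GRing.Theory Num.Theory.
Import numFieldNormedType.Exports.

Local Open Scope classical_set_scope.
Local Open Scope ring_scope.

(* Points, vectors and covectors of R^n are row vectors; n.+1 is the dimension.
   A tensor field is given by its components in a coordinate system. *)

Section Calculus.
Context {R : realType} {n : nat}.
Implicit Types (f : 'rV[R]_n.+1 -> R) (x : 'rV[R]_n.+1).

Definition partial (i : 'I_n.+1) f x : R := 'D_(delta_mx 0 i) f x.

(* C^oo: every iterated partial derivative is differentiable at every point *)
Definition smooth_on (O : set 'rV[R]_n.+1) f : Prop :=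
  forall (s : seq 'I_n.+1) x, O x -> differentiable (foldr partial f s) x.

Definition diff_row f x : 'rV[R]_n.+1 := \row_i partial i f x.

End Calculus.

Section Curvature.
Context {R : realType} {n : nat}.
(* the components g_ij of a pseudo-Riemannian metric *)
Variable g : 'rV[R]_n.+1 -> 'M[R]_n.+1.
Implicit Types (f : 'rV[R]_n.+1 -> R) (x : 'rV[R]_n.+1).

Definition christoffel (k i j : 'I_n.+1) x : R :=
  2^-1 * \sum_l invmx (g x) k l *
    (partial i (fun y => g y j l) x + partial j (fun y => g y i l) x
     - partial l (fun y => g y i j) x).

(* sign convention: the Ricci tensor of a round sphere is positive *)
Definition ricci x : 'M[R]_n.+1 := \matrix_(i, j)
  (\sum_k partial k (christoffel k i j) x
   - \sum_k partial j (christoffel k i k) x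
   + \sum_k \sum_l christoffel k k l x * christoffel l i j x
   - \sum_k \sum_l christoffel k j l x * christoffel l i k x).

Definition hessian f x : 'M[R]_n.+1 := \matrix_(i, j)
  (partial i (partial j f) x - \sum_k christoffel k i j x * partial k f x).

Definition gradient f x : 'rV[R]_n.+1 := diff_row f x *m invmx (g x).

Definition sqnorm_diff f x : R :=
  (diff_row f x *m invmx (g x) *m (diff_row f x)^T) 0 0.

(* R_i^j *)
Definition ricci_endo x : 'M[R]_n.+1 := ricci x *m invmx (g x).

Definition tr_ricci x : R := \tr (ricci_endo x).
Definition tr_ricci2 x : R := \tr (ricci_endo x ^+ 2).
Definition tr_ricci3 x : R := \tr (ricci_endo x ^+ 3).

(* P_ij, where (R^2)_ij = R_ik g^kl R_lj *)
Definition Ptensor x : 'M[R]_n.+1 :=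
  6 *: (ricci x *m invmx (g x) *m ricci x) - tr_ricci2 x *: g x.

(* P_i^j d_j f *)
Definition Pcontract f x : 'rV[R]_n.+1 :=
  (Ptensor x *m invmx (g x) *m (diff_row f x)^T)^T.

Definition Omega x : R := - tr_ricci2 x / (18 * tr_ricci3 x).

End Curvature.

Definition cbrt {R : realType} (a : R) : R := Num.sg a * (`|a| `^ (3^-1)).

Section StaticMetric.
Context {R : realType}.

(* Spacetime points are (T, x) : 'rV_(1 + 3). *)
Definition spacetime_point (T : R) (x : 'rV[R]_3) : 'rV[R]_(1 + 3) :=
  row_mx T%:M x.

Definition static_metric (U : 'rV[R]_3 -> R) (gam : 'rV[R]_3 -> 'M[R]_3)
    (y : 'rV[R]_(1 + 3)) : 'M[R]_(1 + 3) :=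
  block_mx (- expR (2 * U (rsubmx y)))%:M 0 0 (gam (rsubmx y)).

Definition static_vacuum (V : set 'rV[R]_3) (U : 'rV[R]_3 -> R)
    (gam : 'rV[R]_3 -> 'M[R]_3) : Prop :=
  smooth_on V U /\
  forall T x, V x ->
    @ricci R 3 (static_metric U gam) (spacetime_point T x) = 0.

Definition double_weyl_eigenvalue (gam : 'rV[R]_3 -> 'M[R]_3) (x : 'rV[R]_3)
    (mu : R) : Prop :=
  mu != 0 /\
  char_poly (ricci_endo gam x) = ('X - mu%:P) ^+ 2 * ('X - (- 2 * mu)%:P).

Definition unit_simple_eigenvector (gam : 'rV[R]_3 -> 'M[R]_3) (x : 'rV[R]_3)
    (mu : R) (e : 'rV[R]_3) : Prop :=
  e *m gam x *m e^T = 1%:M /\ e *m ricci_endo gam x = (- 2 * mu) *: e.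

(* the rows d_T and e span the time-like principal plane *)
Definition timelike_principal_plane (e : 'rV[R]_3) : 'M[R]_(1 + 1, 1 + 3) :=
  col_mx (row_mx 1%:M 0) (row_mx 0 e).

Definition in_spacelike_principal_plane (g : 'M[R]_(1 + 3)) (e : 'rV[R]_3)
    (X : 'rV[R]_(1 + 3)) : Prop :=
  X *m g *m (timelike_principal_plane e)^T = 0.

(* mu is determined on V by the metric (mu = - tr R^3 / tr R^2), hence smooth. *)
Definition B_metric (V : set 'rV[R]_3) (U : 'rV[R]_3 -> R)
    (gam : 'rV[R]_3 -> 'M[R]_3) : Prop :=
  static_vacuum V U gam /\
  exists mu : 'rV[R]_3 -> R,
    (forall x, V x -> double_weyl_eigenvalue gam x (mu x)) /\
    (forall T x e, V x -> unit_simple_eigenvector gam x (mu x) e ->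
       let y := spacetime_point T x in
       in_spacelike_principal_plane (static_metric U gam y) e
         (@gradient R 3 (static_metric U gam) (fun z : 'rV[R]_(1 + 3) => mu (rsubmx z)) y)).

End StaticMetric.

Record manifold (R : realType) (n : nat) := Manifold {
  space :> topologicalType;
  space_hausdorff : hausdorff_space space;
  space_countable : @second_countable space;
  atlas : Type;
  chart_dom : atlas -> set space;
  chart : atlas -> space -> 'rV[R]_n.+1;
  chart_inv : atlas -> 'rV[R]_n.+1 -> space;
  chart_image := fun a => chart a @` chart_dom a;
  chart_dom_open : forall a, open (chart_dom a);
  chart_cover : forall p, exists a, chart_dom a p;
  chart_image_open : forall a, open (chart_image a);
  chartK : forall a p, chart_dom a p -> chart_inv a (chart a p) = p;
  chart_continuous : forall a, {within chart_dom a, continuous (chart a)};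
  chart_inv_continuous :
    forall a, {within chart_image a, continuous (chart_inv a)};
  transition := fun a b x => chart b (chart_inv a x);
  transition_smooth : forall a b (k : 'I_n.+1),
    smooth_on (chart a @` (chart_dom a `&` chart_dom b))
      (fun x => transition a b x 0 k)
}.

Record riemannian_metric (R : realType) (n : nat) (M : manifold R n) :=
  RiemannianMetric {
  metric_in :> atlas M -> 'rV[R]_n.+1 -> 'M[R]_n.+1;
  metric_smooth : forall a i j,
    smooth_on (chart_image a) (fun x => metric_in a x i j);
  metric_sym : forall a x, chart_image a x -> (metric_in a x)^T = metric_in a x;
  metric_pos : forall a x (v : 'rV[R]_n.+1), chart_image a x -> v != 0 ->
    0 < (v *m metric_in a x *m v^T) 0 0;
  metric_transition : forall a b x,
    (chart a @` (chart_dom a `&` chart_dom b)) x ->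
    metric_in a x =
      'J (transition a b) x *m metric_in b (transition a b x)
        *m ('J (transition a b) x)^T
}.

(* A neighbourhood of a point p in the domain of a chart is identified with its
   image under the chart.  The notions involved being invariant under changes
   of coordinates, they are required in every chart around p. *)
Definition locally_spatial_metric_of_B_metric (R : realType)
    (M : manifold R 2) (gam : riemannian_metric M) : Prop :=
  forall (p : M) (a : atlas M), chart_dom a p ->
    exists V : set 'rV[R]_3,
      [/\ open V, V (chart a p), V `<=` chart_image a
        & exists U : 'rV[R]_3 -> R, B_metric V U (gam a)].

(* Main.v *)
(* The conditions tr R = 0 and 6 t^2 = s^3 say that R has the eigenvalues mu, mu
   and -2 mu, where mu = - t / s.  Then R = mu (gamma - 3 e e) for a unit covector
   e, which is smooth locally, Omega = 1 / (18 mu) and P = 18 mu^2 e e, so that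
   P(ds) = 0 means e(mu) = 0.  With F = Omega^(1/3) the last condition becomes
     nabla dF = F (R + (2 mu + F^-2 |dF|^2) e e),
   while the static vacuum equation for N = exp U is nabla dN = N R.

   In dimension 3 the Ricci tensor determines the curvature, so the Ricci identity
   for a function f with nabla df = a gamma + b e e gives df up to a multiple of e,
   and b nabla e.  For f = N this yields nabla e = - F^-1 e dF and
   dN = N F^-1 dF + phi e; differentiating once more gives the equation of F.
   Conversely the equation of F gives the same nabla e, hence F^-1 e = d theta
   locally, and shows that kappa = 2 mu F^2 + |dF|^2 is constant.  If c'' = - kappa c
   then N = F c(theta) satisfies nabla dN = N R; a positive N is obtained from
   cos (sqrt kappa theta) or exp (sqrt (- kappa) theta). *)

Require Import Defs.
From HB Require Import structures.
From mathcomp Require Import all_boot all_order all_algebra.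
From mathcomp Require Import all_classical all_reals all_analysis.
From mathcomp Require Import ring lra.
Set Implicit Arguments.
Unset Strict Implicit.
Unset Printing Implicit Defensive.
Import Order.TTheory GRing.Theory Num.Theory.
Import numFieldNormedType.Exports.
Local Open Scope classical_set_scope.
Local Open Scope ring_scope.

(** The formula for nabla e makes the covariant derivative of the covector F e antisymmetric. So F
    is, up to sign, the length of a Killing field of gamma along e, and theta is a parameter along
    that field. The cube root is forced: the traced Ricci identity of N makes N dmu + 3 mu dN a
    multiple of e, hence d(N / F) is along e once mu F^3 is constant. The constant 18 is the
    normalization for which 2 [Omega + (dOmega)^2] P equals (2 mu + F^-2 |dF|^2) e e.

    Smooth functions form a ring with zero divisors, so the tensor calculus is done in an abstract
    commutative ring with commuting derivations, and every cancellation comes with an explicit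
    inverse. This is delicate only in the converse, where the coefficient b of e e in the Hessian of
    F may vanish. The spacetime metric is treated over the same ring of functions on space, with the
    time derivation put to zero.

    The sign of mu is free. For negative mu the root F is negative, and c must be negative too for N
    = F c to be positive; hence the sign s that accompanies mu. *)

Lemma addmxE (V : nmodType) m n (X Y : 'M[V]_(m, n)) i j :
  (X + Y) i j = X i j + Y i j.
Proof. by rewrite mxE. Qed.

Lemma oppmxE (V : zmodType) m n (X : 'M[V]_(m, n)) i j : (- X) i j = - X i j.
Proof. by rewrite mxE. Qed.

Lemma trmxD (V : nmodType) m n (X Y : 'M[V]_(m, n)) :
  (X + Y)^T = X^T + Y^T.
Proof. exact: raddfD. Qed.

Lemma trmxN (V : zmodType) m n (X : 'M[V]_(m, n)) : (- X)^T = - X^T.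
Proof. exact: raddfN. Qed.

(** * Curvature over a commutative ring with commuting derivations *)

(* [f] stands for formal: the coordinate formulas are read in a commutative ring
   [A] with derivations [D i], where [half] is 1/2 and [h] is the inverse of [g].
   The ring of smooth functions on an open set is such a ring. *)
Section FormalCurvature.
Context {A : comPzRingType} {n : nat}.
Variables (D : 'I_n -> {additive A -> A}) (half : A) (g h : 'M[A]_n).

Definition fchristoffel k i j : A :=
  half * \sum_l h k l * (D i (g j l) + D j (g i l) - D l (g i j)).

Definition fricci i j : A :=
  \sum_k D k (fchristoffel k i j) - \sum_k D j (fchristoffel k i k)
  + \sum_k \sum_l fchristoffel k k l * fchristoffel l i j
  - \sum_k \sum_l fchristoffel k j l * fchristoffel l i k.

Definition fhessian f i j : A :=
  D i (D j f) - \sum_k fchristoffel k i j * D k f.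

Definition connection k : 'M[A]_n := \matrix_(i, l) fchristoffel l k i.

(** The commutator has the sign opposite to the usual one because the row index of [connection] is
    the lower index: these are the transposes of the connection matrices that act on columns. *)
Definition curvature k j : 'M[A]_n :=
  map_mx (D k) (connection j) - map_mx (D j) (connection k)
  - (connection k *m connection j - connection j *m connection k).

Definition covder k (u : 'rV[A]_n) : 'rV[A]_n :=
  map_mx (D k) u - u *m (connection k)^T.

Definition differential f : 'rV[A]_n := \row_i D i f.

Definition cometric (u w : 'rV[A]_n) : A := (u *m h *m w^T) 0 0.

Hypothesis halfE : half + half = 1.
Hypothesis DM : forall i x y, D i (x * y) = D i x * y + x * D i y.
Hypothesis DC : forall i j x, D i (D j x) = D j (D i x).
Hypothesis gh : g *m h = 1%:M.
Hypothesis gT : g^T = g.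

Lemma cometric_mul_metric : h *m g = 1%:M. Proof. exact: mulmx1C. Qed.

Lemma cometric_trmx : h^T = h.
Proof.
by rewrite -[RHS]mulmx1 -[1%:M]trmx1 -cometric_mul_metric trmx_mul gT mulmxA cometric_mul_metric mul1mx.
Qed.

Lemma metric_symE i j : g i j = g j i. Proof. by rewrite -{1}gT mxE. Qed.
Lemma cometric_symE i j : h i j = h j i. Proof. by rewrite -{1}cometric_trmx mxE. Qed.

Lemma derivation1 i : D i 1 = 0.
Proof.
by apply: (addrI (D i 1)); rewrite addr0 -{3}[1](mulr1 1) DM mul1r mulr1.
Qed.

Lemma double_eq0 (x : A) : x + x = 0 -> x = 0.
Proof. by move=> x2; rewrite -[x]mul1r -halfE mulrDl -mulrDr x2 mulr0. Qed.

Lemma derivation_mulmx k m p q (X : 'M[A]_(m, p)) (Y : 'M[A]_(p, q)) :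
  map_mx (D k) (X *m Y) = map_mx (D k) X *m Y + X *m map_mx (D k) Y.
Proof.
apply/matrixP=> i j; rewrite !mxE raddf_sum -big_split /=.
by apply: eq_bigr => l _; rewrite DM !mxE.
Qed.

Lemma fchristoffelC k i j : fchristoffel k i j = fchristoffel k j i.
Proof.
congr (_ * _); apply: eq_bigr => l _; congr (_ * _).
by rewrite [g i j]metric_symE [D i _ + _]addrC.
Qed.

Lemma lower_fchristoffel k i j :
  \sum_l fchristoffel l k i * g l j
  = half * (D k (g i j) + D i (g k j) - D j (g k i)).
Proof.
pose v := \row_m (D k (g i m) + D i (g k m) - D m (g k i)).
transitivity ((half *: (v *m h) *m g) 0 j).
  rewrite mxE; apply: eq_bigr => l _; rewrite !mxE; congr (_ * _ * _).
  by apply: eq_bigr => m _; rewrite mxE mulrC cometric_symE.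
by rewrite -scalemxAl -mulmxA cometric_mul_metric mulmx1 !mxE.
Qed.

Lemma metric_compat k :
  map_mx (D k) g = connection k *m g + g *m (connection k)^T.
Proof.
apply/matrixP=> i j; rewrite !mxE.
have -> : \sum_l connection k i l * g l j =
   half * (D k (g i j) + D i (g k j) - D j (g k i)).
  by rewrite -lower_fchristoffel; apply: eq_bigr => l _; rewrite mxE.
have -> : \sum_l g i l * (connection k)^T l j =
   half * (D k (g j i) + D j (g k i) - D i (g k j)).
  by rewrite -lower_fchristoffel; apply: eq_bigr => l _; rewrite !mxE mulrC metric_symE.
rewrite -mulrDr [g j i]metric_symE -[LHS]mul1r -halfE; ring.
Qed.

Lemma metric_compatE k i j :
  D k (g i j) = \sum_l fchristoffel l k i * g l j
              + \sum_l fchristoffel l k j * g i l.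
Proof.
have /matrixP/(_ i j) := metric_compat k; rewrite !mxE => ->.
by congr (_ + _); apply: eq_bigr => l _; rewrite !mxE // mulrC.
Qed.

Lemma cometric_compat k :
  map_mx (D k) h = - (h *m connection k + (connection k)^T *m h).
Proof.
have d1 : map_mx (D k) 1%:M = 0 :> 'M[A]_n.
  by apply/matrixP=> i j; rewrite !mxE raddfMn derivation1 mul0rn.
have := derivation_mulmx k g h; rewrite gh d1 metric_compat mulmxDl => /esym/(congr1 (mulmx h)).
rewrite mulmx0 !mulmxDr !mulmxA cometric_mul_metric !mul1mx -[h *m _ *m _ *m _]mulmxA gh mulmx1.
by move/eqP; rewrite addrC addr_eq0 => /eqP.
Qed.

Lemma cometricC u w : cometric u w = cometric w u.
Proof.
have trE (M : 'M[A]_1) : M 0 0 = M^T 0 0 by rewrite [RHS]mxE.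
by rewrite /cometric trE !trmx_mul trmxK cometric_trmx mulmxA.
Qed.

Lemma derivation_cometric k u w :
  D k (cometric u w) = cometric (covder k u) w + cometric u (covder k w).
Proof.
have DE (M : 'M[A]_1) : D k (M 0 0) = (map_mx (D k) M) 0 0 by rewrite [RHS]mxE.
rewrite /cometric DE !derivation_mulmx cometric_compat /covder.
rewrite raddfB /= trmx_mul trmxK map_trmx.
rewrite !(mulmxDl, mulmxDr, mulmxN, mulNmx) !mulmxA !(addmxE, oppmxE); ring.
Qed.

(** The second derivatives of [g] commute. Inserting [metric_compat] twice into their difference
    leaves exactly the action of the curvature on both indices of [g]. *)
Lemma curvature_metric_antisym k j :
  curvature k j *m g + (curvature k j *m g)^T = 0.
Proof.
have DDg a b : map_mx (D a) (map_mx (D b) g) =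
    map_mx (D a) (connection b) *m g
    + connection b *m (connection a *m g + g *m (connection a)^T)
    + ((connection a *m g + g *m (connection a)^T) *m (connection b)^T
       + g *m (map_mx (D a) (connection b))^T).
  by rewrite [map_mx (D b) g]metric_compat map_mxD !derivation_mulmx
    !metric_compat map_trmx.
have : map_mx (D k) (map_mx (D j) g) - map_mx (D j) (map_mx (D k) g) = 0.
  by apply/matrixP=> a b; rewrite !mxE DC subrr.
rewrite !DDg /curvature trmx_mul gT !(trmxD, trmxN, trmx_mul) => <-.
rewrite !(mulmxDl, mulmxDr, mulmxN, mulNmx, mulmxA).
by apply/matrixP=> a b; rewrite !(addmxE, oppmxE); ring.
Qed.

Lemma fricciE i j : fricci i j = \sum_k curvature k j i k.
Proof.
rewrite /fricci /curvature -!sumrB -!big_split /= -sumrB.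
apply: eq_bigr => k _; rewrite !mxE.
under [X in _ = _ - (X - _)]eq_bigr do rewrite !mxE.
under [X in _ = _ - (_ - X)]eq_bigr do rewrite !mxE.
rewrite [fchristoffel k j i]fchristoffelC [fchristoffel k k i]fchristoffelC.
have -> : \sum_l fchristoffel k k l * fchristoffel l i j
   = \sum_l fchristoffel l j i * fchristoffel k k l.
  by apply: eq_bigr => l _; rewrite mulrC fchristoffelC.
have -> : \sum_l fchristoffel k j l * fchristoffel l i k
   = \sum_l fchristoffel l k i * fchristoffel k j l.
  by apply: eq_bigr => l _; rewrite mulrC [fchristoffel l i k]fchristoffelC.
ring.
Qed.

Lemma curvatureC k j : curvature k j = - curvature j k.
Proof. by rewrite /curvature !opprB addrC !addrA; apply/matrixP=> a b; rewrite !mxE; ring. Qed.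

Lemma curvature_trace0 k j : \tr (curvature k j) = 0.
Proof.
have trE : \tr (curvature k j) = \tr (h *m (curvature k j *m g)).
  by rewrite mxtrace_mulC -mulmxA gh mulmx1.
have tr2 : \tr (curvature k j) = \tr (h *m (curvature k j *m g)^T).
  by rewrite trE -mxtrace_tr trmx_mul cometric_trmx mxtrace_mulC.
apply: double_eq0; rewrite [X in X + _]trE [X in _ + X]tr2 -mxtraceD -mulmxDr.
by rewrite curvature_metric_antisym mulmx0 mxtrace0.
Qed.

Lemma fhessianC f i j : fhessian f i j = fhessian f j i.
Proof.
rewrite /fhessian DC; congr (_ - _); apply: eq_bigr => k _.
by rewrite fchristoffelC.
Qed.

Lemma covder_differential k f :
  covder k (differential f) = \row_i fhessian f k i.
Proof.
apply/rowP=> i; rewrite !mxE; congr (_ - _); apply: eq_bigr => l _.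
by rewrite !mxE mulrC.
Qed.

Lemma covder_comm k j u :
  covder k (covder j u) - covder j (covder k u) = - (u *m (curvature k j)^T).
Proof.
rewrite /covder !raddfB /= !derivation_mulmx !mulmxBl /curvature.
have -> : map_mx (D k) (map_mx (D j) u) = map_mx (D j) (map_mx (D k) u).
  by apply/matrixP=> a b; rewrite !mxE DC.
rewrite !(trmxD, trmxN, trmx_mul) !map_trmx !(mulmxDl, mulmxDr, mulmxN, mulNmx, mulmxA).
by apply/matrixP=> a b; rewrite !(addmxE, oppmxE); ring.
Qed.

(** This is [covder_comm] for the covector df, written in components: the left side is the
    antisymmetrized third covariant derivative of [f]. *)
Lemma hessian_curvature f i j k :
  D k (fhessian f j i) - D j (fhessian f k i)
  - \sum_l fchristoffel l k i * fhessian f j l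
  + \sum_l fchristoffel l j i * fhessian f k l
  = - \sum_l curvature k j i l * D l f.
Proof.
have cE a b : covder a (covder b (differential f)) 0 i =
    D a (fhessian f b i) - \sum_l fchristoffel l a i * fhessian f b l.
  rewrite covder_differential /covder addmxE oppmxE [X in X - _]mxE.
  rewrite [X in _ - X]mxE [X in D a X]mxE; congr (_ - _).
  by apply: eq_bigr => l _; rewrite !mxE mulrC.
have /rowP/(_ i) := covder_comm k j (differential f).
rewrite addmxE !oppmxE !cE mxE => E.
transitivity (- \sum_l differential f 0 l * (curvature k j)^T l i).
  by rewrite -E; ring.
by congr (- _); apply: eq_bigr => l _; rewrite !mxE mulrC.
Qed.

(** Only the term with derivatives of the contracted Christoffel symbol is not visibly symmetric.
    Its symmetry is the vanishing of the trace of the curvature. *)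
Lemma fricciC i j : fricci i j = fricci j i.
Proof.
have tr0 : \sum_k D j (fchristoffel k i k) = \sum_k D i (fchristoffel k j k).
  have := curvature_trace0 j i.
  rewrite /curvature !raddfB /= mxtrace_mulC subrr addr0 => /subr0_eq.
  rewrite /mxtrace => E; etransitivity; last (etransitivity; first exact: E).
    by apply: eq_bigr => k _; rewrite !mxE.
  by apply: eq_bigr => k _; rewrite !mxE.
rewrite /fricci tr0; congr (_ - _ + _ - _).
- by apply: eq_bigr => k _; rewrite fchristoffelC.
- apply: eq_bigr => k _; apply: eq_bigr => l _.
  by rewrite [fchristoffel l i j]fchristoffelC.
- rewrite exchange_big; apply: eq_bigr => k _; apply: eq_bigr => l _.
  by rewrite mulrC.
Qed.

End FormalCurvature.

(** * Curvature and the Ricci identity in dimension 3 *)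

Notation o0 := (ord0 : 'I_3).
Notation o1 := (lift ord0 ord0 : 'I_3).
Notation o2 := (lift ord0 (lift ord0 ord0) : 'I_3).

Lemma sum3 (V : nmodType) (F : 'I_3 -> V) : \sum_i F i = F o0 + F o1 + F o2.
Proof. by rewrite !big_ord_recl big_ord0 addr0 addrA. Qed.

Lemma ord3_ind (P : 'I_3 -> Prop) : P o0 -> P o1 -> P o2 -> forall i, P i.
Proof.
move=> P0 P1 P2 [[|[|[|//]]] lti].
- by rewrite (_ : Ordinal lti = o0) //; apply: val_inj.
- by rewrite (_ : Ordinal lti = o1) //; apply: val_inj.
- by rewrite (_ : Ordinal lti = o2) //; apply: val_inj.
Qed.

Lemma det3 (A : comPzRingType) (X : 'M[A]_3) :
  \det X = X o0 o0 * (X o1 o1 * X o2 o2 - X o1 o2 * X o2 o1)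
         - X o0 o1 * (X o1 o0 * X o2 o2 - X o1 o2 * X o2 o0)
         + X o0 o2 * (X o1 o0 * X o2 o1 - X o1 o1 * X o2 o0).
Proof.
rewrite (expand_det_row _ ord0) sum3 /cofactor.
do ! rewrite (expand_det_row _ ord0) !big_ord_recl big_ord0 /cofactor !det_mx11.
rewrite !mxE /=.
(* The iterated minors address the same entry through different nestings of [lift]. Indexing by
   natural numbers lets these compute to one form, as [ring] requires. *)
pose Y (a b : nat) := X (inord a) (inord b).
have XE a b : X a b = Y a b by rewrite /Y !inord_val.
rewrite !XE /= /bump /=; ring.
Qed.

Section CurvatureDimension3.
Context {A : comPzRingType}.
Variables (half dethV : A) (h : 'M[A]_3) (Z : 'I_3 -> 'I_3 -> 'I_3 -> 'I_3 -> A).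
Hypothesis halfE : half + half = 1.
Hypothesis cometric_symE : forall i j, h i j = h j i.
Hypothesis dethVE : dethV * \det h = 1.
Hypothesis Zl : forall k j i l, Z k j i l = - Z j k i l.
Hypothesis Zr : forall k j i l, Z k j i l = - Z k j l i.
Hypothesis Z0 : forall i j, \sum_k \sum_l h l k * Z k j i l = 0.

(* The pair of indices complementary to a, in cyclic order, turns a tensor
   antisymmetric in two pairs of indices into a 3 x 3 matrix. *)
Let c1 (a : nat) : 'I_3 := match a with 0 => o1 | 1 => o2 | _ => o0 end.
Let c2 (a : nat) : 'I_3 := match a with 0 => o2 | 1 => o0 | _ => o1 end.
Let sg (a b : nat) : A := match a, b with
  | 1, 2 | 2, 0 | 0, 1 => 1 | 2, 1 | 0, 2 | 1, 0 => -1 | _, _ => 0 end.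
(** The third index when a and b differ; for a = b the value is arbitrary and is multiplied by
    [sg a b = 0]. *)
Let co (a b : nat) : nat := (3 - a - b)%N.

(** A tensor antisymmetric in both pairs has as many components as a 3 x 3 matrix, and so has its
    contraction. The linear map from one to the other is invertible because [h] is. *)
Lemma antisym_contraction0 k j i l : Z k j i l = 0.
Proof.
have Zk0 a b c : Z a a b c = 0.
  apply: (double_eq0 halfE); rewrite {2}Zl subrr //.
have Z0k a b c : Z b c a a = 0.
  apply: (double_eq0 halfE); rewrite {2}Zr subrr //.
pose G a b := Z (c1 a) (c2 a) (c1 b) (c2 b).
have Zlt a b c d : Z a b c d = sg a b * Z (c1 (co a b)) (c2 (co a b)) c d.
  move: a b; apply: ord3_ind; apply: ord3_ind;
    rewrite /sg /co /= ?Zk0 ?mul0r ?mul1r //; by rewrite Zl mulN1r.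
have Zrt a b c d : Z a b c d = sg c d * Z a b (c1 (co c d)) (c2 (co c d)).
  move: c d; apply: ord3_ind; apply: ord3_ind;
    rewrite /sg /co /= ?Z0k ?mul0r ?mul1r //; by rewrite Zr mulN1r.
have ZG a b c d : Z a b c d = sg a b * (sg c d * G (co a b) (co c d)).
  by rewrite Zlt Zrt.
pose e (a b : 'I_3) := \sum_k \sum_l h l k * (sg k b * (sg a l * G (co k b) (co a l))).
have e0 a b : e a b = 0.
  by rewrite -[RHS](Z0 a b); apply: eq_bigr => m _; apply: eq_bigr => p _; rewrite ZG.
(* The inverse of the contraction: 2 (det h) G = 2 h e h - tr (e h) h. It is a polynomial identity
   in each of the nine entries, and is stated doubled to avoid fractions. *)
have key (a b : 'I_3) : (\det h + \det h) * G a b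
    = \sum_i \sum_j (h a i * e i j * h j b + h a i * e i j * h j b)
      - (\sum_i \sum_j e i j * h j i) * h a b.
  rewrite det3 /e !sum3 /sg /co /= [h o1 o0]cometric_symE [h o2 o0]cometric_symE [h o2 o1]cometric_symE.
  move: a b; apply: ord3_ind; apply: ord3_ind;
    rewrite /= ?[h o1 o0]cometric_symE ?[h o2 o0]cometric_symE ?[h o2 o1]cometric_symE; ring.
have G0 (a b : 'I_3) : G a b = 0.
  apply: (double_eq0 halfE); rewrite -[G a b]mul1r -dethVE -mulrA -mulrDr -mulrDl.
  rewrite key big1 ?big1 ?mul0r ?subrr ?mulr0 // => m _; rewrite big1 // => p _.
    by rewrite e0 mul0r.
  by rewrite e0 mulr0 mul0r addr0.
(* [c1] and [c2] give every natural number from 2 on the pair of 2, so nine cases suffice for all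
   arguments of [G]. *)
have {}G0 a b : G a b = 0.
  case: a b => [|[|a]] [|[|b]]; first [exact: (G0 o0 o0) | exact: (G0 o0 o1)
    | exact: (G0 o0 o2) | exact: (G0 o1 o0) | exact: (G0 o1 o1)
    | exact: (G0 o1 o2) | exact: (G0 o2 o0) | exact: (G0 o2 o1)
    | exact: (G0 o2 o2)].
by rewrite ZG G0 !mulr0.
Qed.

End CurvatureDimension3.

Section RicciIdentity3.
Context {A : comPzRingType}.
Variables (D : 'I_3 -> {additive A -> A}) (half : A) (g h : 'M[A]_3).
Hypothesis halfE : half + half = 1.
Hypothesis DM : forall i x y, D i (x * y) = D i x * y + x * D i y.
Hypothesis DC : forall i j x, D i (D j x) = D j (D i x).
Hypothesis gh : g *m h = 1%:M.
Hypothesis gT : g^T = g.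

Local Notation Ric := (fricci D half g h).
Local Notation chr := (fchristoffel D half g h).
Local Notation hess := (fhessian D half g h).

Definition raise (u : 'I_3 -> A) (i : 'I_3) : A := \sum_j h i j * u j.

Lemma lower_raise u i : \sum_j g i j * raise u j = u i.
Proof.
transitivity (((g *m h) *m (\col_j u j)) i 0); last by rewrite gh mul1mx mxE.
rewrite -mulmxA mxE; apply: eq_bigr => j _; congr (_ * _).
by rewrite mxE; apply: eq_bigr => k _; rewrite mxE.
Qed.

Hypothesis scalar_curvature0 : \sum_i \sum_j h i j * Ric i j = 0.

Let RicC := fricciC halfE DM DC gh gT.
Let gC' := metric_symE gT.
Let hC' := cometric_symE gh gT.

(** The difference of the two sides has the antisymmetries of a curvature tensor and zero Ricci
    contraction, so [antisym_contraction0] applies. The general formula in dimension 3 has a further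
    term in the scalar curvature, which is zero here. *)
Lemma curvature3 k j i l : (curvature D half g h k j *m g) i l =
  g k l * Ric i j - g j l * Ric i k - g k i * Ric l j + g j i * Ric l k.
Proof.
apply/eqP; rewrite -subr_eq0; apply/eqP.
pose Y k j i l :=
  g k l * Ric i j - g j l * Ric i k - g k i * Ric l j + g j i * Ric l k.
rewrite -/(Y k j i l).
pose Z k j i l := (curvature D half g h k j *m g) i l - Y k j i l.
rewrite -/(Z k j i l).
apply: (antisym_contraction0 (h := h) halfE hC' (dethV := \det g)).
- by rewrite -det_mulmx gh det1.
- by move=> a b c d; rewrite /Z /Y curvatureC mulNmx oppmxE; ring.
- move=> a b c d; have /eqP := curvature_metric_antisym halfE DM DC gh gT a b.
  rewrite addr_eq0 => /eqP/matrixP/(_ c d); rewrite /Z /Y oppmxE => ->.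
  by rewrite [X in - X - _]mxE; ring.
move=> a b; have hgE := cometric_mul_metric gh; move/matrixP: (gh) => ghE; move/matrixP: hgE => hgE.
have E0 : \sum_c \sum_d h d c * (curvature D half g h c b *m g) a d = Ric a b.
  rewrite fricciE //; apply: eq_bigr => c _.
  transitivity ((curvature D half g h c b *m (g *m h)) a c).
    by rewrite mulmxA [RHS]mxE; apply: eq_bigr => d _; rewrite mulrC.
  by rewrite gh mulmx1.
have E1 : \sum_c \sum_d h d c * g c d = 1 + 1 + 1.
  transitivity (\sum_c (g *m h) c c).
    by apply: eq_bigr => c _; rewrite mxE; apply: eq_bigr => d _; rewrite mulrC.
  by rewrite gh sum3 !mxE.
have E2 : \sum_c \sum_d h d c * (g b d * Ric a c) = Ric a b.
  transitivity (\sum_c (g *m h) b c * Ric a c).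
    apply: eq_bigr => c _; rewrite mxE mulr_suml.
    by apply: eq_bigr => d _; ring.
  rewrite gh (bigD1 b) //= mxE eqxx mul1r big1 ?addr0 // => c /negPf nb.
  by rewrite mxE eq_sym nb mul0r.
have E3 : \sum_c \sum_d h d c * (g c a * Ric d b) = Ric a b.
  rewrite exchange_big /=.
  transitivity (\sum_d (h *m g) d a * Ric d b).
    apply: eq_bigr => d _; rewrite mxE mulr_suml.
    by apply: eq_bigr => c _; ring.
  rewrite (cometric_mul_metric gh) (bigD1 a) //= mxE eqxx mul1r big1 ?addr0 // => c /negPf nb.
  by rewrite mxE nb mul0r.
have E4 : \sum_c \sum_d h d c * (g b a * Ric d c) = 0.
  rewrite exchange_big /=; transitivity (g b a * \sum_d \sum_c h d c * Ric d c).
    rewrite mulr_sumr.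
    by apply: eq_bigr => d _; rewrite mulr_sumr; apply: eq_bigr => c _; ring.
  by rewrite scalar_curvature0 mulr0.
transitivity (\sum_c \sum_d h d c * (curvature D half g h c b *m g) a d
   - \sum_c \sum_d h d c * g c d * Ric a b
   + \sum_c \sum_d h d c * (g b d * Ric a c)
   + \sum_c \sum_d h d c * (g c a * Ric d b)
   - \sum_c \sum_d h d c * (g b a * Ric d c)).
  rewrite -!(sumrB, big_split) /=; apply: eq_bigr => c _.
  rewrite -!(sumrB, big_split) /=; apply: eq_bigr => d _.
  by rewrite /Z /Y; ring.
rewrite E0 E2 E3 E4; under eq_bigr do rewrite -mulr_suml.
by rewrite -mulr_suml E1; ring.
Qed.

(** The gain over [hessian_curvature] is that the right side contains only the Ricci tensor and df,
    both of which are known for type D. *)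
Lemma hessian_commutator f i j k :
  D k (hess f j i) - D j (hess f k i)
  - \sum_l chr l k i * hess f j l + \sum_l chr l j i * hess f k l
  = - (D k f * Ric i j - D j f * Ric i k
       - g k i * \sum_l Ric l j * raise (D^~ f) l
       + g j i * \sum_l Ric l k * raise (D^~ f) l).
Proof.
rewrite hessian_curvature //; congr (- _).
have -> : \sum_l curvature D half g h k j i l * D l f
    = \sum_m (curvature D half g h k j *m g) i m * raise (D^~ f) m.
  transitivity ((curvature D half g h k j *m (\col_l D l f)) i 0).
    by rewrite [RHS]mxE; apply: eq_bigr => l _; rewrite [(\col__ _) _ _]mxE.
  rewrite -[X in X *m _]mulmx1 -gh mulmxA -mulmxA mxE.
  apply: eq_bigr => m _; congr (_ * _).
  by rewrite mxE; apply: eq_bigr => l _; rewrite mxE.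
under eq_bigr do rewrite curvature3.
transitivity ((\sum_m g k m * raise (D^~ f) m) * Ric i j
  - (\sum_m g j m * raise (D^~ f) m) * Ric i k
  - g k i * \sum_l Ric l j * raise (D^~ f) l
  + g j i * \sum_l Ric l k * raise (D^~ f) l).
  by rewrite !sum3; ring.
by rewrite !lower_raise.
Qed.

End RicciIdentity3.

(** A certificate for deriving an equation from others: the coefficients are given by hand and the
    remaining goal is an identity for [ring]. *)
Lemma lincomb2 (A : comPzRingType) (c1 c2 x1 y1 x2 y2 x y : A) :
  x1 = y1 -> x2 = y2 -> x - y = c1 * (x1 - y1) + c2 * (x2 - y2) -> x = y.
Proof. by move=> -> -> /eqP; rewrite !subrr !mulr0 addr0 subr_eq0 => /eqP. Qed.

(** * Type D metrics, formally *)

Section TypeDHessian.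
Context {A : comPzRingType}.
Variables (D : 'I_3 -> {additive A -> A}) (half : A) (g h : 'M[A]_3).
Hypothesis halfE : half + half = 1.
Hypothesis DM : forall i x y, D i (x * y) = D i x * y + x * D i y.
Hypothesis DC : forall i j x, D i (D j x) = D j (D i x).
Hypothesis gh : g *m h = 1%:M.
Hypothesis gT : g^T = g.

Local Notation Ric := (fricci D half g h).
Local Notation chr := (fchristoffel D half g h).
Local Notation hess := (fhessian D half g h).

Variables (mu : A) (e : 'rV[A]_3).
Hypothesis e_unit : cometric h e e = 1.
Hypothesis RicE : forall i j, Ric i j = mu * (g i j - 3 * (e 0 i * e 0 j)).

Local Notation up u := (raise h u).
Local Notation E := (raise h (e 0)).
Local Notation beta k := (covder D half g h k e 0).

Let gC' := metric_symE gT.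
Let hC' := cometric_symE gh gT.

Lemma cometricE u w : cometric h u w = \sum_j raise h (u 0) j * w 0 j.
Proof.
rewrite /cometric mxE; apply: eq_bigr => j _; rewrite !mxE; congr (_ * _).
by apply: eq_bigr => k _; rewrite mulrC hC'.
Qed.

Lemma raise_dot (u w : 'I_3 -> A) : \sum_j up u j * w j = \sum_j u j * up w j.
Proof.
rewrite /raise !sum3 [h o1 o0]hC' [h o2 o0]hC' [h o2 o1]hC'; ring.
Qed.

Lemma raise_e_unit : \sum_j E j * e 0 j = 1.
Proof. by rewrite -cometricE. Qed.

Lemma lower_raise_e i : \sum_j g i j * E j = e 0 i.
Proof. exact: lower_raise. Qed.

Lemma covder_e_perp k : \sum_j E j * beta k j = 0.
Proof.
apply: (double_eq0 halfE).
have : D k (cometric h e e) = 0 by rewrite e_unit derivation1.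
rewrite (derivation_cometric halfE DM gh gT) (cometricC gh gT (covder _ _ _ _ _ _)).
by rewrite !cometricE.
Qed.

Lemma scalar_curvature0 : \sum_i \sum_j h i j * Ric i j = 0.
Proof.
have E1 : \sum_i \sum_j h i j * g i j = 3.
  transitivity (\sum_i (h *m g) i i).
    by apply: eq_bigr => i _; rewrite mxE; apply: eq_bigr => j _; rewrite gC'.
  by rewrite (cometric_mul_metric gh) sum3 !mxE !eqxx /=; ring.
under eq_bigr do under eq_bigr do rewrite RicE.
transitivity (mu * (\sum_i \sum_j h i j * g i j - 3 *
  (\sum_j E j * e 0 j))).
  by rewrite /raise !sum3; ring.
by rewrite E1 raise_e_unit; ring.
Qed.

Variables (f a b : A).
Hypothesis hessE : forall i j, hess f i j = a * g i j + b * (e 0 i * e 0 j).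

Local Notation u := (D^~ f).
Local Notation phi := (\sum_j E j * D j f).

(** The Ricci identity of [f] with the special forms of [Ric] and of the Hessian inserted; the
    derivatives of [g] cancel by metric compatibility. Everything below is read off from its
    contractions with the axis and with the inverse metric. *)
Lemma typeD_commutator i j k :
  D k a * g j i - D j a * g k i
  + D k b * e 0 j * e 0 i - D j b * e 0 k * e 0 i
  + b * (beta k j * e 0 i + e 0 j * beta k i - beta j k * e 0 i - e 0 k * beta j i)
  = - (2 * mu * u k * g j i - 2 * mu * u j * g k i
       - 3 * mu * u k * e 0 i * e 0 j + 3 * mu * u j * e 0 i * e 0 k
       + 3 * mu * phi * (g k i * e 0 j - g j i * e 0 k)).
Proof.
have rhoE c : \sum_l Ric l c * up u l = mu * (D c f - 3 * e 0 c * phi).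
  rewrite -(lower_raise gh u c).
  under eq_bigr do rewrite RicE gC'.
  have := raise_dot (e 0) u.
  by rewrite !sum3 => ->; ring.
have := hessian_commutator halfE DM DC gh gT scalar_curvature0 f i j k.
rewrite !rhoE !RicE.
under eq_bigr do rewrite hessE; under [X in _ + X = _ -> _]eq_bigr do rewrite hessE.
rewrite !hessE !raddfD /= !DM.
have De c d : D c (e 0 d) = beta c d + \sum_l chr l c d * e 0 l.
  rewrite /covder addmxE oppmxE [X in X - _]mxE [X in _ - X]mxE.
  under eq_bigr do rewrite !mxE mulrC.
  by rewrite subrK.
rewrite !De !(metric_compatE D halfE gh gT).
rewrite !sum3 ![chr _ j k](fchristoffelC _ _ _ gT).
move: (beta k) (beta j) => bk bj.
rewrite [g o0 i]gC' [g o1 i]gC' [g o2 i]gC'.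
rewrite [g i j]gC' [g i k]gC' .
move/eqP; rewrite -subr_eq0 => /eqP EE; apply: subr0_eq.
by etransitivity; last exact: EE; ring.
Qed.

Local Notation acc j := (\sum_k E k * beta k j).

Lemma typeD_curl k j : b * (beta k j - beta j k) =
  mu * (u k * e 0 j - u j * e 0 k)
  - (D k a + D k b) * e 0 j + (D j a + D j b) * e 0 k.
Proof.
have S : \sum_i E i * _ = \sum_i E i * _ :=
  eq_bigr _ (fun i _ => congr1 (fun x => E i * x) (typeD_commutator i j k)).
have LS : D k a * (\sum_i g j i * E i) - D j a * (\sum_i g k i * E i)
   + (D k b * e 0 j - D j b * e 0 k) * (\sum_i E i * e 0 i)
   + b * (beta k j * (\sum_i E i * e 0 i) + e 0 j * (\sum_i E i * beta k i)
          - beta j k * (\sum_i E i * e 0 i) - e 0 k * (\sum_i E i * beta j i))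
   = - (2 * mu * u k * (\sum_i g j i * E i) - 2 * mu * u j * (\sum_i g k i * E i)
        + (3 * mu * u j * e 0 k - 3 * mu * u k * e 0 j) * (\sum_i E i * e 0 i)
        + 3 * mu * phi * ((\sum_i g k i * E i) * e 0 j
                          - (\sum_i g j i * E i) * e 0 k)).
  etransitivity; last (etransitivity; first exact: S).
    by rewrite !sum3; move: (beta k) (beta j) => bk bj; ring.
  by rewrite !sum3; ring.
rewrite !lower_raise_e raise_e_unit !covder_e_perp in LS.
apply: subr0_eq; move/eqP: LS; rewrite -subr_eq0 => /eqP LS.
by etransitivity; last exact: LS; ring.
Qed.

Lemma typeD_acc j : b * acc j =
  D j a + D j b - mu * u j
  - (\sum_k E k * D k a + \sum_k E k * D k b - mu * phi) * e 0 j.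
Proof.
have S : \sum_k E k * _ = \sum_k E k * _ :=
  eq_bigr _ (fun k _ => congr1 (fun x => E k * x) (typeD_curl k j)).
have LS : b * (acc j - \sum_k E k * beta j k) =
  mu * (phi * e 0 j - u j * (\sum_k E k * e 0 k))
  - (\sum_k E k * D k a + \sum_k E k * D k b) * e 0 j
  + (D j a + D j b) * (\sum_k E k * e 0 k).
  etransitivity; last (etransitivity; first exact: S).
    by rewrite !sum3; ring.
  by rewrite !sum3; ring.
rewrite raise_e_unit covder_e_perp in LS.
rewrite subr0 in LS; rewrite LS; ring.
Qed.

(** The contraction of [typeD_commutator] with the axis in the index [k], where [typeD_acc] removes
    the derivatives of [a] and [b] along j. Thus b nabla e consists of an expansion term and an
    acceleration term only. *)
Lemma typeD_covder j i : b * beta j i =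
  (\sum_k E k * D k a - mu * phi) * (g j i - e 0 j * e 0 i)
  + e 0 j * (b * acc i).
Proof.
have S : \sum_k E k * _ = \sum_k E k * _ :=
  eq_bigr _ (fun k _ => congr1 (fun x => E k * x) (typeD_commutator i j k)).
have gE c : \sum_k E k * g k c = e 0 c.
  by rewrite -lower_raise_e; apply: eq_bigr => k _; rewrite mulrC gC'.
have LS : (\sum_k E k * D k a) * g j i - D j a * (\sum_k E k * g k i)
  + (\sum_k E k * D k b) * e 0 j * e 0 i - D j b * e 0 i * (\sum_k E k * e 0 k)
  + b * (acc j * e 0 i + e 0 j * acc i - (\sum_k E k * beta j k) * e 0 i
         - beta j i * (\sum_k E k * e 0 k))
  = - (2 * mu * phi * g j i - 2 * mu * u j * (\sum_k E k * g k i)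
       - 3 * mu * phi * e 0 i * e 0 j
       + 3 * mu * u j * e 0 i * (\sum_k E k * e 0 k)
       + 3 * mu * phi * ((\sum_k E k * g k i) * e 0 j
                         - g j i * (\sum_k E k * e 0 k))).
  etransitivity; last (etransitivity; first exact: S).
    by rewrite !sum3; ring.
  by rewrite !sum3; ring.
rewrite raise_e_unit covder_e_perp !gE in LS.
apply: (lincomb2 (c1 := -1) (c2 := e 0 i) LS (typeD_acc j)); ring.
Qed.

(** The trace of [typeD_commutator] over [j] and [i]. The divergence of e comes from [typeD_covder],
    where the projector orthogonal to e has trace 2, and the acceleration from [typeD_acc]. *)
Lemma typeD_gradient k : D k a + 2 * mu * u k =
  (\sum_j E j * D j a + 2 * mu * phi) * e 0 k.
Proof.
have S : \sum_j \sum_i h j i * _ = \sum_j \sum_i h j i * _ :=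
  eq_bigr _ (fun j _ => eq_bigr _ (fun i _ =>
    congr1 (fun x => h j i * x) (typeD_commutator i j k))).
have gE c : \sum_k E k * g k c = e 0 c.
  by rewrite -lower_raise_e; apply: eq_bigr => m _; rewrite mulrC gC'.
have hg3 : \sum_j \sum_i h j i * g j i = 3.
  transitivity (\sum_i (h *m g) i i).
    by apply: eq_bigr => i _; rewrite mxE; apply: eq_bigr => j _; rewrite gC'.
  by rewrite (cometric_mul_metric gh) sum3 !mxE !eqxx /=; ring.
have hgk (x : 'I_3 -> A) : \sum_j \sum_i h j i * (x j * g k i) = x k.
  rewrite -[RHS](lower_raise gh x k) /raise.
  rewrite exchange_big; apply: eq_bigr => i _; rewrite mulr_sumr.
  by apply: eq_bigr => j _; rewrite [h i j]hC'; ring.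
have hee (x : 'I_3 -> A) : \sum_j \sum_i h j i * (x j * e 0 i) = \sum_j E j * x j.
  rewrite raise_dot -[RHS]raise_dot /raise; apply: eq_bigr => j _.
  by rewrite mulr_suml; apply: eq_bigr => i _; ring.
have hex (x : 'I_3 -> A) : \sum_j \sum_i h j i * (x i * e 0 j) = \sum_j E j * x j.
  rewrite -hee exchange_big; apply: eq_bigr => i _; apply: eq_bigr => j _.
  by rewrite hC'.
have LS : D k a * (\sum_j \sum_i h j i * g j i)
  - (\sum_j \sum_i h j i * (D j a * g k i))
  + D k b * (\sum_j \sum_i h j i * (e 0 j * e 0 i))
  - (\sum_j \sum_i h j i * (D j b * e 0 i)) * e 0 k
  + b * ((\sum_j \sum_i h j i * (beta k j * e 0 i))
         + (\sum_j \sum_i h j i * (beta k i * e 0 j))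
         - (\sum_j \sum_i h j i * (beta j k * e 0 i)))
  - e 0 k * (\sum_j \sum_i h j i * (b * beta j i))
  = - (2 * mu * u k * (\sum_j \sum_i h j i * g j i)
       - 2 * mu * (\sum_j \sum_i h j i * (u j * g k i))
       - 3 * mu * u k * (\sum_j \sum_i h j i * (e 0 j * e 0 i))
       + 3 * mu * (\sum_j \sum_i h j i * (u j * e 0 i)) * e 0 k
       + 3 * mu * phi * ((\sum_j \sum_i h j i * (e 0 j * g k i))
                   - (\sum_j \sum_i h j i * g j i) * e 0 k)).
  etransitivity; last (etransitivity; first exact: S).
    rewrite !sum3; move: (beta k) (fun i => beta i k) => bk bj.
    by ring.
  by rewrite !sum3; ring.
have div : \sum_j \sum_i h j i * (b * beta j i)
    = 2 * (\sum_j E j * D j a - mu * phi).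
  under eq_bigr do under eq_bigr do rewrite typeD_covder.
  have expand x (y : 'I_3 -> A) :
      \sum_j \sum_i h j i * (x * (g j i - e 0 j * e 0 i) + e 0 j * (b * y i))
    = x * (\sum_j \sum_i h j i * g j i
           - \sum_j \sum_i h j i * (e 0 j * e 0 i))
    + b * (\sum_j \sum_i h j i * (y i * e 0 j)).
    by rewrite !sum3; ring.
  rewrite expand hg3 hee hex raise_e_unit.
  have -> : \sum_i E i * acc i = 0.
    under eq_bigr do rewrite mulr_sumr; rewrite exchange_big big1 // => k' _.
    under eq_bigr do rewrite mulrCA; by rewrite -mulr_sumr covder_e_perp mulr0.
  ring.
rewrite !hgk hg3 !hee !hex !raise_e_unit !covder_e_perp div in LS.
apply: (lincomb2 (c1 := 1) (c2 := 1) LS (typeD_acc k)); ring.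
Qed.

End TypeDHessian.

Lemma lincomb1 (A : comPzRingType) (c x1 y1 x y : A) :
  x1 = y1 -> x - y = c * (x1 - y1) -> x = y.
Proof. by move=> -> /eqP; rewrite subrr mulr0 subr_eq0 => /eqP. Qed.

Lemma lincomb3 (A : comPzRingType) (c1 c2 c3 x1 y1 x2 y2 x3 y3 x y : A) :
  x1 = y1 -> x2 = y2 -> x3 = y3 ->
  x - y = c1 * (x1 - y1) + c2 * (x2 - y2) + c3 * (x3 - y3) -> x = y.
Proof.
by move=> -> -> -> /eqP; rewrite !subrr !mulr0 !addr0 subr_eq0 => /eqP.
Qed.

Lemma scalemxE (R : pzSemiRingType) m n (a : R) (X : 'M[R]_(m, n)) i j :
  (a *: X) i j = a * X i j.
Proof. by rewrite mxE. Qed.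

(** * The functions N and F on a type D metric *)

Section CovariantLeibniz.
Context {A : comPzRingType} {n : nat}.
Variables (D : 'I_n -> {additive A -> A}) (half : A) (g h : 'M[A]_n).
Hypothesis DM : forall i x y, D i (x * y) = D i x * y + x * D i y.
Local Notation hess := (fhessian D half g h).

Lemma covderD k u w :
  covder D half g h k (u + w) = covder D half g h k u + covder D half g h k w.
Proof. by rewrite /covder raddfD mulmxDl opprD addrACA. Qed.

Lemma covderZ k x u :
  covder D half g h k (x *: u) = D k x *: u + x *: covder D half g h k u.
Proof.
rewrite /covder -scalemxAl scalerBr addrA; congr (_ - _).
by apply/rowP=> i; rewrite !mxE DM.
Qed.

Lemma hessian_covder f i j : hess f i j = covder D half g h i (differential D f) 0 j.
Proof. by rewrite covder_differential mxE. Qed.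

Lemma hessian_exp N U i j : (forall i, D i N = N * D i U) ->
  hess N i j = N * (hess U i j + D i U * D j U).
Proof.
move=> DN; rewrite !hessian_covder.
have -> : differential D N = N *: differential D U.
  by apply/rowP=> k; rewrite !mxE.
rewrite covderZ addmxE !scalemxE DN (_ : differential D U 0 j = D j U); first ring.
by rewrite mxE.
Qed.

End CovariantLeibniz.

Section TypeDPotential.
Context {A : comPzRingType}.
Variables (D : 'I_3 -> {additive A -> A}) (half third : A) (g h : 'M[A]_3).
Hypothesis halfE : half + half = 1.
Hypothesis thirdE : third * 3 = 1.
Hypothesis DM : forall i x y, D i (x * y) = D i x * y + x * D i y.
Hypothesis DC : forall i j x, D i (D j x) = D j (D i x).
Hypothesis gh : g *m h = 1%:M.
Hypothesis gT : g^T = g.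

Local Notation Ric := (fricci D half g h).
Local Notation hess := (fhessian D half g h).

Variables (mu muV : A) (e : 'rV[A]_3).
Hypothesis muVE : muV * mu = 1.
Hypothesis e_unit : cometric h e e = 1.
Hypothesis RicE : forall i j, Ric i j = mu * (g i j - 3 * (e 0 i * e 0 j)).

Variables (F FV : A).
Hypothesis FVE : FV * F = 1.
(** This is the differential form of the statement that mu F^3 is constant. *)
Hypothesis DF : forall i, 3 * mu * D i F = - F * D i mu.

Local Notation E := (raise h (e 0)).
Local Notation beta k := (covder D half g h k e 0).
Local Notation dF := (differential D F).
Local Notation dF2 := (cometric h dF dF).

Hypothesis e_mu : \sum_j E j * D j mu = 0.

(** The ring is not a domain, so a factor is cancelled by exhibiting its inverse. *)
Lemma cancel_unit (x xV y z : A) : xV * x = 1 -> x * y = x * z -> y = z.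
Proof. by move=> xVx xyz; rewrite -[y]mul1r -xVx -mulrA xyz mulrA xVx mul1r. Qed.

Lemma derivation_inv (x xV : A) i : xV * x = 1 -> D i xV = - (xV * xV * D i x).
Proof.
move=> xVx; apply: (cancel_unit xVx).
have := congr1 (D i) xVx; rewrite DM (derivation1 DM) => E1.
by apply: (lincomb2 (c1 := 1) (c2 := D i x * xV) E1 xVx); ring.
Qed.

Lemma derivation_eigenvalue i : D i mu = - (3 * mu * FV * D i F).
Proof.
apply: (cancel_unit FVE).
by apply: (lincomb2 (c1 := 1) (c2 := 3 * mu * D i F) (DF i) FVE); ring.
Qed.

Lemma cancel_3mu x y : 3 * mu * x = 3 * mu * y -> x = y.
Proof.
apply: (cancel_unit (xV := muV * third)).
by apply: (lincomb2 (c1 := third * 3) (c2 := 1) muVE thirdE); ring.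
Qed.

Let derivationD i x y : D i (x + y) = D i x + D i y.
Proof. exact: raddfD. Qed.

Lemma axis_F : \sum_j E j * D j F = 0.
Proof.
apply: cancel_3mu; rewrite mulr0.
transitivity (- F * \sum_j E j * D j mu); last by rewrite e_mu mulr0.
by rewrite !mulr_sumr; apply: eq_bigr => j _; rewrite mulrCA DF; ring.
Qed.

Section Potential.
Variables (N NV : A).
Hypothesis NVE : NV * N = 1.
Hypothesis hessN : forall i j, hess N i j = N * Ric i j.

Local Notation phi := (\sum_j E j * D j N).

Let hessNE i j :
  hess N i j = N * mu * g i j + (- (N * mu *+ 3)) * (e 0 i * e 0 j).
Proof. by rewrite hessN RicE; ring. Qed.

Let e_Nmu : \sum_j E j * D j (N * mu) = mu * phi.
Proof.
transitivity (\sum_j (mu * (E j * D j N) + N * (E j * D j mu))).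
  by apply: eq_bigr => j _; rewrite !DM; ring.
by rewrite !big_split -!mulr_sumr /= e_mu mulr0 addr0.
Qed.

Let e_Nmu3 : \sum_j E j * D j (- (N * mu *+ 3)) = - (3 * mu * phi).
Proof.
transitivity (- (3 * \sum_j E j * D j (N * mu))).
  rewrite mulr_sumr -sumrN.
  by apply: eq_bigr => j _; rewrite raddfN raddfMn /=; ring.
by rewrite e_Nmu; ring.
Qed.

(** For a = N mu, [typeD_gradient] reads 3 mu dN + N dmu = 3 mu phi e, because e(N mu) = mu phi. The
    relation between dF and dmu turns N dmu into - 3 mu N F^-1 dF. *)
Lemma dN_split k : D k N = N * FV * D k F + phi * e 0 k.
Proof.
apply: cancel_3mu.
have G := typeD_gradient halfE DM DC gh gT e_unit RicE hessNE k.
rewrite e_Nmu DM in G.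
by apply: (lincomb2 (c1 := 1) (c2 := - N) G (derivation_eigenvalue k)); ring.
Qed.

(** Here e(mu) = 0 acts twice: it makes e(N mu) equal to mu phi, so the expansion term of
    [typeD_covder] vanishes, and it leaves - F^-1 dF as the acceleration. The coefficient b = - 3 N
    mu is a unit and can be cancelled. *)
Lemma covder_e j i : beta j i = - (e 0 j * FV * D i F).
Proof.
have bV : (- (NV * muV * third)) * (- (N * mu *+ 3)) = 1.
  by apply: (lincomb3 (c1 := third * 3 * muV * mu) (c2 := third * 3) (c3 := 1)
    NVE muVE thirdE); ring.
apply: (cancel_unit bV).
rewrite (typeD_covder halfE DM DC gh gT e_unit RicE hessNE).
rewrite (typeD_acc halfE DM DC gh gT e_unit RicE hessNE).
rewrite e_Nmu e_Nmu3 raddfN raddfMn /= DM dN_split derivation_eigenvalue; ring.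
Qed.

Lemma raise_e_u (u : 'rV[A]_3) : \sum_i E i * u 0 i = cometric h e u.
Proof. by rewrite -(cometricE gh gT). Qed.

(** Differentiate e(F) = 0 and insert the formula for nabla e. *)
Lemma hess_F_e j : \sum_i E i * hess F j i = e 0 j * FV * dF2.
Proof.
have : D j (cometric h e dF) = 0.
  have -> : cometric h e dF = 0; last exact: raddf0.
  by rewrite -raise_e_u -[RHS]axis_F; apply: eq_bigr => i _; rewrite mxE.
rewrite (derivation_cometric halfE DM gh gT) covder_differential -raise_e_u.
have -> : \sum_i E i * (\row_i0 hess F j i0) 0 i = \sum_i E i * hess F j i.
  by apply: eq_bigr => i _; rewrite mxE.
have -> : covder D half g h j e = - (e 0 j * FV) *: dF.
  by apply/rowP=> i; rewrite covder_e !mxE mulNr.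
have -> : cometric h (- (e 0 j * FV) *: dF) dF = - (e 0 j * FV) * dF2.
  by rewrite /cometric -!scalemxAl scalemxE.
by move/eqP; rewrite addrC mulNr subr_eq0 => /eqP.
Qed.

(** Differentiate dN = N F^-1 dF + phi e. The derivative of N F^-1 is phi F^-1 e, and its product
    with dF cancels the contribution of phi nabla e. *)
Lemma hessN_split j i :
  N * Ric j i = N * FV * hess F j i + D j phi * e 0 i.
Proof.
rewrite -hessN hessian_covder.
have -> : differential D N = (N * FV) *: dF + phi *: e.
  by apply/rowP=> k; rewrite !mxE dN_split.
rewrite covderD !(covderZ _ _ _ DM) covder_differential.
have -> : covder D half g h j e = - (e 0 j * FV) *: dF.
  by apply/rowP=> k; rewrite covder_e !mxE mulNr.
rewrite !mxE DM (derivation_inv _ FVE) dN_split; ring.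
Qed.

(** Both Hessians and [Ric] are symmetric, so in [hessN_split] the product of dphi and e is
    symmetric and dphi = psi e. Contracting twice with the axis determines psi, since the value of
    Ric on e is - 2 mu and that of the Hessian of F is known from [hess_F_e]. *)
Theorem hessian_F_of_potential j i :
  hess F j i = F * (Ric j i + (2 * mu + FV * FV * dF2) * (e 0 j * e 0 i)).
Proof.
have RicC := fricciC halfE DM DC gh gT.
have Nsym a b : D a phi * e 0 b = D b phi * e 0 a.
  have HC : hess F b a = hess F a b by exact: fhessianC.
  have := hessN_split b a; rewrite RicC HC hessN_split.
  by move/addrI.
pose psi := \sum_b E b * D b phi.
have ee1 := raise_e_unit gh gT e_unit.
have Dphi a : D a phi = psi * e 0 a.
  rewrite -[LHS]mulr1 -ee1 mulr_sumr /psi mulr_suml; apply: eq_bigr => b _.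
  by rewrite mulrCA -Nsym; ring.
have RE a : \sum_b E b * Ric a b = - (2 * mu * e 0 a).
  under eq_bigr do rewrite RicE.
  have := lower_raise_e gh e a; move: ee1; rewrite !sum3 => e1 e2.
  by apply: (lincomb2 (c1 := - (3 * mu * e 0 a)) (c2 := mu) e1 e2); ring.
have psiE : psi = - N * (2 * mu + FV * FV * dF2).
  have S a : N * (\sum_b E b * Ric a b)
      = N * FV * (\sum_b E b * hess F a b) + D a phi * (\sum_b E b * e 0 b).
    rewrite !mulr_sumr -big_split; apply: eq_bigr => b _ /=.
    by rewrite mulrCA hessN_split; ring.
  have S2 : \sum_a E a * _ = \sum_a E a * _ := eq_bigr _ (fun a _ => congr1 (fun x => E a * x) (S a)).
  rewrite ee1 in S2.
  transitivity (psi * \sum_a E a * e 0 a); first by rewrite ee1 mulr1.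
  have {}S2 : \sum_a E a * (N * - (2 * mu * e 0 a)) = \sum_a E a * (N * FV * (e 0 a * FV * dF2) + psi * e 0 a * 1).
    etransitivity; last (etransitivity; first exact: S2).
      by apply: eq_bigr => a _; rewrite RE.
    by apply: eq_bigr => a _; rewrite hess_F_e Dphi.
  transitivity (- N * (2 * mu + FV * FV * dF2) * \sum_a E a * e 0 a); last by rewrite ee1 mulr1.
  apply: (lincomb1 (c := -1) S2); rewrite !sum3; ring.
have xV : (NV * F) * (N * FV) = 1.
  by apply: (lincomb2 (c1 := F * FV) (c2 := 1) NVE FVE); ring.
apply: (cancel_unit xV).
have H := hessN_split j i; rewrite Dphi psiE in H.
apply: (lincomb2 (c1 := -1) (c2 := - N * (Ric j i + (2 * mu + FV * FV * dF2) * (e 0 j * e 0 i))) H FVE).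
ring.
Qed.

End Potential.

Section Reconstruction.
Hypothesis reduced : forall x : A, x * x = 0 -> x = 0.
Hypothesis hessF : forall i j, hess F i j =
  F * (Ric i j + (2 * mu + FV * FV * dF2) * (e 0 i * e 0 j)).

(** With these coefficients the equation of F has the form a g + b e e, so the results on type D
    Hessians apply to F itself. In contrast to the case of N, [b] need not be invertible. *)
Let a := F * mu.
Let b := FV * dF2 - F * mu.

Let hessFE i j : hess F i j = a * g i j + b * (e 0 i * e 0 j).
Proof.
rewrite hessF RicE /a /b.
by apply: (lincomb1 (c := FV * dF2 * (e 0 i * e 0 j)) FVE); ring.
Qed.

Let Da j : D j a = - (2 * mu * D j F).
Proof.
rewrite /a DM derivation_eigenvalue.
by apply: (lincomb1 (c := - (3 * mu * D j F)) FVE); ring.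
Qed.

Let raise_dF k : raise h (dF 0) k = raise h (D^~ F) k.
Proof. by apply: eq_bigr => m _; rewrite mxE. Qed.

Let e_dF : \sum_k raise h (D^~ F) k * e 0 k = 0.
Proof.
by rewrite (raise_dot gh gT) -[RHS]axis_F; apply: eq_bigr => k _; rewrite mulrC.
Qed.

Lemma derivation_dF2 j : D j dF2 = 2 * a * D j F.
Proof.
rewrite (derivation_cometric halfE DM gh gT) covder_differential.
rewrite (cometricC gh gT (\row__ _)) !(cometricE gh gT).
have -> : \sum_k raise h (dF 0) k * (\row_i hess F j i) 0 k = a * D j F.
  transitivity (a * \sum_k g j k * raise h (D^~ F) k
                + b * e 0 j * \sum_k raise h (D^~ F) k * e 0 k).
    rewrite !mulr_sumr -big_split; apply: eq_bigr => k _ /=.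
    by rewrite mxE hessFE raise_dF; ring.
  by rewrite lower_raise // e_dF mulr0 addr0.
ring.
Qed.

(** Since dF is orthogonal to e, the differential of |dF|^2 is 2 F mu dF, while mu F^2 has the
    differential - F mu dF. *)
Lemma kappa_const j : D j (2 * mu * F * F + dF2) = 0.
Proof.
have D2 : D j 2 = 0 by rewrite raddfMn derivation1 // mul0rn.
rewrite raddfD /= !DM D2 derivation_eigenvalue.
apply: (lincomb2 (c1 := 1) (c2 := - (6 * mu * D j F * F)) (derivation_dF2 j) FVE).
by rewrite /a; ring.
Qed.

Lemma derivation_ab j : D j a + D j b = (2 * mu - FV * FV * dF2) * D j F.
Proof.
have -> : D j a + D j b = D j (FV * dF2).
  by rewrite -derivationD; congr (D j _); rewrite /b /a; ring.
rewrite DM derivation_dF2 (derivation_inv _ FVE) /a.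
by apply: (lincomb1 (c := 2 * mu * D j F) FVE); ring.
Qed.

(** The argument of [covder_e] with F in place of N; now phi = e(F) = 0 and e(a) = 0, so again only
    the acceleration survives, but the factor [b] has to stay. *)
Lemma b_covder_e j i : b * (beta j i + e 0 j * FV * D i F) = 0.
Proof.
have e_DF c : \sum_k E k * (c * D k F) = 0.
  by under eq_bigr do rewrite mulrCA; rewrite -mulr_sumr axis_F mulr0.
have e_a : \sum_k E k * D k a = 0.
  rewrite -[RHS](e_DF (- (2 * mu))); apply: eq_bigr => k _.
  by rewrite Da mulNr.
have e_ab : \sum_k E k * D k a + \sum_k E k * D k b = 0.
  rewrite -big_split -[RHS](e_DF (2 * mu - FV * FV * dF2)) /=.
  by apply: eq_bigr => k _; rewrite -mulrDr derivation_ab.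
rewrite mulrDr (typeD_covder halfE DM DC gh gT e_unit RicE hessFE).
rewrite (typeD_acc halfE DM DC gh gT e_unit RicE hessFE).
rewrite e_ab e_a axis_F derivation_ab /b.
by apply: (lincomb1 (c := - (mu * e 0 j * D i F)) FVE); ring.
Qed.

(* [b] may vanish, but not together with its differential: differentiating
   [b * x = 0] shows that [x] vanishes there too. *)
Lemma reconstructed_covder_e j i : beta j i = - (e 0 j * FV * D i F).
Proof.
apply/eqP; rewrite -addr_eq0; apply/eqP; set x := _ + _.
have bx : b * x = 0 by exact: b_covder_e.
have Db k : D k b = (4 * mu - FV * FV * dF2) * D k F.
  by apply: (lincomb2 (c1 := 1) (c2 := -1) (derivation_ab k) (Da k)); ring.
have Dbx k : D k b * (x * x) = 0.
  have := congr1 (D k) bx; rewrite DM raddf0 => E1.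
  by apply: (lincomb2 (c1 := x) (c2 := - D k x) E1 bx); ring.
(* On multiples of x the relation b x = 0 replaces F^-2 |dF|^2 by mu, which turns the coefficient 4
   mu - F^-2 |dF|^2 of db into 3 mu, a unit. *)
have xxDF k : x * x * D k F = 0.
  apply: cancel_3mu; rewrite mulr0.
  have E1 := Dbx k; rewrite Db in E1.
  apply: (lincomb3 (c1 := 1) (c2 := FV * x * D k F) (c3 := mu * (x * x * D k F)) E1 bx FVE).
  by rewrite /b; ring.
have xxdF2 : x * x * dF2 = 0.
  rewrite (cometricE gh gT) mulr_sumr big1 // => k _.
  by rewrite mxE mulrCA xxDF mulr0.
apply: reduced; apply: (cancel_unit muVE); apply: (cancel_unit FVE); rewrite !mulr0.
by apply: (lincomb2 (c1 := FV) (c2 := - x) xxdF2 bx); rewrite /b; ring.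
Qed.

(** The derivative of F^-1 supplies the transpose of the term - F^-2 e dF that comes from nabla e,
    so the sum is symmetric in i and j. *)
Lemma e_over_F_closed i j : D j (FV * e 0 i) = D i (FV * e 0 j).
Proof.
have De c d : D c (e 0 d) =
    - (e 0 c * FV * D d F) + \sum_l fchristoffel D half g h l c d * e 0 l.
  rewrite -reconstructed_covder_e /covder addmxE oppmxE [X in X - _]mxE.
  rewrite [X in _ - X]mxE; under eq_bigr do rewrite !mxE mulrC.
  by rewrite subrK.
rewrite !DM !(derivation_inv _ FVE) !De.
under eq_bigr do rewrite fchristoffelC //.
ring.
Qed.

(** [c1] is the derivative of [c] with respect to theta. As F dtheta = e, one has dN = c dF + c1 e;
    in its covariant derivative the terms with c1 cancel, and - kappa c F^-1 e e removes the extra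
    term of the equation of F. *)
Lemma potential_of_hessian_F theta c c1 kappa i j :
  kappa = 2 * mu * F * F + dF2 ->
  (forall k, D k theta = FV * e 0 k) ->
  (forall k, D k c = c1 * D k theta) ->
  (forall k, D k c1 = - kappa * c * D k theta) ->
  hess (F * c) i j = F * c * Ric i j.
Proof.
move=> kE Dt Dc Dc1.
have dN : differential D (F * c) = c *: dF + c1 *: e.
  apply/rowP=> k; rewrite !mxE DM Dc Dt.
  by apply: (lincomb1 (c := c1 * e 0 k) FVE); ring.
rewrite hessian_covder dN covderD !(covderZ _ _ _ DM) covder_differential.
have -> : covder D half g h i e = - (e 0 i * FV) *: dF.
  by apply/rowP=> k; rewrite reconstructed_covder_e !mxE mulNr.
rewrite !mxE Dc Dc1 !Dt hessF kE.
apply: (lincomb1 (c := c * (FV * dF2 - 2 * mu * F) * (e 0 i * e 0 j)) FVE).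
ring.
Qed.

End Reconstruction.
End TypeDPotential.

(** * Ricci tensor of a static metric *)

Section StaticRicci.
Context {A : comPzRingType} {n : nat}.
Variables (D : 'I_n -> {additive A -> A}) (half : A) (g h : 'M[A]_n).
Hypothesis halfE : half + half = 1.
Hypothesis DM : forall i x y, D i (x * y) = D i x * y + x * D i y.
Hypothesis DC : forall i j x, D i (D j x) = D j (D i x).
Hypothesis gh : g *m h = 1%:M.
Hypothesis gT : g^T = g.
Variables (U w wV : A).
Hypothesis wVE : wV * w = 1.
Hypothesis Dw : forall i, D i w = 2 * w * D i U.

Local Notation chr := (fchristoffel D half g h).
Local Notation Ric := (fricci D half g h).
Local Notation hess := (fhessian D half g h).

(* the functions at hand do not depend on the time coordinate *)
Definition static_derivation (i : 'I_(1 + n)) : {additive A -> A} :=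
  match fintype.split i with inl _ => \0 | inr j => D j end.

Let D4 := static_derivation.
Let g4 : 'M[A]_(1 + n) := block_mx (- w)%:M 0 0 g.
Let h4 : 'M[A]_(1 + n) := block_mx (- wV)%:M 0 0 h.

Local Notation chr4 := (fchristoffel D4 half g4 h4).
Local Notation Ric4 := (fricci D4 half g4 h4).
Local Notation z := (lshift n (ord0 : 'I_1)).
Local Notation r := (rshift 1).
Local Notation upU k := (\sum_l h k l * D l U).

Lemma D4z x : D4 z x = 0.
Proof. by rewrite /D4 /static_derivation; case: split_ordP => // j /eqP. Qed.

Lemma D4r i x : D4 (r i) x = D i x.
Proof.
rewrite /D4 /static_derivation; case: split_ordP => j; first by move/eqP; rewrite eq_rlshift.
by move/rshift_inj ->.
Qed.

Let g4zz : g4 z z = - w. Proof. by rewrite block_mxEul mxE. Qed.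
Let g4zr i : g4 z (r i) = 0. Proof. by rewrite block_mxEur mxE. Qed.
Let g4rz i : g4 (r i) z = 0. Proof. by rewrite block_mxEdl mxE. Qed.
Let g4rr i j : g4 (r i) (r j) = g i j. Proof. by rewrite block_mxEdr. Qed.
Let h4zz : h4 z z = - wV. Proof. by rewrite block_mxEul mxE. Qed.
Let h4zr i : h4 z (r i) = 0. Proof. by rewrite block_mxEur mxE. Qed.
Let h4rz i : h4 (r i) z = 0. Proof. by rewrite block_mxEdl mxE. Qed.
Let h4rr i j : h4 (r i) (r j) = h i j. Proof. by rewrite block_mxEdr. Qed.
Let entries := (g4zz, g4zr, g4rz, g4rr, h4zz, h4zr, h4rz, h4rr, D4z, D4r).

Let sum4 (F : 'I_(1 + n) -> A) : \sum_i F i = F z + \sum_i F (r i).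
Proof. by rewrite big_split_ord /= big_ord1. Qed.

Let Dw2 k : half * D k w = w * D k U.
Proof. by rewrite Dw; apply: (lincomb1 (c := w * D k U) halfE); ring. Qed.

Let D0 k : D k 0 = 0. Proof. exact: raddf0. Qed.
Let DN k x : D k (- x) = - D k x. Proof. exact: raddfN. Qed.

Lemma chr4_zzz : chr4 z z z = 0.
Proof.
rewrite /fchristoffel sum4 !entries; under eq_bigr do rewrite !entries mul0r.
by rewrite big1 // ; ring.
Qed.

Lemma chr4_zzr i : chr4 z z (r i) = D i U.
Proof.
rewrite /fchristoffel sum4 !entries; under eq_bigr do rewrite !entries mul0r.
rewrite big1 // DN.
by apply: (lincomb2 (c1 := wV) (c2 := D i U) (Dw2 i) wVE); ring.
Qed.

Lemma chr4_zrz i : chr4 z (r i) z = D i U.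
Proof.
rewrite /fchristoffel sum4 !entries; under eq_bigr do rewrite !entries mul0r.
rewrite big1 // DN.
by apply: (lincomb2 (c1 := wV) (c2 := D i U) (Dw2 i) wVE); ring.
Qed.

Lemma chr4_zrr i j : chr4 z (r i) (r j) = 0.
Proof.
rewrite /fchristoffel sum4 !entries; under eq_bigr do rewrite !entries mul0r.
by rewrite big1 // !D0; ring.
Qed.

Lemma chr4_rzz k : chr4 (r k) z z = w * upU k.
Proof.
rewrite /fchristoffel sum4 !entries.
rewrite mul0r add0r !mulr_sumr; apply: eq_bigr => l _.
rewrite !entries !DN.
by apply: (lincomb1 (c := h k l) (Dw2 l)); ring.
Qed.

Lemma chr4_rzr k i : chr4 (r k) z (r i) = 0.
Proof.
rewrite /fchristoffel sum4 !entries big1; first by ring.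
by move=> l _; rewrite !entries !D0; ring.
Qed.

Lemma chr4_rrz k i : chr4 (r k) (r i) z = 0.
Proof.
rewrite /fchristoffel sum4 !entries big1; first by ring.
by move=> l _; rewrite !entries !D0; ring.
Qed.

Lemma chr4_rrr k i j : chr4 (r k) (r i) (r j) = chr k i j.
Proof.
rewrite /fchristoffel sum4 !entries mul0r add0r; congr (_ * _).
by apply: eq_bigr => l _; rewrite !entries.
Qed.

Let chr4E := (chr4_zzz, chr4_zzr, chr4_zrz, chr4_zrr, chr4_rzz, chr4_rzr,
  chr4_rrz, chr4_rrr).

Let sum44 (F : 'I_(1 + n) -> 'I_(1 + n) -> A) : \sum_i \sum_j F i j =
  F z z + \sum_j F z (r j) + \sum_i F (r i) z + \sum_i \sum_j F (r i) (r j).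
Proof.
rewrite sum4 [X in X + _ = _]sum4 (eq_bigr _ (fun i _ => sum4 _)).
by rewrite big_split /= !addrA.
Qed.

(** In terms of N = exp U the subtracted terms are N^-1 nabla dN. *)
Lemma static_ricci_rr i j :
  Ric4 (r i) (r j) = Ric i j - hess U i j - D i U * D j U.
Proof.
rewrite /fricci.
have -> : \sum_k D4 k (chr4 k (r i) (r j)) = \sum_k D k (chr k i j).
  rewrite sum4 D4z add0r; apply: eq_bigr => k _; by rewrite D4r chr4E.
have -> : \sum_k D4 (r j) (chr4 k (r i) k) = D j (D i U) + \sum_k D j (chr k i k).
  rewrite sum4 D4r chr4E; congr (_ + _); apply: eq_bigr => k _.
  by rewrite D4r chr4E.
have -> : \sum_k \sum_l chr4 k k l * chr4 l (r i) (r j)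
    = \sum_l chr l i j * D l U + \sum_k \sum_l chr k k l * chr l i j.
  rewrite sum44 !chr4E mulr0 add0r [X in _ + X + _]big1 => [|k _]; last first.
    by rewrite !chr4E mul0r.
  rewrite addr0; congr (_ + _).
    by apply: eq_bigr => l _; rewrite !chr4E mulrC.
  by apply: eq_bigr => k _; apply: eq_bigr => l _; rewrite !chr4E.
have -> : \sum_k \sum_l chr4 k (r j) l * chr4 l (r i) k
    = D i U * D j U + \sum_k \sum_l chr k j l * chr l i k.
  rewrite sum44 !chr4E mulrC big1 => [|k _]; last by rewrite !chr4E mul0r.
  rewrite big1 => [|k _]; last by rewrite !chr4E mul0r.
  rewrite !addr0; congr (_ + _).
  by apply: eq_bigr => k _; apply: eq_bigr => l _; rewrite !chr4E.
by rewrite /fhessian (DC i j); ring.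
Qed.

Lemma static_ricci_zr i : Ric4 z (r i) = 0.
Proof.
rewrite /fricci.
have -> : \sum_k D4 k (chr4 k z (r i)) = 0.
  by rewrite sum4 D4z add0r big1 // => k _; rewrite D4r chr4E D0.
have -> : \sum_k D4 (r i) (chr4 k z k) = 0.
  rewrite sum4 D4r chr4E D0 add0r big1 // => k _; by rewrite D4r chr4E D0.
have -> : \sum_k \sum_l chr4 k k l * chr4 l z (r i) = 0.
  rewrite sum44 !chr4E mul0r add0r !big1 ?addr0 // => k _.
  - by rewrite big1 // => l _; rewrite !chr4E mulr0.
  - by rewrite !chr4E mul0r.
  - by rewrite !chr4E mulr0.
have -> : \sum_k \sum_l chr4 k (r i) l * chr4 l z k = 0.
  rewrite sum44 !chr4E mulr0 add0r !big1 ?addr0 // => k _.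
  - by rewrite big1 // => l _; rewrite !chr4E mulr0.
  - by rewrite !chr4E mul0r.
  - by rewrite !chr4E mul0r.
ring.
Qed.

Lemma static_ricci_rz i : Ric4 (r i) z = 0.
Proof.
rewrite /fricci.
have -> : \sum_k D4 k (chr4 k (r i) z) = 0.
  by rewrite sum4 D4z add0r big1 // => k _; rewrite D4r chr4E D0.
have -> : \sum_k D4 z (chr4 k (r i) k) = 0.
  by rewrite big1 // => k _; rewrite D4z.
have -> : \sum_k \sum_l chr4 k k l * chr4 l (r i) z = 0.
  rewrite sum44 !chr4E mul0r add0r !big1 ?addr0 // => k _.
  - by rewrite big1 // => l _; rewrite !chr4E mulr0.
  - by rewrite !chr4E mul0r.
  - by rewrite !chr4E mulr0.
have -> : \sum_k \sum_l chr4 k z l * chr4 l (r i) k = 0.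
  rewrite sum44 !chr4E mul0r add0r !big1 ?addr0 // => k _.
  - by rewrite big1 // => l _; rewrite !chr4E mul0r.
  - by rewrite !chr4E mulr0.
  - by rewrite !chr4E mulr0.
ring.
Qed.

(** The right side is N times the Laplacian of N = exp U, as w = N^2. *)
Lemma static_ricci_zz : Ric4 z z =
  w * (\sum_k \sum_l h k l * (hess U k l + D k U * D l U)).
Proof.
rewrite /fricci.
have -> : \sum_k D4 k (chr4 k z z) = \sum_k D k (w * upU k).
  by rewrite sum4 D4z add0r; apply: eq_bigr => k _; rewrite D4r chr4E.
have -> : \sum_k D4 z (chr4 k z k) = 0.
  by rewrite big1 // => k _; rewrite D4z.
have -> : \sum_k \sum_l chr4 k k l * chr4 l z z
    = \sum_l D l U * (w * upU l) + \sum_k \sum_l chr k k l * (w * upU l).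
  rewrite sum44 !chr4E mul0r add0r [X in _ + X + _]big1 => [|k _]; last first.
    by rewrite !chr4E mulr0.
  rewrite addr0; congr (_ + _); first by apply: eq_bigr => k _; rewrite !chr4E.
  by apply: eq_bigr => k _; apply: eq_bigr => l _; rewrite !chr4E.
have -> : \sum_k \sum_l chr4 k z l * chr4 l z k
    = \sum_l D l U * (w * upU l) + \sum_l D l U * (w * upU l).
  rewrite sum44 !chr4E mul0r add0r [X in _ + _ + X]big1 => [|k _]; last first.
    by rewrite big1 // => l _; rewrite !chr4E mul0r.
  rewrite addr0; congr (_ + _); apply: eq_bigr => k _; rewrite !chr4E //.
  by rewrite mulrC.
(* The divergence of the gradient is the trace of the Hessian: the derivative of [h] yields both the
   Christoffel term of the divergence and that of the Hessian. *)
have divE : \sum_k D k (upU k) + \sum_k \sum_l chr k k l * upU l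
    = \sum_k \sum_l h k l * hess U k l.
  have Dh k i j : D k (h i j) =
      - (\sum_m h i m * chr j k m + \sum_m chr i k m * h m j).
    have /matrixP/(_ i j) := cometric_compat halfE DM gh gT k.
    by rewrite !mxE => ->; congr (- (_ + _)); apply: eq_bigr => m _; rewrite !mxE.
  have S1 k : D k (upU k) = \sum_l h k l * hess U k l
      - \sum_m chr k k m * upU m.
    rewrite raddf_sum /=.
    have -> : \sum_m chr k k m * upU m = \sum_l \sum_m chr k k m * h m l * D l U.
      rewrite exchange_big; apply: eq_bigr => m _; rewrite mulr_sumr.
      by apply: eq_bigr => l _; rewrite mulrA.
    have -> : \sum_l h k l * hess U k l = \sum_l h k l * D k (D l U)
        - \sum_l \sum_m h k m * chr l k m * D l U.
      rewrite exchange_big -sumrB; apply: eq_bigr => l _.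
      rewrite mulrBr mulr_sumr; congr (_ - _).
      by apply: eq_bigr => m _; rewrite mulrA.
    rewrite -!sumrB; apply: eq_bigr => l _.
    by rewrite DM Dh -!mulr_suml; ring.
  under eq_bigr do rewrite S1.
  by rewrite sumrB subrK.
have -> : \sum_k D k (w * upU k)
    = w * (2 * \sum_l D l U * upU l + \sum_k D k (upU k)).
  rewrite mulrDr !mulr_sumr -big_split; apply: eq_bigr => k _ /=.
  by rewrite DM Dw; ring.
have wS (F : 'I_n -> A) : \sum_l F l * (w * upU l) = w * \sum_l F l * upU l.
  by rewrite mulr_sumr; apply: eq_bigr => l _; rewrite mulrCA.
under [X in _ + (_ + X) - _]eq_bigr do rewrite wS.
rewrite !wS -mulr_sumr.
have -> : \sum_k \sum_l h k l * (hess U k l + D k U * D l U)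
    = \sum_k D k (upU k) + \sum_k \sum_l chr k k l * upU l
      + \sum_l D l U * upU l.
  rewrite divE -big_split; apply: eq_bigr => k _ /=.
  rewrite mulr_sumr -big_split; apply: eq_bigr => l _ /=; ring.
ring.
Qed.

End StaticRicci.

(** * Smooth functions *)

Lemma is_diff_approx (R : numFieldType) (V W : normedModType R) (f : V -> W)
    (L : {linear V -> W}) x :
  continuous L ->
  (forall e, 0 < e -> \forall h \near 0, `|f (h + x) - f x - L h| <= e * `|h|) ->
  is_diff x f L.
Proof.
move=> cL fL.
have fE : f \o shift x = cst (f x) + L +o_ 0 id.
  apply/eqaddoP => _/posnumP[e]; apply: filterS (fL _ [gt0 of e%:num]) => h.
  by rewrite -[X in `|X| <= _ -> _]addrA -opprD.
have dE := diff_unique cL fE.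
apply: DiffDef => //; apply/diff_locallyP; rewrite dE; split => //.
Qed.

Lemma near_eq_is_diff (R : numFieldType) (V W : normedModType R)
    (f g df : V -> W) x :
  {near x, f =1 g} -> is_diff x f df -> is_diff x g df.
Proof.
move=> fg [dfx <-]; apply: is_diff_approx; first exact: diff_continuous.
move=> e e0; have fgx := nbhs_singleton fg.
have /eqaddoP/(_ _ e0) := diff_locally dfx.
have fg0 : \forall h \near (0 : V), f (h + x) = g (h + x).
  by rewrite (near_shift x) /=; near do rewrite /= sub0r subrK.
apply: filterS2 fg0 => h fgh.
by move=> H; rewrite -fgh -fgx -addrA -opprD; exact: H.
Unshelve. all: by end_near. Qed.

Lemma near_eq_differentiable (R : numFieldType) (V W : normedModType R)
    (f g : V -> W) x :
  {near x, f =1 g} -> differentiable f x -> differentiable g x.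
Proof. by move=> fg /differentiableP; move/(near_eq_is_diff fg). Qed.

Section SmoothFunctions.
Context {R : realType} {n : nat}.
Local Notation V := 'rV[R]_n.+1.
Variable O : set V.
Hypothesis oO : open O.
Implicit Types (f g : V -> R) (x : V).

Lemma near_open x : O x -> \forall y \near x, O y.
Proof. by move=> Ox; apply: open_nbhs_nbhs. Qed.

Lemma near_eq_on f g x : (forall y, O y -> f y = g y) -> O x ->
  {near x, f =1 g}.
Proof. by move=> fg Ox; near do apply: fg; exact: near_open. Unshelve. all: by end_near. Qed.

Lemma partial_eq f g i x : (forall y, O y -> f y = g y) -> O x ->
  partial i f x = partial i g x.
Proof. by move=> fg Ox; apply: near_eq_derive; exact: near_eq_on. Qed.

Lemma foldr_partial_eq f g s x : (forall y, O y -> f y = g y) -> O x ->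
  foldr partial f s x = foldr partial g s x.
Proof.
by move=> fg; elim: s x => [|i s IHs] x Ox /=; [exact: fg | exact: partial_eq].
Qed.

Lemma partialD f g i x : differentiable f x -> differentiable g x ->
  partial i (fun y => f y + g y) x = partial i f x + partial i g x.
Proof. by move=> df dg; apply: deriveD; exact: diff_derivable. Qed.

Lemma partialN f i x : differentiable f x ->
  partial i (fun y => - f y) x = - partial i f x.
Proof. by move=> df; apply: deriveN; exact: diff_derivable. Qed.

Lemma partialM f g i x : differentiable f x -> differentiable g x ->
  partial i (fun y => f y * g y) x
  = partial i f x * g x + f x * partial i g x.
Proof.
move=> df dg; rewrite addrC [partial i f x * _]mulrC.
by apply: deriveM; exact: diff_derivable.
Qed.

Lemma partial_cst (a : R) i x : partial i (fun=> a) x = 0.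
Proof. exact: derive_cst. Qed.

(** Bounding the number of derivatives allows induction on [m]: a partial derivative of a product or
    a composite again contains the original functions, so induction over lists of indices for fixed
    functions would not close. *)
Definition Ck (m : nat) f := forall s, (size s <= m)%N ->
  forall x, O x -> differentiable (foldr partial f s) x.

Lemma smooth_onP f : smooth_on O f <-> forall m, Ck m f.
Proof. by split=> [sf m s _ x|sf s x]; [exact: sf | exact: (sf (size s))]. Qed.

Lemma CkS m f : Ck m.+1 f <->
  (forall x, O x -> differentiable f x) /\ forall i, Ck m (partial i f).
Proof.
split=> [Cf|[df Cf] s].
  split=> [x|i s sm x Ox]; first exact: (Cf [::]).
  by rewrite -foldr_rcons; apply: Cf => //; rewrite size_rcons.
elim/last_ind: s => [_ x|s i _]; first exact: df.
by rewrite size_rcons foldr_rcons => sm x Ox; exact: Cf.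
Qed.

Lemma Ck_le m k f : (m <= k)%N -> Ck k f -> Ck m f.
Proof. by move=> mk Cf s sm; apply: Cf; exact: leq_trans mk. Qed.

Lemma Ck_eq m f g : (forall x, O x -> f x = g x) -> Ck m f -> Ck m g.
Proof.
move=> fg Cf s sm x Ox; apply: near_eq_differentiable (Cf s sm x Ox).
by apply: near_eq_on => // y Oy; exact: foldr_partial_eq.
Qed.

Lemma CkD m f g : Ck m f -> Ck m g -> Ck m (fun x => f x + g x).
Proof.
elim: m f g => [|m IHm] f g.
  by move=> Cf Cg [|//] _ x Ox; apply: differentiableD; [exact: (Cf [::])|exact: (Cg [::])].
move=> /CkS[df Cf] /CkS[dg Cg]; apply/CkS; split=> [x Ox|i].
  by apply: differentiableD; [exact: df|exact: dg].
apply: Ck_eq (IHm _ _ (Cf i) (Cg i)) => x Ox /=.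
by rewrite partialD //; [exact: df|exact: dg].
Qed.

Lemma CkN m f : Ck m f -> Ck m (fun x => - f x).
Proof.
elim: m f => [|m IHm] f.
  by move=> Cf [|//] _ x Ox; apply: differentiableN; exact: (Cf [::]).
move=> /CkS[df Cf]; apply/CkS; split=> [x Ox|i].
  by apply: differentiableN; exact: df.
apply: Ck_eq (IHm _ (Cf i)) => x Ox /=.
by rewrite partialN //; exact: df.
Qed.

Lemma CkM m f g : Ck m f -> Ck m g -> Ck m (fun x => f x * g x).
Proof.
elim: m f g => [|m IHm] f g.
  by move=> Cf Cg [|//] _ x Ox; apply: differentiableM; [exact: (Cf [::])|exact: (Cg [::])].
move=> Cf1 Cg1; have Cf0 := Ck_le (leqnSn _) Cf1; have Cg0 := Ck_le (leqnSn _) Cg1.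
move: Cf1 Cg1 => /CkS[df Cf] /CkS[dg Cg]; apply/CkS; split=> [x Ox|i].
  by apply: differentiableM; [exact: df|exact: dg].
apply: Ck_eq (CkD (IHm _ _ (Cf i) Cg0) (IHm _ _ Cf0 (Cg i))) => x Ox /=.
by rewrite partialM //; [exact: df|exact: dg].
Qed.

Lemma Ck_cst m (a : R) : Ck m (fun=> a).
Proof.
elim: m a => [|m IHm] a; first by move=> [|//] _ x _; exact: differentiable_cst.
apply/CkS; split=> [x _|i]; first exact: differentiable_cst.
by apply: Ck_eq (IHm 0) => x _; rewrite partial_cst.
Qed.

Lemma smooth_differentiable f x : smooth_on O f -> O x -> differentiable f x.
Proof. by move=> sf; exact: (sf [::]). Qed.

Lemma smooth_partial i f : smooth_on O f -> smooth_on O (partial i f).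
Proof.
by move=> sf s x Ox; rewrite -foldr_rcons; exact: sf.
Qed.

Lemma smooth_eq f g : (forall x, O x -> f x = g x) ->
  smooth_on O f -> smooth_on O g.
Proof.
by move=> fg /smooth_onP Cf; apply/smooth_onP => m; exact: Ck_eq (Cf m).
Qed.

Lemma smoothD f g : smooth_on O f -> smooth_on O g ->
  smooth_on O (fun x => f x + g x).
Proof.
by move=> /smooth_onP Cf /smooth_onP Cg; apply/smooth_onP => m; exact: CkD.
Qed.

Lemma smoothN f : smooth_on O f -> smooth_on O (fun x => - f x).
Proof. by move=> /smooth_onP Cf; apply/smooth_onP => m; exact: CkN. Qed.

Lemma smoothM f g : smooth_on O f -> smooth_on O g ->
  smooth_on O (fun x => f x * g x).
Proof.
by move=> /smooth_onP Cf /smooth_onP Cg; apply/smooth_onP => m; exact: CkM.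
Qed.

Lemma smooth_cst (a : R) : smooth_on O (fun=> a).
Proof. by apply/smooth_onP => m; exact: Ck_cst. Qed.

Lemma smooth_sum I (r : seq I) (P : pred I) (F : I -> V -> R) :
  (forall i, P i -> smooth_on O (F i)) ->
  smooth_on O (fun x => \sum_(i <- r | P i) F i x).
Proof.
move=> sF; elim: r => [|i r IHr].
  by apply: smooth_eq (smooth_cst 0) => x _; rewrite big_nil.
have [Pi|nPi] := boolP (P i).
  by apply: smooth_eq (smoothD (sF i Pi) IHr) => x _; rewrite big_cons Pi.
by apply: smooth_eq IHr => x _; rewrite big_cons (negPf nPi).
Qed.

(** Bootstrapping: if the partial derivatives are always as regular as [f], then [f] is smooth. It
    serves inverses, exponentials and roots, whose derivatives contain the function itself. *)
Lemma smooth_bootstrap f : (forall x, O x -> differentiable f x) ->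
  (forall m, Ck m f -> forall i, Ck m (partial i f)) -> smooth_on O f.
Proof.
move=> df Cf; apply/smooth_onP; elim=> [|m IHm]; last by apply/CkS; split; last exact: Cf.
by move=> [|//] _; exact: df.
Qed.

Lemma partial_comp f (phi : R -> R) i x d : differentiable f x ->
  is_derive (f x) 1 phi d ->
  differentiable (phi \o f) x /\ partial i (phi \o f) x = d * partial i f x.
Proof.
move=> df [dphi phid].
have dphi' : differentiable phi (f x) by exact/derivable1_diffP.
split; first exact: differentiable_comp.
rewrite /partial !deriveE //; last exact: differentiable_comp.
rewrite diff_comp //= -phid deriveE //.
by rewrite -[X in 'd phi _ X]mulr1 -[_ * 1]/(_ *: _) linearZ mulrC.
Qed.

Lemma smooth_logderivative f (w : 'I_n.+1 -> V -> R) :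
  (forall x, O x -> differentiable f x) ->
  (forall i, smooth_on O (w i)) ->
  (forall i x, O x -> partial i f x = f x * w i x) -> smooth_on O f.
Proof.
move=> df sw fw; apply: smooth_bootstrap => // m Cf i.
apply: Ck_eq (CkM Cf ((smooth_onP _).1 (sw i) m)) => x Ox.
by rewrite fw.
Qed.

Lemma partial_inv f i x : differentiable f x -> f x != 0 ->
  differentiable (fun y => (f y)^-1) x /\
  partial i (fun y => (f y)^-1) x = - (f x)^-1 * (f x)^-1 * partial i f x.
Proof.
move=> df fx0; split; first exact: differentiableV.
rewrite /partial deriveV //; last exact: diff_derivable.
by congr (_ * _); rewrite expr2 invfM mulNr.
Qed.

Lemma smooth_inv f : smooth_on O f -> (forall x, O x -> f x != 0) ->
  smooth_on O (fun x => (f x)^-1).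
Proof.
move=> sf f0; have df x : O x -> differentiable f x by exact: smooth_differentiable.
apply: smooth_bootstrap => [x Ox|m Cf i].
  by apply: differentiableV; [exact: df|exact: f0].
have Cdf := (smooth_onP _).1 (smooth_partial i sf) m.
apply: Ck_eq (CkM (CkM (CkN Cf) Cf) Cdf) => x Ox /=.
by rewrite (partial_inv _ (df x Ox) (f0 x Ox)).2.
Qed.

Lemma smooth_exp f : smooth_on O f -> smooth_on O (fun x => expR (f x)).
Proof.
move=> sf; have df x : O x -> differentiable f x by exact: smooth_differentiable.
have dE i x (Ox : O x) := partial_comp i (df x Ox) (is_derive_expR (f x)).
apply: (smooth_logderivative (w := fun i => partial i f)).
- by move=> x Ox; have [] := dE ord0 x Ox.
- by move=> i; exact: smooth_partial.
- by move=> i x Ox; have [_] := dE i x Ox.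
Qed.

Lemma smooth_sqrt f : smooth_on O f -> (forall x, O x -> 0 < f x) ->
  smooth_on O (fun x => Num.sqrt (f x)).
Proof.
move=> sf f0; have df x : O x -> differentiable f x by exact: smooth_differentiable.
have dE i x (Ox : O x) := partial_comp i (df x Ox) (is_derive1_sqrt (f0 x Ox)).
apply: (smooth_logderivative (w := fun i x => 2^-1 * ((f x)^-1 * partial i f x))).
- by move=> x Ox; have [] := dE ord0 x Ox.
- move=> i; apply: smoothM; first exact: smooth_cst.
  apply: smoothM; last exact: smooth_partial.
  by apply: smooth_inv => // x /f0 /lt0r_neq0.
- move=> i x Ox; have [_ ->] := dE i x Ox.
  have fx0 := f0 x Ox; have s0 : Num.sqrt (f x) != 0 by rewrite gt_eqF // sqrtr_gt0.
  rewrite -{3}(sqr_sqrtr (ltW fx0)); field.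
  by [].
Qed.

Lemma smooth_ln f : smooth_on O f -> (forall x, O x -> 0 < f x) ->
  smooth_on O (fun x => ln (f x)).
Proof.
move=> sf f0; have df x : O x -> differentiable f x by exact: smooth_differentiable.
have dE i x (Ox : O x) := partial_comp i (df x Ox) (is_derive1_ln (f0 x Ox)).
apply: smooth_bootstrap => [x Ox|m _ i]; first by have [] := dE ord0 x Ox.
have s1 : smooth_on O (fun x => (f x)^-1 * partial i f x).
  apply: smoothM; last exact: smooth_partial.
  by apply: smooth_inv => // x /f0 /lt0r_neq0.
by apply: Ck_eq ((smooth_onP _).1 s1 m) => x Ox; have [_ ->] := dE i x Ox.
Qed.

(** The induction must treat both functions together, since each appears in the derivative of the
    other. *)
Lemma Ck_cos_sin m f : smooth_on O f ->
  Ck m (fun x => cos (f x)) /\ Ck m (fun x => sin (f x)).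
Proof.
move=> sf; have df x : O x -> differentiable f x by exact: smooth_differentiable.
have dc i x (Ox : O x) := partial_comp i (df x Ox) (is_derive_cos (f x)).
have ds i x (Ox : O x) := partial_comp i (df x Ox) (is_derive_sin (f x)).
elim: m => [|m [Cc Cs]].
  split=> -[|//] _ x Ox; first by have [] := dc ord0 x Ox.
  by have [] := ds ord0 x Ox.
have Cdf i := (smooth_onP _).1 (smooth_partial i sf) m.
split; apply/CkS; split=> [x Ox|i].
- by have [] := dc ord0 x Ox.
- by apply: Ck_eq (CkM (CkN Cs) (Cdf i)) => x Ox; have [_ ->] := dc i x Ox.
- by have [] := ds ord0 x Ox.
- by apply: Ck_eq (CkM Cc (Cdf i)) => x Ox; have [_ ->] := ds i x Ox.
Qed.

Lemma smooth_cos f : smooth_on O f -> smooth_on O (fun x => cos (f x)).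
Proof. by move=> sf; apply/smooth_onP => m; have [] := Ck_cos_sin m sf. Qed.

Lemma smooth_sin f : smooth_on O f -> smooth_on O (fun x => sin (f x)).
Proof. by move=> sf; apply/smooth_onP => m; have [] := Ck_cos_sin m sf. Qed.

End SmoothFunctions.

(** * Mean value theorem along segments and symmetry of second derivatives *)

Section Lines.
Context {R : realType} {n : nat}.
Local Notation V := 'rV[R]_n.+1.
Implicit Types (f : V -> R) (x y u v : V).

Lemma is_diff_line (u y : V) (t : R) :
  is_diff t (fun s : R => s *: u + y) (fun s => s *: u).
Proof.
have := is_diffD (is_diff_scalel t u) (is_diff_cst y t).
by rewrite addr0.
Qed.

Lemma line_derive f u y (t : R) : differentiable f (t *: u + y) ->
  is_derive t 1 (fun s => f (s *: u + y)) ('D_u f (t *: u + y)).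
Proof.
move=> df; have dl := is_diff_line u y t.
have dfl : differentiable (f \o (fun s : R => s *: u + y)) t.
  exact: differentiable_comp.
apply: DeriveDef; first exact/derivable1_diffP.
rewrite deriveE // diff_comp //= diff_val scale1r deriveE //.
Qed.

Lemma derive_partial f x v : differentiable f x ->
  'D_v f x = \sum_i v 0 i * partial i f x.
Proof.
move=> df; rewrite deriveE // {1}[v]row_sum_delta linear_sum.
by apply: eq_bigr => i _; rewrite linearZ /partial deriveE.
Qed.

Lemma ball_line (x0 : V) r x y (t : R) :
  ball x0 r x -> ball x0 r y -> 0 <= t -> t <= 1 ->
  ball x0 r (t *: (y - x) + x).
Proof.
rewrite -ball_normE /= => bx byy t0 t1.
have -> : x0 - (t *: (y - x) + x) = (1 - t) *: (x0 - x) + t *: (x0 - y).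
  apply/rowP=> i; rewrite !mxE; ring.
apply: (le_lt_trans (ler_normD _ _)); rewrite !normrZ !ger0_norm ?subr_ge0 //.
have [->|t_neq0] := eqVneq t 0; first by rewrite subr0 mul1r mul0r addr0.
rewrite -[ltRHS](_ : (1 - t) * r + t * r = r); last by ring.
rewrite ler_ltD // ?ltr_pM2l ?lt0r ?t_neq0 //.
by rewrite ler_wpM2l ?subr_ge0 // ltW.
Qed.

Lemma MVT_line f x y :
  (forall t, 0 <= t -> t <= 1 -> differentiable f (t *: (y - x) + x)) ->
  exists t, [/\ 0 <= t, t <= 1 &
    f y - f x = 'D_(y - x) f (t *: (y - x) + x)].
Proof.
move=> df; pose F (s : R) := f (s *: (y - x) + x).
pose dF (s : R) := 'D_(y - x) f (s *: (y - x) + x).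
have dline t : t \in `[(0:R), 1] -> is_derive t 1 F (dF t).
  by rewrite in_itv /= => /andP[t0 t1]; apply: line_derive; exact: df.
have cF : {within `[(0:R), 1], continuous F}.
  by apply: derivable_within_continuous => t t01; have [] := dline t t01.
have dF01 t : t \in `](0:R), 1[ -> is_derive t 1 F (dF t).
  by move=> t01; apply: dline; exact: subset_itv_oo_cc.
have [t + E] := MVT_segment ler01 dF01 cF.
rewrite in_itv /= => /andP[t0 t1]; exists t; split => //.
by move: E; rewrite /F /dF scale1r subrK scale0r add0r subr0 mulr1.
Qed.

Lemma partial0_constant f x0 r :
  (forall y, ball x0 r y -> differentiable f y) ->
  (forall i y, ball x0 r y -> partial i f y = 0) ->
  forall y, ball x0 r y -> f y = f x0.
Proof.
move=> df f0 y yr.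
have x0r : ball x0 r x0.
  by apply: ballxx; move: yr; rewrite -ball_normE /=; apply: le_lt_trans.
have [t t0 t1|t [t0 t1]] := @MVT_line f x0 y.
  by apply: df; exact: ball_line.
have tr := ball_line x0r yr t0 t1.
rewrite derive_partial; last exact: df.
by rewrite big1 => [/subr0_eq|i _]; rewrite ?f0 ?mulr0.
Qed.

End Lines.

Section Schwarz.
Context {R : realType} {n : nat}.
Local Notation V := 'rV[R]_n.+1.
Implicit Types (f : V -> R) (x y u v : V).

(* The mean value theorem, used twice. *)
Lemma second_difference f u v x (t : R) : 0 <= t ->
  (forall a b, 0 <= a <= t -> 0 <= b <= t ->
     differentiable f (a *: u + (b *: v + x)) /\
     differentiable ('D_u f) (b *: v + (a *: u + x))) ->
  exists a b, [/\ 0 <= a <= t, 0 <= b <= t &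
    f (t *: u + (t *: v + x)) - f (t *: u + x) - (f (t *: v + x) - f x)
    = t * t * 'D_v ('D_u f) (b *: v + (a *: u + x))].
Proof.
move=> t0 df.
have tt0 : 0 <= t <= t by rewrite t0 lexx.
have t00 : 0 <= (0 : R) <= t by rewrite t0 lexx.
pose p (a : R) := f (a *: u + (t *: v + x)) - f (a *: u + x).
pose dp (a : R) := 'D_u f (a *: u + (t *: v + x)) - 'D_u f (a *: u + x).
have pD a : 0 <= a <= t -> is_derive a 1 p (dp a).
  move=> at0; apply: is_deriveB; apply: line_derive.
    by have [] := df a t at0 tt0.
  by have [] := df a 0 at0 t00; rewrite scale0r add0r.
have dp0 a : a \in `]0, t[ -> is_derive a 1 p (dp a).
  by move=> a0; apply: pD; move: a0; rewrite in_itv /= => /andP[a0 at1]; rewrite !ltW.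
have cp : {within `[0, t], continuous p}.
  apply: derivable_within_continuous => a; rewrite in_itv /= => at1.
  by have [] := pD a at1.
have [a + E1] := MVT_segment t0 dp0 cp; rewrite in_itv /= => at1.
pose q (b : R) := 'D_u f (b *: v + (a *: u + x)).
pose dq (b : R) := 'D_v ('D_u f) (b *: v + (a *: u + x)).
have qD b : 0 <= b <= t -> is_derive b 1 q (dq b).
  by move=> bt; apply: line_derive; have [] := df a b at1 bt.
have dq0 b : b \in `]0, t[ -> is_derive b 1 q (dq b).
  by move=> b0; apply: qD; move: b0; rewrite in_itv /= => /andP[b0 bt1]; rewrite !ltW.
have cq : {within `[0, t], continuous q}.
  apply: derivable_within_continuous => b; rewrite in_itv /= => bt1.
  by have [] := qD b bt1.
have [b + E2] := MVT_segment t0 dq0 cq; rewrite in_itv /= => bt1.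
exists a, b; split => //.
move: E1; rewrite /p /dp scale0r !add0r => ->.
have -> : a *: u + (t *: v + x) = t *: v + (a *: u + x) by rewrite addrCA.
move: E2; rewrite /q scale0r add0r !subr0 => ->; rewrite /dq; ring.
Qed.

Lemma half_dist_contra (p q a b e : R) :
  `|p - a| < e -> `|q - b| < e -> a = b -> e = `|p - q| / 2 -> False.
Proof.
move=> pa qb ab; move: pa qb; rewrite ab => pb qb eE.
have : `|p - q| < e + e.
  rewrite (_ : p - q = (p - b) - (q - b)); last by ring.
  by apply: le_lt_trans (ler_normB _ _) _; exact: ltrD.
by rewrite eE -splitr ltxx.
Qed.

(** The second difference over a small parallelogram is symmetric in its two sides. It is t^2 times
    either mixed derivative at some point of the parallelogram, and by continuity both values are
    close to those at [x]. *)
Lemma Schwarz f O i j x : open O -> smooth_on O f -> O x ->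
  partial i (partial j f) x = partial j (partial i f) x.
Proof.
move=> oO sf Ox.
have sP := smooth_partial i (smooth_partial j sf).
have sQ := smooth_partial j (smooth_partial i sf).
apply/eqP; rewrite -subr_eq0; apply/negPn/negP => PQ.
set P := partial i (partial j f); set Q := partial j (partial i f).
pose e := `|P x - Q x| / 2.
have e0 : 0 < e by rewrite divr_gt0 // normr_gt0.
have cP : \forall z \near x, `|P x - P z| < e.
  have := differentiable_continuous (smooth_differentiable sP Ox).
  by move=> /cvgrPdist_lt/(_ e e0).
have cQ : \forall z \near x, `|Q x - Q z| < e.
  have := differentiable_continuous (smooth_differentiable sQ Ox).
  by move=> /cvgrPdist_lt/(_ e e0).
have /nbhs_ballP[r /= r0 rO] : \forall z \near x, [/\ O z, `|P x - P z| < e & `|Q x - Q z| < e].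
  by apply: filterS3 (near_open oO Ox) cP cQ.
pose u : V := delta_mx 0 i; pose v : V := delta_mx 0 j.
(* With this side the whole parallelogram lies in the ball where each mixed derivative varies by
   less than half of the supposed gap; the summand 1 makes the bound strict. *)
pose t := r / (1 + `|u| + `|v|).
have d0 : 0 < 1 + `|u| + `|v| by rewrite -addrA ltr_pwDl // addr_ge0.
have t0 : 0 < t by rewrite divr_gt0.
have near_x a b (w w' : V) : `|w| + `|w'| = `|u| + `|v| ->
    0 <= a <= t -> 0 <= b <= t -> ball x r (a *: w + (b *: w' + x)).
  move=> ww' /andP[a0 at1] /andP[b0 bt1]; rewrite -ball_normE /=.
  have -> : x - (a *: w + (b *: w' + x)) = - (a *: w + b *: w').
    by apply/rowP=> k; rewrite !mxE; ring.
  rewrite normrN; apply: le_lt_trans (ler_normD _ _) _.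
  rewrite !normrZ !ger0_norm //.
  apply: (@le_lt_trans _ _ (t * (`|w| + `|w'|))).
    by rewrite mulrDr lerD // ler_wpM2r.
  rewrite ww' /t mulrAC ltr_pdivrMr // ltr_pM2l //.
  by rewrite -addrA [ltRHS]addrC ltrDl.
have uv : `|v| + `|u| = `|u| + `|v| by rewrite addrC.
have [a [b [at0 bt0 E1]]] : exists a b, [/\ 0 <= a <= t, 0 <= b <= t &
    f (t *: u + (t *: v + x)) - f (t *: u + x) - (f (t *: v + x) - f x)
    = t * t * Q (b *: v + (a *: u + x))].
  apply: second_difference; first exact: ltW.
  move=> a b at0 bt0; split.
    by apply: (smooth_differentiable sf); have [] := rO _ (near_x a b u v erefl at0 bt0).
  apply: (smooth_differentiable (smooth_partial i sf)).
  by have [] := rO _ (near_x b a v u uv bt0 at0).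
have [a' [b' [at0' bt0' E2]]] : exists a b, [/\ 0 <= a <= t, 0 <= b <= t &
    f (t *: v + (t *: u + x)) - f (t *: v + x) - (f (t *: u + x) - f x)
    = t * t * P (b *: u + (a *: v + x))].
  apply: second_difference; first exact: ltW.
  move=> a' b' at0' bt0'; split.
    by apply: (smooth_differentiable sf); have [] := rO _ (near_x a' b' v u uv at0' bt0').
  apply: (smooth_differentiable (smooth_partial j sf)).
  by have [] := rO _ (near_x b' a' u v erefl bt0' at0').
have QP : Q (b *: v + (a *: u + x)) = P (b' *: u + (a' *: v + x)).
  apply: (mulfI (lt0r_neq0 (mulr_gt0 t0 t0))).
  apply: etrans (esym E1) _; apply: etrans _ E2.
  have -> : t *: v + (t *: u + x) = t *: u + (t *: v + x) by rewrite addrCA.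
  ring.
have [_ _ Q1] := rO _ (near_x b a v u uv bt0 at0).
have [_ P1 _] := rO _ (near_x b' a' u v erefl bt0' at0').
exact: (half_dist_contra P1 Q1 (esym QP) erefl).
Qed.

End Schwarz.

Lemma ler_coord_norm (R : realType) n (v : 'rV[R]_n.+1) i : `|v 0 i| <= `|v|.
Proof.
have /mapP[j _ ->] : `|v 0 i| \in [seq `|v x.1 x.2| | x : 'I_1 * 'I_n.+1].
  by apply/mapP; exists (0, i) => //=; rewrite mem_enum.
by rewrite [leRHS]/Num.norm /= mx_normrE; apply/bigmax_geP; right => /=; exists j.
Qed.

Lemma is_diff_linear_form (R : realType) n (c : 'I_n.+1 -> R) (y : 'rV[R]_n.+1) :
  is_diff y (fun z : 'rV[R]_n.+1 => \sum_j z 0 j * c j)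
    (fun h => \sum_j h 0 j * c j).
Proof.
pose f (z : 'rV[R]_n.+1) := \sum_j z 0 j * c j.
have lf : linear f.
  move=> a u v; rewrite scaler_sumr -big_split; apply: eq_bigr => j _ /=.
  by rewrite !mxE mulrDl -mulrA.
pose fM := GRing.isLinear.Build _ _ _ _ _ lf.
pose fL : {linear _ -> _} := HB.pack f fM.
have df z : differentiable f z.
  have -> : f = \sum_j ((fun v : 'rV[R]_n.+1 => v 0 j) * cst (c j)).
    by apply/funext => v; rewrite fct_sumE.
  apply: differentiable_sum => j; apply: differentiableM; last exact: differentiable_cst.
  exact: differentiable_coord.
apply: DiffDef; first exact: df.
by rewrite (@diff_lin _ _ _ fL) // => z; exact/differentiable_continuous/df.
Qed.

Lemma is_diff_coord (R : realType) n (y : 'rV[R]_n.+1) i :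
  is_diff y (fun z : 'rV[R]_n.+1 => z 0 i) (fun h => h 0 i).
Proof.
have E : (fun z : 'rV[R]_n.+1 => z 0 i) = (fun z => \sum_j z 0 j * (j == i)%:R).
  apply/funext => z; rewrite (bigD1 i) //= eqxx mulr1 big1 ?addr0 // => j /negPf ->.
  by rewrite mulr0.
by rewrite E; exact: is_diff_linear_form.
Qed.

Lemma derive_comp_diff (R : realType) n (f : 'rV[R]_n.+1 -> R)
    (A L : 'rV[R]_n.+1 -> 'rV[R]_n.+1) y v :
  differentiable f (A y) -> is_diff y A L ->
  'D_v (f \o A) y = 'D_(L v) f (A y).
Proof.
move=> df [dA <-]; rewrite [RHS]deriveE // deriveE; last exact: differentiable_comp.
exact: (congr1 (fun F : 'rV[R]_n.+1 -> R => F v) (diff_comp dA df)).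
Qed.

Lemma deriveZdir (R : realType) n (f : 'rV[R]_n.+1 -> R) y v t :
  differentiable f y -> 'D_(t *: v) f y = t * 'D_v f y.
Proof. by move=> df; rewrite !deriveE // linearZ. Qed.

(** * Local primitives of closed forms *)

Section Poincare.
Context {R : realType} {n : nat}.
Local Notation V := 'rV[R]_n.+1.
Local Notation leb := (@lebesgue_measure R).
Variables (x0 : V) (r M : R) (w : 'I_n.+1 -> V -> R).
Local Notation B := (ball x0 r).
Hypothesis r0 : 0 < r.
Hypothesis sw : forall i, smooth_on B (w i).
Hypothesis cw : forall i j (x : V), B x -> partial j (w i) x = partial i (w j) x.
Hypothesis wM : forall i (x : V), B x -> `|w i x| <= M.
Hypothesis dwM : forall i j (x : V), B x -> `|partial j (w i) x| <= M.

Implicit Types (t s : R) (y u v : V) (i j : 'I_n.+1).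

Let At (t : R) (y : V) : V := t *: (y - x0) + x0.
Let Psi (t : R) (y : V) := \sum_i (y - x0) 0 i * w i (At t y).
Let H (v y : V) (t : R) := \sum_i v 0 i * w i (At t y).
Let H' (v y : V) (t : R) := \sum_i v 0 i * 'D_(y - x0) (w i) (At t y).

(** The homotopy formula of the Poincaré lemma: the integral of the form over the segment from [x0]
    to [y]. *)
Definition radial_primitive (y : V) : R := \int[leb]_(t in `[0, 1]) Psi t y.

Let oB : open B. Proof. exact: ball_open. Qed.

Let B0 : B x0. Proof. exact: ballxx. Qed.

Let AtB (t : R) (y : V) : B y -> 0 <= t <= 1 -> B (At t y).
Proof. by move=> By /andP[t0 t1]; exact: ball_line. Qed.

Let smooth_dir (u : V) i : smooth_on B ('D_u (w i)).
Proof.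
apply: (smooth_eq oB (f := fun z => \sum_j u 0 j * partial j (w i) z)).
  by move=> z Bz; rewrite derive_partial //; exact: smooth_differentiable Bz.
apply: smooth_sum => // j _; apply: smoothM => //; first exact: smooth_cst.
exact: smooth_partial.
Qed.

Let coord_diff (y : V) i : is_diff y (fun z : V => (z - x0) 0 i) (fun h => h 0 i).
Proof.
have -> : (fun z : V => (z - x0) 0 i) = (fun z : V => z 0 i) - cst (x0 0 i).
  by apply/funext => z; rewrite !mxE.
have := is_diffB (is_diff_coord y i) (is_diff_cst (x0 0 i) y).
by rewrite subr0.
Qed.

Let Psi_derive t y v : B y -> 0 <= t <= 1 ->
  differentiable (Psi t) y /\
  'D_v (Psi t) y = H v y t + t * \sum_i (y - x0) 0 i * 'D_v (w i) (At t y).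
Proof.
move=> By t01.
have dA : is_diff y (At t) (fun h => t *: h).
  have := is_diffD (is_diffZ t (is_diffB (is_diff_id y) (is_diff_cst x0 y))) (is_diff_cst x0 y).
  move=> dd; apply: is_diff_eq dd _; apply/funext => h.
  by rewrite !fctE subr0 addr0.
have dw i : differentiable (w i) (At t y).
  by apply: smooth_differentiable (AtB By t01); exact: sw.
have dwA i : differentiable (w i \o At t) y by exact: differentiable_comp.
have DwA i : 'D_v (w i \o At t) y = t * 'D_v (w i) (At t y).
  by rewrite (derive_comp_diff _ (dw i) dA) deriveZdir.
have PsiE : Psi t = \sum_i ((fun z : V => (z - x0) 0 i) * (w i \o At t)).
  by apply/funext => z; rewrite fct_sumE.
have dPsi i : differentiable ((fun z : V => (z - x0) 0 i) * (w i \o At t)) y.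
  by apply: differentiableM => //; have [] := coord_diff y i.
rewrite PsiE; split; first exact: differentiable_sum.
rewrite derive_sum => [|i]; last exact: diff_derivable.
rewrite /H mulr_sumr -big_split; apply: eq_bigr => i _ /=.
have cd := coord_diff y i.
rewrite deriveM //; [|exact: diff_derivable..].
rewrite DwA [in X in _ + X]deriveE // diff_val.
transitivity ((y - x0) 0 i * (t * 'D_v (w i) (At t y)) + w i (At t y) * v 0 i) => //.
ring.
Qed.

Let line_form (c : V) (g : 'I_n.+1 -> V -> R) y t :
  (forall i, smooth_on B (g i)) -> B y -> 0 <= t <= 1 ->
  is_derive t 1 (fun s => \sum_i c 0 i * g i (At s y))
    (\sum_i c 0 i * 'D_(y - x0) (g i) (At t y)).
Proof.
move=> sg By t01.
have gd i : is_derive t 1 (fun s => g i (At s y)) ('D_(y - x0) (g i) (At t y)).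
  by apply: line_derive; apply: smooth_differentiable (sg i) (AtB By t01).
have -> : (fun s => \sum_i c 0 i * g i (At s y))
    = \sum_i (c 0 i *: (fun s => g i (At s y))).
  by apply/funext => s; rewrite fct_sumE.
by apply: is_derive_sum => i; exact: is_deriveZ.
Qed.

Let H_derive v y t : B y -> 0 <= t <= 1 -> is_derive t 1 (H v y) (H' v y t).
Proof. by move=> By t01; exact: line_form. Qed.

Let H'_derivable v y t : B y -> 0 <= t <= 1 -> derivable (H' v y) t 1.
Proof.
move=> By t01.
by have [] := line_form v (g := fun i => 'D_(y - x0) (w i)) (smooth_dir (y - x0)) By t01.
Qed.

Let within01 (f : R -> R) : (forall t, 0 <= t <= 1 -> derivable f t 1) ->
  {within `[0, 1], continuous f}.
Proof.
by move=> df; apply: derivable_within_continuous => t; rewrite in_itv /= => /df.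
Qed.

Let dirE u i y t : B y -> 0 <= t <= 1 ->
  'D_u (w i) (At t y) = \sum_j u 0 j * partial j (w i) (At t y).
Proof.
by move=> By t01; apply/derive_partial/(smooth_differentiable (sw i))/AtB.
Qed.

(** Closedness of the form exchanges the direction of differentiation [v] with the radial
    direction. *)
Let swap_H' v y t : B y -> 0 <= t <= 1 ->
  \sum_i (y - x0) 0 i * 'D_v (w i) (At t y) = H' v y t.
Proof.
move=> By t01; rewrite /H'.
under eq_bigr do rewrite dirE // mulr_sumr.
under [RHS]eq_bigr do rewrite dirE // mulr_sumr.
rewrite exchange_big; apply: eq_bigr => i _; apply: eq_bigr => j _.
by rewrite (cw j i (AtB By t01)) mulrCA.
Qed.

(** The integrand is the derivative of t H(t), which vanishes at 0 and is the form at [y], applied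
    to [v], at 1. *)
Let FTC_H v y : B y ->
  \int[leb]_(t in `[0, 1]) (H v y t + t * H' v y t) = \sum_j v 0 j * w j y.
Proof.
move=> By; pose G := (id : R -> R) * H v y.
have dG t : 0 <= t <= 1 -> is_derive t 1 G (H v y t + t * H' v y t).
  move=> t01; have dH := H_derive v By t01.
  apply: (is_derive_eq (is_deriveM (is_derive_id t (1:R)) dH)); rewrite addrC; congr (_ + _).
  by rewrite -[LHS]/(_ * 1) mulr1.
have cG t : 0 <= t <= 1 -> {for t, continuous G}.
  by move=> t01; apply/differentiable_continuous/derivable1_diffP; have [] := dG t t01.
have G1 : G 1 = \sum_j v 0 j * w j y.
  rewrite /G /= -[LHS]/(1 * _) mul1r; apply: eq_bigr => j _.
  by rewrite /At scale1r subrK.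
have G0 : G 0 = 0 by rewrite /G -[LHS]/(0 * _) mul0r.
rewrite /Rintegral (@continuous_FTC2 R _ G) //= ?G1 ?G0 ?subr0 //.
- apply: within01 => t t01; apply: derivableD.
    by have [] := H_derive v By t01.
  by apply: derivableM; [exact: derivable_id | exact: H'_derivable].
- split.
  + move=> t; rewrite in_itv /= => /andP[t0 t1].
    by have [] := dG t _; rewrite ?(ltW t0) ?(ltW t1).
  + by apply: cvg_at_right_filter; apply: cG; rewrite lexx ler01.
  + by apply: cvg_at_left_filter; apply: cG; rewrite lexx ler01.
- move=> t; rewrite in_itv /= => /andP[t0 t1].
  rewrite derive1E; apply: derive_val.
  by apply: dG; rewrite (ltW t0) (ltW t1).
Qed.

Lemma radial_primitive_derive0 v y : B y ->
  is_derive (0 : R) (1 : R) (fun s : R => radial_primitive (s *: v + y)) (\sum_j v 0 j * w j y).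
Proof.
move=> By.
have [d /= d0 dB] : exists2 d : R, 0 < d & forall s, `|s| < d -> B (s *: v + y).
  have /nbhs_ballP[d /= d0 dB] : \forall s \near (0 : R), B (s *: v + y).
    have [dly _] := is_diff_line v y 0.
    have := differentiable_continuous dly.
    by apply; rewrite scale0r add0r; exact: near_open.
  exists d => // s sd; apply: dB; rewrite -ball_normE /= sub0r normrN //.
pose f (s t : R) := Psi t (s *: v + y).
have sB s : s \in `](- d), d[ -> B (s *: v + y).
  by rewrite in_itv /= -ltr_norml => /dB.
have f1 s t : s \in `](- d), d[ -> 0 <= t <= 1 ->
    is_derive s 1 (f ^~ t) (H v (s *: v + y) t + t * H' v (s *: v + y) t).
  move=> sd t01; have Bs := sB s sd.
  have [dP DP] := Psi_derive v Bs t01.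
  have := line_derive dP; rewrite DP swap_H' //.
have intPsi s : s \in `](- d), d[ -> leb.-integrable `[0, 1] (EFin \o f s).
  move=> sd; have Bs := sB s sd.
  apply: continuous_compact_integrable; first exact: segment_compact.
  by apply: within01 => t t01; have [] := H_derive (s *: v + y - x0) Bs t01.
(* The dominating constant for differentiation under the integral: one sum for [H], the other for t
   H', where the radial vector has coordinates bounded by [r]. *)
pose K : R := \sum_(i < n.+1) (`|v| * M) + \sum_(i < n.+1) (r * \sum_(j < n.+1) (`|v| * M)).
have M0 : 0 <= M by apply: le_trans (wM ord0 B0).
have K0 : 0 <= K.
  apply: addr_ge0; apply: sumr_ge0 => i _; first exact: mulr_ge0.
  by apply: mulr_ge0; [exact: ltW|apply: sumr_ge0 => j _; exact: mulr_ge0].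
have fK s t : s \in `](- d), d[ -> t \in `[(0:R), 1] -> `|partial1of2 f s t| <= K.
  move=> sd; rewrite in_itv /= => t01; have Bs := sB s sd.
  have [_ dfE] := f1 s t sd t01.
  rewrite partial1of2E dfE -swap_H' //.
  apply: le_trans (ler_normD _ _) _; apply: lerD.
    apply: le_trans (ler_norm_sum _ _ _) _; apply: ler_sum => i _.
    by rewrite normrM ler_pM // ?ler_coord_norm // wM //; exact: AtB.
  have /andP[t0 t1] := t01.
  rewrite normrM (ger0_norm t0) -[leRHS]mul1r ler_pM //.
  apply: le_trans (ler_norm_sum _ _ _) _; apply: ler_sum => i _.
  rewrite normrM ler_pM //.
    apply: le_trans (ler_coord_norm _ _) _.
    by move: Bs; rewrite -ball_normE /= distrC => /ltW.
  rewrite dirE //; apply: le_trans (ler_norm_sum _ _ _) _; apply: ler_sum => j _.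
  by rewrite normrM ler_pM // ?ler_coord_norm // dwM //; exact: AtB.
have I0 : (0 : R) \in `](- d), d[ by rewrite in_itv /= oppr_lt0 d0.
have dK : leb.-integrable `[0, 1] (EFin \o cst K).
  apply: continuous_compact_integrable; first exact: segment_compact.
  by apply: continuous_subspaceT => z; exact: cst_continuous.
have df s t : `](- d), d[%classic s -> `[0, 1]%classic t -> derivable (f ^~ t) s 1.
  by move=> sd; rewrite /= in_itv /= => t01; have [] := f1 s t sd t01.
apply: DeriveDef.
  apply: (@derivable_under_integral R _ _ leb f `[0, 1]%classic _ 0 (- d) d _ intPsi df (cst K)) => //.
rewrite -derive1E.
rewrite (@differentiation_under_integral R _ _ leb f `[0, 1]%classic _ 0 (- d) d _ intPsi df (cst K)) //.
rewrite -FTC_H //; apply: eq_Rintegral => t; rewrite inE /= in_itv /= => t01.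
have [_ dfE] := f1 0 t I0 t01.
by rewrite partial1of2E dfE scale0r add0r.
Qed.

Lemma radial_primitive_derive v y s : B (s *: v + y) ->
  is_derive s (1 : R) (fun s : R => radial_primitive (s *: v + y))
    (\sum_j v 0 j * w j (s *: v + y)).
Proof.
move=> Bs; have d0 := radial_primitive_derive0 v Bs.
have sh : is_derive s 1 (fun a : R => a - s) 1.
  by have := is_deriveB (is_derive_id s (1:R)) (is_derive_cst s s (1:R)); rewrite subr0.
have -> : (fun a => radial_primitive (a *: v + y))
    = (fun a => radial_primitive (a *: v + (s *: v + y))) \o (fun a : R => a - s).
  by apply/funext => a /=; rewrite addrA -scalerDl subrK.
rewrite -[\sum_j _]mulr1; apply: is_derive1_comp => //.
by rewrite subrr.
Qed.

(** To pass from derivatives along lines to a differential, the mean value theorem on the segment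
    from y to h + y expresses the increment by the form at an intermediate point, and continuity of
    the form bounds the error. The tolerance is divided among the coordinates. *)
Lemma radial_primitive_diff y : B y ->
  is_diff y radial_primitive (fun h => \sum_j h 0 j * w j y).
Proof.
move=> By; have lf := is_diff_linear_form (w ^~ y) y.
have dE : 'd (fun z : V => \sum_j z 0 j * w j y) y = (fun h => \sum_j h 0 j * w j y) :> (V -> R).
  exact: diff_val.
rewrite -dE; apply: is_diff_approx.
  by apply: diff_continuous; have [] := lf.
move=> e e0; rewrite dE.
pose c := e / n.+1%:R.
have c0 : 0 < c by rewrite divr_gt0.
have nw : \forall z \near y, B z /\ forall i, `|w i y - w i z| < c.
  apply: filterI; first exact: near_open.
  apply: (@filter_forall V _ (fun i z => `|w i y - w i z| < c) (nbhs y) (nbhs_filter y)) => i.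
  have := differentiable_continuous (smooth_differentiable (sw i) By).
  by move=> /cvgrPdist_lt/(_ c c0).
have /nbhs_ballP[d /= d0 dB] := nw.
apply/nbhs_ballP; exists d => //= h; rewrite -ball_normE /= sub0r normrN => hd.
have hB s : 0 <= s <= 1 -> ball y d (s *: h + y).
  move=> /andP[s0 s1]; rewrite -ball_normE /= opprD addrCA subrr addr0 normrN.
  by rewrite normrZ ger0_norm //; apply: le_lt_trans hd; rewrite ler_piMl.
pose F (s : R) := radial_primitive (s *: h + y).
pose dF (s : R) := \sum_j h 0 j * w j (s *: h + y).
have FD s : 0 <= s <= 1 -> is_derive s 1 F (dF s).
  by move=> s01; apply: radial_primitive_derive; have [] := dB _ (hB s s01).
have F01 s : s \in `](0:R), 1[ -> is_derive s 1 F (dF s).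
  by rewrite in_itv /= => /andP[s0 s1]; apply: FD; rewrite !ltW.
have cF : {within `[0, 1], continuous F}.
  by apply: within01 => s s01; have [] := FD s s01.
have [s + E] := MVT_segment ler01 F01 cF; rewrite in_itv /= => s01.
have -> : radial_primitive (h + y) - radial_primitive y = dF s.
  by move: E; rewrite /F scale1r scale0r add0r subr0 mulr1.
rewrite /dF -sumrB; apply: le_trans (ler_norm_sum _ _ _) _.
have -> : e * `|h| = \sum_(j < n.+1) `|h| * c.
  by rewrite sumr_const card_ord -mulr_natr /c -mulrA divfK ?pnatr_eq0 // mulrC.
apply: ler_sum => j _; rewrite -mulrBr normrM ler_pM // ?ler_coord_norm //.
by rewrite distrC ltW //; have [_] := dB _ (hB s s01); exact.
Qed.

End Poincare.

Theorem Poincare_lemma (R : realType) n (O : set 'rV[R]_n.+1)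
    (w : 'I_n.+1 -> 'rV[R]_n.+1 -> R) (x0 : 'rV[R]_n.+1) :
  open O -> O x0 -> (forall i, smooth_on O (w i)) ->
  (forall i j x, O x -> partial j (w i) x = partial i (w j) x) ->
  exists r theta, [/\ 0 < r, ball x0 r `<=` O,
    smooth_on (ball x0 r) theta, theta x0 = 0 &
    forall i x, ball x0 r x -> partial i theta x = w i x].
Proof.
move=> oO Ox0 sw cw.
(* The homotopy formula needs uniform bounds on the form and its first derivatives. The values at
   [x0] enlarged by 1 are such bounds on a small ball, by continuity. *)
pose M0 := \sum_i (`|w i x0| + 1); pose M1 := \sum_i \sum_j (`|partial j (w i) x0| + 1).
have M00 i : `|w i x0| + 1 <= M0.
  by rewrite /M0 (bigD1 i) //= lerDl sumr_ge0 // => j _; rewrite addr_ge0.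
have M10 i j : `|partial j (w i) x0| + 1 <= M1.
  rewrite /M1 (bigD1 i) //= (bigD1 j) //= -addrA lerDl addr_ge0 //.
    by rewrite sumr_ge0 // => k _; rewrite addr_ge0.
  by rewrite sumr_ge0 // => k _; rewrite sumr_ge0 // => l _; rewrite addr_ge0.
have near_bound f : smooth_on O f -> \forall z \near x0, `|f z| <= `|f x0| + 1.
  move=> sf; have := differentiable_continuous (smooth_differentiable sf Ox0).
  move=> /cvgrPdist_lt/(_ 1 ltr01); apply: filterS => z fz.
  rewrite -[f z](subrK (f x0)) addrC; apply: le_trans (ler_normD _ _) _.
  by rewrite lerD2l distrC ltW.
have : \forall z \near x0, O z /\ ((forall i, `|w i z| <= M0) /\
    forall i j, `|partial j (w i) z| <= M1).
  apply: filterI; first exact: near_open.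
  apply: filterI.
    apply: (@filter_forall _ _ (fun i z => `|w i z| <= M0) (nbhs x0) (nbhs_filter x0)) => i.
    apply: filterS (near_bound _ (sw i)) => z wz.
    exact: le_trans wz (M00 i).
  apply: (@filter_forall _ _ (fun i z => forall j, `|partial j (w i) z| <= M1) (nbhs x0) (nbhs_filter x0)) => i.
  apply: (@filter_forall _ _ (fun j z => `|partial j (w i) z| <= M1) (nbhs x0) (nbhs_filter x0)) => j.
  apply: filterS (near_bound _ (smooth_partial j (sw i))) => z wz.
  exact: le_trans wz (M10 i j).
move=> /nbhs_ballP[r /= r0 rB].
have rO : ball x0 r `<=` O by move=> z /rB[].
pose th := radial_primitive x0 w.
have sw' i : smooth_on (ball x0 r) (w i) by move=> s x /rO; exact: sw.
have M01 : M0 <= Num.max M0 M1 by rewrite le_max lexx.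
have M11 : M1 <= Num.max M0 M1 by rewrite le_max lexx orbT.
have th_diff y : ball x0 r y -> is_diff y th (fun h => \sum_j h 0 j * w j y).
  apply: (@radial_primitive_diff R n x0 r (Num.max M0 M1)) => //.
  - by move=> i j x /rO; exact: cw.
  - by move=> i x /rB[_ [+ _]] => /(_ i) /le_trans; apply.
  - by move=> i j x /rB[_ [_ +]] => /(_ i j) /le_trans; apply.
have th_partial i x : ball x0 r x -> partial i th x = w i x.
  move=> xr; have [dth th'] := th_diff x xr.
  rewrite /partial deriveE // th' (bigD1 i) //= mxE !eqxx mul1r big1 ?addr0 //.
  by move=> j /negPf ji; rewrite mxE eqxx ji mul0r.
(* Normalizing the primitive at [x0] will make the cosine in the potential equal to 1 there. *)
exists r, (fun x => th x - th x0); split => //.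
- have sth : smooth_on (ball x0 r) th.
    apply: smooth_bootstrap => [x xr|m _ i].
      by have [] := th_diff x xr.
    apply: (Ck_eq (ball_open x0 r)) ((smooth_onP _ _).1 (sw' i) m) => x xr.
    by rewrite th_partial.
  apply: (smooth_eq (ball_open x0 r) _ (smoothD (ball_open x0 r) sth (smooth_cst (ball_open x0 r) (- th x0)))).
  by [].
- by rewrite subrr.
- move=> i x xr; have [dth _] := th_diff x xr.
  have dc : differentiable (cst (- th x0) : 'rV[R]_n.+1 -> R) x by exact: differentiable_cst.
  by rewrite (partialD _ dth dc) partial_cst addr0 th_partial.
Qed.

(** * The ring of smooth functions *)

(* Extending by 0 outside [O] makes equality in this ring the equality of
   functions on [O]. *)
Record sfun (R : realType) (n : nat) (O : set 'rV[R]_n.+1) (oO : open O) := Sfun {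
  sfun_val :> 'rV[R]_n.+1 -> R;
  sfun_smooth : smooth_on O sfun_val;
  sfun_out : forall x, ~ O x -> sfun_val x = 0
}.

Section SmoothRing.
Context {R : realType} {n : nat} {O : set 'rV[R]_n.+1} (oO : open O).
Local Notation V := 'rV[R]_n.+1.
Local Notation A := (sfun oO).

HB.instance Definition _ := gen_eqMixin A.
HB.instance Definition _ := gen_choiceMixin A.

Lemma sfunP (a b : A) : (forall x, O x -> a x = b x) -> a = b.
Proof.
move=> ab; have {ab} : sfun_val a = sfun_val b.
  apply/funext => x; have [Ox|nOx] := pselect (O x); first exact: ab.
  by rewrite !sfun_out.
case: a b => [a sa a0] [b sb b0] /= ab; subst b.
by rewrite (Prop_irrelevance sa sb) (Prop_irrelevance a0 b0).
Qed.

Definition restr (f : V -> R) (x : V) : R := if `[< O x >] then f x else 0.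

Lemma restrE f x : O x -> restr f x = f x.
Proof. by move=> Ox; rewrite /restr asboolT. Qed.

Lemma smooth_restr f : smooth_on O f -> smooth_on O (restr f).
Proof. by apply: smooth_eq => // x Ox; rewrite restrE. Qed.

Lemma restr_out f x : ~ O x -> restr f x = 0.
Proof. by move=> nOx; rewrite /restr asboolF. Qed.

Definition sfun_of f (sf : smooth_on O f) : A := Sfun oO (smooth_restr sf) (@restr_out f).

Lemma sfun_ofE f (sf : smooth_on O f) x : O x -> sfun_of sf x = f x.
Proof. exact: restrE. Qed.

Definition sfun_cst c : A := sfun_of (smooth_cst oO c).
Definition sfun_add (a b : A) : A :=
  sfun_of (smoothD oO (sfun_smooth a) (sfun_smooth b)).
Definition sfun_opp (a : A) : A := sfun_of (smoothN oO (sfun_smooth a)).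
Definition sfun_mul (a b : A) : A :=
  sfun_of (smoothM oO (sfun_smooth a) (sfun_smooth b)).

Lemma sfun_addA : associative sfun_add.
Proof. by move=> a b c; apply: sfunP => x Ox; rewrite !sfun_ofE // addrA. Qed.
Lemma sfun_addC : commutative sfun_add.
Proof. by move=> a b; apply: sfunP => x Ox; rewrite !sfun_ofE // addrC. Qed.
Lemma sfun_add0 : left_id (sfun_cst 0) sfun_add.
Proof. by move=> a; apply: sfunP => x Ox; rewrite !sfun_ofE // add0r. Qed.
Lemma sfun_addN : left_inverse (sfun_cst 0) sfun_opp sfun_add.
Proof. by move=> a; apply: sfunP => x Ox; rewrite !sfun_ofE // addNr. Qed.

HB.instance Definition _ :=
  GRing.isZmodule.Build A sfun_addA sfun_addC sfun_add0 sfun_addN.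

Lemma sfun_mulA : associative sfun_mul.
Proof. by move=> a b c; apply: sfunP => x Ox; rewrite !sfun_ofE // mulrA. Qed.
Lemma sfun_mulC : commutative sfun_mul.
Proof. by move=> a b; apply: sfunP => x Ox; rewrite !sfun_ofE // mulrC. Qed.
Lemma sfun_mul1 : left_id (sfun_cst 1) sfun_mul.
Proof. by move=> a; apply: sfunP => x Ox; rewrite !sfun_ofE // mul1r. Qed.
Lemma sfun_mulDl : left_distributive sfun_mul sfun_add.
Proof. by move=> a b c; apply: sfunP => x Ox; rewrite !sfun_ofE // mulrDl. Qed.

HB.instance Definition _ :=
  GRing.Zmodule_isComPzRing.Build A sfun_mulA sfun_mulC sfun_mul1 sfun_mulDl.

Lemma sfun_addE (a b : A) x : O x -> (a + b) x = a x + b x.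
Proof. exact: restrE. Qed.
Lemma sfun_oppE (a : A) x : O x -> (- a) x = - a x.
Proof. exact: restrE. Qed.
Lemma sfun_mulE (a b : A) x : O x -> (a * b) x = a x * b x.
Proof. exact: restrE. Qed.
Lemma sfun_1E x : O x -> (1 : A) x = 1.
Proof. exact: restrE. Qed.
Lemma sfun_cstE c x : O x -> sfun_cst c x = c.
Proof. exact: restrE. Qed.

Definition sfun_eval (x : V) (Ox : O x) (a : A) : R := a x.

Section Eval.
Variables (x : V) (Ox : O x).
Fact sfun_eval_is_additive : zmod_morphism (sfun_eval Ox).
Proof. by move=> a b; rewrite /sfun_eval sfun_addE // sfun_oppE. Qed.
Fact sfun_eval_is_multiplicative : monoid_morphism (sfun_eval Ox).
Proof. by split=> [|a b]; rewrite /sfun_eval ?sfun_1E ?sfun_mulE. Qed.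
HB.instance Definition _ :=
  GRing.isZmodMorphism.Build A R (sfun_eval Ox) sfun_eval_is_additive.
HB.instance Definition _ :=
  GRing.isMonoidMorphism.Build A R (sfun_eval Ox) sfun_eval_is_multiplicative.
End Eval.

Definition sfun_D (i : 'I_n.+1) (a : A) : A := sfun_of (smooth_partial i (sfun_smooth a)).

Lemma sfun_DE i (a : A) x : O x -> sfun_D i a x = partial i a x.
Proof. exact: restrE. Qed.

Lemma sfun_differentiable (a : A) x : O x -> differentiable a x.
Proof. exact/smooth_differentiable/sfun_smooth. Qed.

Fact sfun_D_is_additive i : zmod_morphism (sfun_D i).
Proof.
move=> a b; apply: sfunP => x Ox; rewrite sfun_addE // sfun_oppE // !sfun_DE //.
rewrite (partial_eq oO (g := fun y => a y + - b y)) // => [|y Oy].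
  rewrite partialD ?partialN //; try exact: sfun_differentiable.
  by apply: differentiableN; exact: sfun_differentiable.
by rewrite sfun_addE // sfun_oppE.
Qed.

HB.instance Definition _ i :=
  GRing.isZmodMorphism.Build A A (sfun_D i) (sfun_D_is_additive i).

Definition sfun_der (i : 'I_n.+1) : {additive A -> A} := sfun_D i.

Lemma sfun_derE i (a : A) x : O x -> sfun_der i a x = partial i a x.
Proof. exact: sfun_DE. Qed.

Lemma sfun_derM i a b : sfun_der i (a * b) = sfun_der i a * b + a * sfun_der i b.
Proof.
apply: sfunP => x Ox; rewrite sfun_addE // !sfun_mulE // !sfun_DE //.
rewrite (partial_eq oO (g := fun y => a y * b y)) // => [|y Oy].
  by rewrite partialM //; exact: sfun_differentiable.
by rewrite sfun_mulE.
Qed.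

Lemma sfun_der2E i j (a : A) x : O x ->
  sfun_der i (sfun_der j a) x = partial i (partial j a) x.
Proof.
move=> Ox; apply: etrans (sfun_DE _ _ Ox) _; apply: (partial_eq oO) Ox => y Oy.
exact: sfun_DE.
Qed.

Lemma sfun_derC i j a : sfun_der i (sfun_der j a) = sfun_der j (sfun_der i a).
Proof.
apply: sfunP => x Ox; apply: etrans (sfun_der2E _ _ _ Ox) _.
apply: etrans _ (esym (sfun_der2E _ _ _ Ox)).
exact: Schwarz (sfun_smooth a) Ox.
Qed.

Lemma sfun_reduced (a : A) : a * a = 0 -> a = 0.
Proof.
move=> a2; apply: sfunP => x Ox.
have := congr1 (sfun_eval Ox) a2; rewrite rmorphM rmorph0 => /eqP.
rewrite mulf_eq0 orbb => /eqP a0.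
exact: etrans (a0 : a x = 0) (esym (rmorph0 (sfun_eval Ox))).
Qed.

End SmoothRing.

(** * From formal tensors to coordinate tensors *)

Section Transfer.
Context {R : realType} {n : nat} {A : comPzRingType}.
Local Notation V := 'rV[R]_n.+1.
Variables (D : 'I_n.+1 -> {additive A -> A}) (half : A) (G H : 'M[A]_n.+1).
(** The evaluation is left abstract because it is used twice: at points of space, and at points of
    spacetime, where a function on space is read through [rsubmx]. *)
Variables (W : set V) (oW : open W) (ev : A -> V -> R).
Variable (phi : forall y, W y -> {rmorphism A -> R}).
Hypothesis evE : forall y (Wy : W y) a, ev a y = phi Wy a.
Hypothesis evD : forall i a y, W y -> ev (D i a) y = partial i (ev a) y.
Hypothesis halfE : half + half = 1.
Hypothesis GH : G *m H = 1%:M.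
Variable (g : V -> 'M[R]_n.+1).
Hypothesis gG : forall i j y, W y -> g y i j = ev (G i j) y.

Lemma transfer_invmx i j y : W y -> invmx (g y) i j = ev (H i j) y.
Proof.
move=> Wy; have gE : g y = map_mx (phi Wy) G.
  by apply/matrixP=> a b; rewrite gG // mxE (evE Wy).
have gh : g y *m map_mx (phi Wy) H = 1%:M by rewrite gE -map_mxM GH map_mx1.
have [gu _] := mulmx1_unit gh.
rewrite (_ : invmx (g y) = map_mx (phi Wy) H); first by rewrite mxE (evE Wy).
by rewrite -[LHS]mulmx1 -gh mulKmx.
Qed.

Lemma transfer_half y : W y -> ev half y = 2^-1.
Proof.
move=> Wy; rewrite (evE Wy); have := congr1 (phi Wy) halfE.
by rewrite rmorphD rmorph1; lra.
Qed.

Lemma transfer_partial i (f : V -> R) a y :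
  (forall z, W z -> f z = ev a z) -> W y -> partial i f y = ev (D i a) y.
Proof. by move=> fa Wy; rewrite evD //; exact: partial_eq Wy. Qed.

Lemma transfer_christoffel k i j y : W y ->
  christoffel g k i j y = ev (fchristoffel D half G H k i j) y.
Proof.
move=> Wy; rewrite /christoffel /fchristoffel (evE Wy) rmorphM /= rmorph_sum.
rewrite -(evE Wy) transfer_half //; congr (_ * _); apply: eq_bigr => l _ /=.
rewrite rmorphM rmorphB rmorphD /= -!(evE Wy) transfer_invmx //; congr (_ * _).
have P a b c : partial c (fun z => g z a b) y = ev (D c (G a b)) y.
  by apply: transfer_partial Wy => z Wz; exact: gG.
by rewrite !P.
Qed.

Lemma transfer_ricci i j y : W y -> ricci g y i j = ev (fricci D half G H i j) y.
Proof.
move=> Wy; rewrite mxE /fricci (evE Wy) !(rmorphB, rmorphD) /= !rmorph_sum /=.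
have P a b c d : partial d (christoffel g a b c) y
    = phi Wy (D d (fchristoffel D half G H a b c)).
  rewrite -(evE Wy); apply: transfer_partial Wy => z Wz.
  exact: transfer_christoffel.
congr (_ - _ + _ - _).
- by apply: eq_bigr => k _; rewrite P.
- by apply: eq_bigr => k _; rewrite P.
- apply: eq_bigr => k _; rewrite rmorph_sum; apply: eq_bigr => l _ /=.
  by rewrite rmorphM /= -!(evE Wy) !transfer_christoffel.
- apply: eq_bigr => k _; rewrite rmorph_sum; apply: eq_bigr => l _ /=.
  by rewrite rmorphM /= -!(evE Wy) !transfer_christoffel.
Qed.

Lemma transfer_hessian f a i j y : (forall z, W z -> f z = ev a z) -> W y ->
  hessian g f y i j = ev (fhessian D half G H a i j) y.
Proof.
move=> fa Wy; rewrite mxE /fhessian (evE Wy) rmorphB rmorph_sum /=.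
rewrite -(evE Wy) -(@transfer_partial i (partial j f)) //; last first.
  by move=> z Wz; exact: transfer_partial.
congr (_ - _); apply: eq_bigr => k _; rewrite rmorphM /= -!(evE Wy).
by rewrite transfer_christoffel // (@transfer_partial k f a).
Qed.

End Transfer.

(** * Characteristic polynomials of 3 x 3 matrices *)

Lemma mulmx3E (A : comPzRingType) (X Y : 'M[A]_3) i j :
  (X *m Y) i j = X i o0 * Y o0 j + X i o1 * Y o1 j + X i o2 * Y o2 j.
Proof. by rewrite mxE sum3. Qed.

Lemma mxtrace3 (A : comPzRingType) (X : 'M[A]_3) :
  \tr X = X o0 o0 + X o1 o1 + X o2 o2.
Proof. by rewrite /mxtrace sum3. Qed.

Lemma char_poly3 (R : realFieldType) (X : 'M[R]_3) :
  char_poly X = 'X^3 - (\tr X)%:P * 'X^2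
    + (2^-1 * (\tr X ^+ 2 - \tr (X *m X)))%:P * 'X - (\det X)%:P.
Proof.
rewrite /char_poly !det3 !mxtrace3 !mulmx3E.
have -> : 2^-1 * ((X o0 o0 + X o1 o1 + X o2 o2) ^+ 2 -
     (X o0 o0 * X o0 o0 + X o0 o1 * X o1 o0 + X o0 o2 * X o2 o0 +
      (X o1 o0 * X o0 o1 + X o1 o1 * X o1 o1 + X o1 o2 * X o2 o1) +
      (X o2 o0 * X o0 o2 + X o2 o1 * X o1 o2 + X o2 o2 * X o2 o2)))
   = X o0 o0 * X o1 o1 + X o0 o0 * X o2 o2 + X o1 o1 * X o2 o2
     - X o0 o1 * X o1 o0 - X o0 o2 * X o2 o0 - X o1 o2 * X o2 o1 by field.
rewrite !mxE /= !mulr0n !mulr1n !(polyCB, polyCD, polyCM).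
ring.
Qed.

Lemma det3_trace (R : realFieldType) (X : 'M[R]_3) :
  6 * \det X = (\tr X) ^+ 3 - 3 * \tr X * \tr (X *m X) + 2 * \tr (X *m X *m X).
Proof. rewrite det3 !mxtrace3 !mulmx3E; ring. Qed.

(** The coefficients are expressed by traces of powers through Newton's identities; the factor 6
    clears their denominators. *)
Lemma Cayley_Hamilton3 (R : realFieldType) (X : 'M[R]_3) i j :
  6 * (X *m X *m X) i j = 6 * \tr X * (X *m X) i j
  - 3 * ((\tr X) ^+ 2 - \tr (X *m X)) * X i j
  + ((\tr X) ^+ 3 - 3 * \tr X * \tr (X *m X) + 2 * \tr (X *m X *m X)) * (i == j)%:R.
Proof.
rewrite !mxtrace3 !mulmx3E.
move: i j; apply: ord3_ind; apply: ord3_ind; rewrite /=; ring.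
Qed.

(** The power sums of the eigenvalues mu, mu and -2 mu. *)
Definition typeD_invariants (R : realFieldType) (X : 'M[R]_3) mu :=
  [/\ \tr X = 0, \tr (X *m X) = 6 * mu ^+ 2 & \tr (X *m X *m X) = - (6 * mu ^+ 3)].

Lemma typeD_char_poly (R : realFieldType) (X : 'M[R]_3) mu :
  char_poly X = ('X - mu%:P) ^+ 2 * ('X - (- 2 * mu)%:P) <-> typeD_invariants X mu.
Proof.
rewrite char_poly3; have dt := det3_trace X; split=> [E|[t1 t2 t3]].
  (* Both sides are monic cubics, so the values at three points determine the three remaining
     coefficients. *)
  have E0 := congr1 (fun p : {poly R} => p.[0]) E.
  have E1 := congr1 (fun p : {poly R} => p.[1]) E.
  have E2 := congr1 (fun p : {poly R} => p.[-1]) E.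
  move: E0 E1 E2; rewrite !hornerE /= => E0 E1 E2.
  have t0 : \tr X = 0 by lra.
  rewrite t0 in dt E1 E0 E2; split => //; first by nra.
  nra.
rewrite t1 t2 t3 in dt *.
have -> : \det X = - (2 * mu ^+ 3) by lra.
rewrite (_ : 2^-1 * (0 ^+ 2 - 6 * mu ^+ 2) = - (3 * mu ^+ 2)); last by field.
rewrite !(polyCN, polyCM, polyC_exp).
have -> : (3%:P : {poly R}) = 3 by rewrite rmorph_nat.
have -> : (2%:P : {poly R}) = 2 by rewrite rmorph_nat.
rewrite polyC0; ring.
Qed.

(** * Symmetric tensors with a double eigenvalue *)

Section PositiveForm.
Context {R : realFieldType} {n : nat}.
Variable g : 'M[R]_n.
Hypothesis gT : g^T = g.
Hypothesis g_pos : forall v : 'rV[R]_n, v != 0 -> 0 < (v *m g *m v^T) 0 0.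

Lemma posdef_unit : g \in unitmx.
Proof.
rewrite -row_free_unit -kermx_eq0; apply/eqP/row_matrixP => i.
apply/eqP; rewrite row0; apply: contraT => /g_pos.
have -> : row i (kermx g) *m g = 0 by rewrite -row_mul mulmx_ker row0.
by rewrite mul0mx mxE ltxx.
Qed.

Lemma invmx_sym : (invmx g)^T = invmx g.
Proof. by rewrite trmx_inv gT. Qed.

Lemma invmx_pos (v : 'rV[R]_n) : v != 0 -> 0 < (v *m invmx g *m v^T) 0 0.
Proof.
move=> v0; have u := posdef_unit.
have w0 : v *m invmx g != 0.
  apply: contra_neq v0 => w0; by rewrite -[v](mulmxKV u) w0 mul0mx.
have := g_pos w0; rewrite trmx_mul invmx_sym mulmxKV // mulmxA.
by [].
Qed.

(** The diagonal entries of the product are the squared lengths of the rows of [S] in the inverse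
    metric. *)
Lemma sym_square0 (S : 'M[R]_n) : S^T = S -> S *m invmx g *m S = 0 -> S = 0.
Proof.
move=> ST S2; apply/row_matrixP => i; rewrite row0; apply/eqP; apply: contraT.
have row_form : (row i S *m invmx g *m (row i S)^T) 0 0 = (S *m invmx g *m S^T) i i.
  by rewrite -row_mul !mxE; apply: eq_bigr => k _; rewrite !mxE.
move=> /invmx_pos; rewrite row_form ST S2 mxE ltxx.
by [].
Qed.

End PositiveForm.

Section TypeDTensor.
Context {R : realFieldType}.
Variables (g Ric : 'M[R]_3) (mu : R).
Hypothesis gT : g^T = g.
Hypothesis g_pos : forall v : 'rV[R]_3, v != 0 -> 0 < (v *m g *m v^T) 0 0.
Hypothesis RicT : Ric^T = Ric.
Hypothesis mu0 : mu != 0.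

Local Notation h := (invmx g).
Local Notation L := (Ric *m h).

Let gu := posdef_unit g_pos.
Let Lg : L *m g = Ric. Proof. exact: mulmxKV. Qed.

(** This solves Ric = mu (g - 3 Q) for Q, so it is e e without a choice of the sign of e. *)
Definition axis_projection : 'M[R]_3 := (3 * mu)^-1 *: (mu *: g - Ric).
Local Notation Q := axis_projection.

Hypothesis inv : typeD_invariants L mu.

(** The double eigenvalue has no Jordan block because L is self-adjoint for [g]. With W = (L - mu)
    (L + 2 mu), the Cayley-Hamilton theorem gives L W = mu W and hence W^2 = 0; as W g is symmetric,
    definiteness of [g] forces W = 0. *)
Lemma typeD_minimal : L *m L = 2 * mu ^+ 2 *: 1%:M - mu *: L.
Proof.
have [t1 t2 t3] := inv.
have CH : L *m L *m L = (3 * mu ^+ 2) *: L - (2 * mu ^+ 3) *: 1%:M.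
  apply/matrixP=> i j; have := Cayley_Hamilton3 L i j; rewrite t1 t2 t3.
  by rewrite !(addmxE, oppmxE, scalemxE) !mxE => ?; lra.
apply/eqP; rewrite -subr_eq0; apply/eqP.
set W := _ - _.
have WE : W = L *m L + mu *: L - (2 * mu ^+ 2) *: 1%:M.
  by rewrite /W opprB addrA.
have LW : L *m W = mu *: W.
  rewrite WE !(mulmxDr, mulmxN) -!scalemxAr mulmxA CH mulmx1.
  apply/matrixP=> i j; rewrite !(addmxE, oppmxE, scalemxE).
  ring.
have LLW : L *m L *m W = mu *: (mu *: W).
  by rewrite -[L *m L *m W]mulmxA LW -scalemxAr LW.
have WW : W *m W = 0.
  rewrite {1}WE !(mulmxDl, mulNmx) -!scalemxAl mul1mx LLW LW.
  apply/matrixP=> i j; rewrite !(addmxE, oppmxE, scalemxE) [RHS]mxE; ring.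
have WgT : (W *m g)^T = W *m g.
  have WgE : W *m g = Ric *m h *m Ric + mu *: Ric - (2 * mu ^+ 2) *: g.
    by rewrite WE !(mulmxDl, mulNmx) -!scalemxAl mul1mx -[L *m L *m g]mulmxA !Lg.
  rewrite WgE !(trmxD, trmxN, linearZ) /= !trmx_mul RicT gT (invmx_sym gT) mulmxA.
  by [].
have Wg0 : W *m g = 0.
  apply: (sym_square0 gT g_pos WgT).
  by rewrite -[W *m g *m _]mulmxA mulmxV // mulmx1 mulmxA WW mul0mx.
by rewrite -[W](mulmxK gu) Wg0 mul0mx.
Qed.

Lemma axis_projection_sym : Q^T = Q.
Proof. by rewrite /axis_projection linearZ /= trmxD trmxN linearZ /= gT RicT. Qed.

Let K := Q *m h.

Let KE : K = (3 * mu)^-1 *: (mu *: 1%:M - L).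
Proof.
by rewrite /K /axis_projection -scalemxAl mulmxBl -scalemxAl mulmxV.
Qed.

Let KK : K *m K = K.
Proof.
rewrite {1 2}KE -scalemxAl -scalemxAr !(mulmxBl, mulmxBr) -!scalemxAl -!scalemxAr.
rewrite mul1mx mulmx1 mul1mx typeD_minimal KE.
apply/matrixP=> i j; rewrite !(addmxE, oppmxE, scalemxE); field.
by [].
Qed.

Lemma axis_projection_trace : \tr K = 1.
Proof.
have [t1 _ _] := inv.
rewrite KE linearZ /= linearB linearZ /= mxtrace1 t1; field.
by [].
Qed.

Lemma axis_projection_idem : Q *m h *m Q = Q.
Proof.
have QE : Q = K *m g by rewrite /K mulmxKV.
by rewrite -/K {1}QE mulmxA KK -QE.
Qed.

Lemma axis_projection_ge0 i : 0 <= Q i i.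
Proof.
have -> : Q i i = (row i Q *m h *m (row i Q)^T) 0 0.
  rewrite -{1}axis_projection_idem -{2}axis_projection_sym -row_mul !mxE.
  by apply: eq_bigr => k _; rewrite !mxE.
have [->|Q0] := eqVneq (row i Q) 0; first by rewrite !mul0mx mxE.
exact/ltW/invmx_pos.
Qed.

(* the 2 x 2 minors of K are the entries of adj K = K^2 - (tr K) K + e_2(K) *)
Let K_minor a b i j : (i, j) \in [:: (o0, o1); (o0, o2); (o1, o2)] ->
  K a i * K b j = K a j * K b i.
Proof.
have t1 := axis_projection_trace; rewrite mxtrace3 -/K in t1.
have K2E c d : K c o0 * K o0 d + K c o1 * K o1 d + K c o2 * K o2 d = K c d.
  by rewrite -mulmx3E KK.
have t2 : K o0 o0 = 1 - K o1 o1 - K o2 o2 by lra.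
have := K2E o0 o0; have := K2E o0 o1; have := K2E o0 o2.
have := K2E o1 o0; have := K2E o1 o1; have := K2E o1 o2.
have := K2E o2 o0; have := K2E o2 o1; have := K2E o2 o2.
rewrite !t2 => k22 k21 k20 k12 k11 k10 k02 k01 k00.
rewrite !inE => /or3P[] /eqP[-> ->]; move: a b; do 2 apply: ord3_ind;
  rewrite ?t2; lra.
Qed.

Lemma axis_projection_rank1 a b i j : Q a i * Q b j = Q a j * Q b i.
Proof.
have QE c d : Q c d = K c o0 * g o0 d + K c o1 * g o1 d + K c o2 * g o2 d.
  by rewrite -mulmx3E /K mulmxKV.
have m01 := @K_minor a b o0 o1 isT; have m02 := @K_minor a b o0 o2 isT.
have m12 := @K_minor a b o1 o2 isT.
rewrite !QE.
apply: (lincomb3 (c1 := g o0 i * g o1 j - g o0 j * g o1 i)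
  (c2 := g o0 i * g o2 j - g o0 j * g o2 i) (c3 := g o1 i * g o2 j - g o1 j * g o2 i)
   m01 m02 m12); ring.
Qed.

(** A vanishing diagonal would make the rank one symmetric matrix zero, against its trace 1. The
    positive entry is what allows a row to be normalized to e. *)
Lemma axis_projection_gt0 : exists k, 0 < Q k k.
Proof.
have [/existsP[k Qk]|] := boolP [exists k, Q k k != 0].
  by exists k; rewrite lt0r Qk axis_projection_ge0.
rewrite negb_exists => /forallP Qd.
have Q0 : Q = 0.
  apply/matrixP=> i j; rewrite [RHS]mxE; apply/eqP.
  have /negPn/eqP Qi := Qd i; have := axis_projection_rank1 i j j i.
  have -> : Q j i = Q i j by rewrite -{1}axis_projection_sym mxE.
  by rewrite Qi mul0r => /eqP; rewrite mulf_eq0 orbb.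
have := axis_projection_trace; rewrite /K Q0 mul0mx mxtrace0 => /esym/eqP.
by rewrite oner_eq0.
Qed.

Lemma axis_projection_ricci : Ric = mu *: (g - 3 *: Q).
Proof.
apply/matrixP=> i j; rewrite !(addmxE, oppmxE, scalemxE); field.
by [].
Qed.

End TypeDTensor.

(** For mu = - t / s the equation 6 t^2 = s^3 gives s = 6 mu^2 and then t = - 6 mu^3, provided that
    s is nonzero. *)
Lemma typeD_of_tensors (R : realFieldType) (g Ric : 'M[R]_3) :
  g^T = g -> (forall v : 'rV[R]_3, v != 0 -> 0 < (v *m g *m v^T) 0 0) ->
  Ric^T = Ric -> Ric <> 0 ->
  let L := Ric *m invmx g in
  \tr L = 0 -> 6 * \tr (L *m L *m L) ^+ 2 = \tr (L *m L) ^+ 3 ->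
  let mu := - \tr (L *m L *m L) / \tr (L *m L) in
  mu != 0 /\ typeD_invariants L mu.
Proof.
move=> gT g_pos RicT Ric0 L t1 t23 mu.
have gu := posdef_unit g_pos.
have LE : Ric *m invmx g = L by [].
have Lg : L *m g = Ric by exact: mulmxKV.
clearbody L.
have s0 : \tr (L *m L) != 0.
  (* If s = 0 then t = 0, and all power sums vanish; L is nilpotent, and being self-adjoint for a
     definite metric it is zero, against the hypothesis on [Ric]. *)
  apply/negP => /eqP s0; apply: Ric0.
  have t0 : \tr (L *m L *m L) = 0.
    by move: t23; rewrite s0 expr0n /= => /eqP; rewrite mulf_eq0 sqrf_eq0 pnatr_eq0 => /eqP.
  have L3 : L *m L *m L = 0.
    by apply/matrixP=> i j; rewrite [RHS]mxE; have := Cayley_Hamilton3 L i j; rewrite t1 s0 t0 => ?; lra.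
  have L2 : L *m L = 0.
    rewrite -[L *m L](mulmxK gu) (_ : L *m L *m g = 0) ?mul0mx //.
    apply: (sym_square0 gT g_pos).
      by rewrite -mulmxA Lg -LE !trmx_mul (invmx_sym gT) RicT mulmxA.
    by rewrite -[_ *m g *m _]mulmxA mulmxV // mulmx1 !mulmxA L3 !mul0mx.
  apply: (sym_square0 gT g_pos RicT).
  by rewrite LE -Lg mulmxA L2 mul0mx.
have sE : \tr (L *m L) = 6 * mu ^+ 2.
  rewrite /mu exprMn sqrrN exprVn; apply: (mulIf (expf_neq0 2 s0)).
  by rewrite -mulrA divfK ?expf_neq0 // t23; ring.
have m0 : mu != 0 by apply: contra_neq s0 => m0; rewrite sE m0 expr0n mulr0.
split=> //; split=> //.
have -> : \tr (L *m L *m L) = - (mu * \tr (L *m L)) by rewrite /mu divfK // opprK.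
by rewrite sE; ring.
Qed.

(** * Metrics on an open set *)

Section SfunInverse.
Context {R : realType} {n : nat} {O : set 'rV[R]_n.+1} {oO : open O}.
Local Notation A := (sfun oO).

Definition sfun_inv (a : A) (a0 : forall x, O x -> a x != 0) : A :=
  sfun_of oO (smooth_inv oO (sfun_smooth a) a0).

Lemma sfun_invE a a0 x : O x -> @sfun_inv a a0 x = (a x)^-1.
Proof. by move=> Ox; rewrite sfun_ofE. Qed.

Lemma sfun_mulV (a : A) a0 : @sfun_inv a a0 * a = 1.
Proof.
by apply: sfunP => x Ox; rewrite sfun_mulE // sfun_invE // sfun_1E // mulVf ?a0.
Qed.

Lemma sfun_half : sfun_cst oO 2^-1 + sfun_cst oO 2^-1 = 1.
Proof.
by apply: sfunP => x Ox; rewrite sfun_addE // sfun_1E // !sfun_cstE //; field.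
Qed.

Lemma sfun_natE k x : O x -> (k%:R : A) x = k%:R.
Proof. by move=> Ox; rewrite -[LHS]/(sfun_eval Ox k%:R) rmorph_nat. Qed.

Lemma sfun_third : sfun_cst oO 3^-1 * 3 = 1.
Proof.
apply: sfunP => x Ox; rewrite sfun_mulE // sfun_1E // sfun_cstE // sfun_natE //.
by field.
Qed.

End SfunInverse.

Lemma derive_rsubmx (R : realType) m n (f : 'rV[R]_n.+1 -> R)
    (v y : 'rV[R]_(m + n.+1)) :
  'D_v (fun z : 'rV[R]_(m + n.+1) => f (rsubmx z)) y = 'D_(rsubmx v) f (rsubmx y).
Proof.
rewrite /derive; set F := (X in lim (nbhs (fmap X _))); set K := (X in _ = lim (nbhs (fmap X _))).
suff -> : F = K by [].
by apply/funext => a; rewrite /F /K /= linearP.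
Qed.

Section LocalMetric.
Context {R : realType} {W : set 'rV[R]_3} (oW : open W).
Variable g : 'rV[R]_3 -> 'M[R]_3.
Hypothesis gs : forall i j, smooth_on W (fun x => g x i j).
Hypothesis gT : forall x, W x -> (g x)^T = g x.
Hypothesis g_pos : forall x (v : 'rV[R]_3), W x -> v != 0 ->
  0 < (v *m g x *m v^T) 0 0.

Local Notation A := (sfun oW).
Local Notation D := (@sfun_der R 2 W oW).
Local Notation half := (sfun_cst oW 2^-1).

Definition metric_sfun : 'M[A]_3 := \matrix_(i, j) sfun_of oW (gs i j).
Local Notation G := metric_sfun.

Lemma metric_sfunE i j x : W x -> G i j x = g x i j.
Proof. by move=> Wx; rewrite mxE sfun_ofE. Qed.

Lemma map_metric_sfun x (Wx : W x) : map_mx (sfun_eval Wx) G = g x.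
Proof. by apply/matrixP => i j; rewrite mxE /sfun_eval metric_sfunE. Qed.

Lemma metric_sfunT : G^T = G.
Proof.
apply/matrixP=> i j; apply: sfunP => x Wx; rewrite mxE !metric_sfunE //.
by rewrite -{1}gT // mxE.
Qed.

Lemma det_metric_neq0 x : W x -> (\det G) x != 0.
Proof.
move=> Wx; rewrite -[_ x]/(sfun_eval Wx (\det G)) -det_map_mx map_metric_sfun.
by rewrite -unitfE -unitmxE posdef_unit // => v; exact: g_pos.
Qed.

(** Cramer's rule, which shows that the inverse metric has smooth entries. *)
Definition cometric_sfun : 'M[A]_3 := sfun_inv det_metric_neq0 *: \adj G.
Local Notation H := cometric_sfun.

Lemma metric_mulV : G *m H = 1%:M.
Proof. by rewrite -scalemxAr mul_mx_adj scale_scalar_mx sfun_mulV. Qed.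

Let GH := metric_mulV.
Let GT := metric_sfunT.
Let hlf := @sfun_half R 2 W oW.
Let DM := @sfun_derM R 2 W oW.
Let DC := @sfun_derC R 2 W oW.

Local Notation Ric := (fricci D half G H).

Let ev (a : A) (x : 'rV[R]_3) : R := a x.

Let evE y (Wy : W y) a : ev a y = sfun_eval Wy a. Proof. by []. Qed.
Let evD i a y : W y -> ev (D i a) y = partial i (ev a) y.
Proof. exact: sfun_derE. Qed.
Let gG i j y : W y -> g y i j = ev (G i j) y.
Proof. by move=> Wy; rewrite /ev metric_sfunE. Qed.

Lemma ricciE i j x : W x -> ricci g x i j = Ric i j x.
Proof. exact: (transfer_ricci oW evE evD hlf GH gG). Qed.

Lemma invmxE i j x : W x -> invmx (g x) i j = H i j x.
Proof. exact: (transfer_invmx evE GH gG). Qed.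

Lemma hessianE f (a : A) i j x : (forall z, W z -> f z = a z) -> W x ->
  hessian g f x i j = fhessian D half G H a i j x.
Proof. exact: (transfer_hessian oW evE evD hlf GH gG). Qed.

Lemma diff_rowE f (a : A) i x : (forall z, W z -> f z = a z) -> W x ->
  diff_row f x 0 i = D i a x.
Proof. by move=> fa Wx; rewrite mxE sfun_derE //; exact: partial_eq Wx. Qed.

Lemma map_invmxE x (Wx : W x) : map_mx (sfun_eval Wx) H = invmx (g x).
Proof. by apply/matrixP => i j; rewrite mxE invmxE. Qed.

Lemma map_ricciE x (Wx : W x) : map_mx (sfun_eval Wx) (\matrix_(i, j) Ric i j) = ricci g x.
Proof. by apply/matrixP => i j; rewrite [RHS]ricciE // !mxE. Qed.

Lemma ricci_sym x : W x -> (ricci g x)^T = ricci g x.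
Proof.
move=> Wx; apply/matrixP=> i j; rewrite [LHS]mxE.
apply: etrans (ricciE j i Wx) _; apply: etrans _ (esym (ricciE i j Wx)).
exact: (congr1 (fun a : A => a x) (fricciC hlf DM DC GH GT j i)).
Qed.

Lemma ricci_smooth i j : smooth_on W (fun x => ricci g x i j).
Proof.
apply: (smooth_eq oW) (sfun_smooth (Ric i j)) => x Wx.
by rewrite ricciE.
Qed.

Lemma cometric_transfer (u w : 'rV[A]_3) x (Wx : W x) :
  cometric H u w x = (map_mx (sfun_eval Wx) u *m invmx (g x)
                      *m (map_mx (sfun_eval Wx) w)^T) 0 0.
Proof.
rewrite -map_invmxE // -map_mxM map_trmx -map_mxM /= mxE.
by [].
Qed.

Lemma map_differential f (a : A) x (Wx : W x) : (forall z, W z -> f z = a z) ->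
  map_mx (sfun_eval Wx) (differential D a) = diff_row f x.
Proof.
move=> fa; apply/rowP=> i; apply: etrans _ (esym (diff_rowE i fa Wx)).
by rewrite !mxE.
Qed.

Lemma sqnorm_diffE f (a : A) x : (forall z, W z -> f z = a z) -> W x ->
  sqnorm_diff g f x = cometric H (differential D a) (differential D a) x.
Proof. by move=> fa Wx; rewrite cometric_transfer (map_differential Wx fa). Qed.

Lemma tr_ricci2_smooth : smooth_on W (tr_ricci2 g).
Proof.
apply: (smooth_eq oW) (sfun_smooth (\tr ((\matrix_(i, j) Ric i j *m H) ^+ 2))) => x Wx.
rewrite /tr_ricci2 /ricci_endo -(map_ricciE Wx) -(map_invmxE Wx) -map_mxM.
by rewrite -rmorphXn /= trace_map_mx.
Qed.

Lemma tr_ricci3_smooth : smooth_on W (tr_ricci3 g).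
Proof.
apply: (smooth_eq oW) (sfun_smooth (\tr ((\matrix_(i, j) Ric i j *m H) ^+ 3))) => x Wx.
rewrite /tr_ricci3 /ricci_endo -(map_ricciE Wx) -(map_invmxE Wx) -map_mxM.
by rewrite -rmorphXn /= trace_map_mx.
Qed.

Section StaticSpacetime.
Variable (U : 'rV[R]_3 -> R).
Hypothesis sU : smooth_on W U.

Definition potential_sfun : A := sfun_of oW sU.
Local Notation Ua := potential_sfun.

Let s2U : smooth_on W (fun x => expR (2 * U x)).
Proof. by apply: smooth_exp => //; apply: smoothM => //; exact: smooth_cst. Qed.

Let w : A := sfun_of oW s2U.

Let wE x : W x -> w x = expR (2 * U x). Proof. exact: sfun_ofE. Qed.

Let w0 x : W x -> w x != 0.
Proof. by move=> Wx; rewrite wE // gt_eqF // expR_gt0. Qed.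

Let Dw i : D i w = 2 * w * D i Ua.
Proof.
apply: sfunP => x Wx; rewrite !sfun_mulE // !sfun_derE // sfun_natE // wE //.
rewrite (partial_eq oW (g := fun y => expR (2 * U y)) _ _ Wx); last exact: wE.
rewrite [in RHS](partial_eq oW (g := U) _ _ Wx); last by move=> y Wy; rewrite sfun_ofE.
have dU := smooth_differentiable sU Wx.
have dc : differentiable (cst 2 : 'rV[R]_3 -> R) x by exact: differentiable_cst.
have d2U : differentiable (fun y => 2 * U y) x by exact: differentiableM.
have [_ ->] := partial_comp i d2U (is_derive_expR (2 * U x)).
rewrite (partialM _ dc dU) partial_cst; ring.
Qed.

Definition spacetime_domain : set 'rV[R]_(1 + 3) := [set y | W (rsubmx y)].
Local Notation W4 := spacetime_domain.

Lemma open_spacetime_domain : open (W4 : set 'rV[R]_4).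
Proof.
apply: (@open_comp 'rV[R]_(1 + 3) 'rV[R]_3 rsubmx) => //.
by move=> y _; exact: continuous_rsubmx.
Qed.

Let ev4 (a : A) (y : 'rV[R]_(1 + 3)) : R := a (rsubmx y).
Let phi4 (y : 'rV[R]_(1 + 3)) (Wy : W4 y) : {rmorphism A -> R} := sfun_eval (x := rsubmx y) Wy.
Let ev4E (y : 'rV[R]_(1 + 3)) (Wy : W4 y) a : ev4 a y = phi4 Wy a. Proof. by []. Qed.

Let D4 := @static_derivation A 3 D.

Let ev4D i a (y : 'rV[R]_(1 + 3)) : W4 y -> ev4 (D4 i a) y = @partial R 3 i (ev4 a) y.
Proof.
move=> Wy; apply: etrans _ (esym (@derive_rsubmx R 1 2 a (delta_mx 0 i) y)).
rewrite /D4 /static_derivation /ev4; case: split_ordP => j ->.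
  rewrite (_ : rsubmx (delta_mx 0 (lshift 3 j)) = 0 :> 'rV[R]_3) ?derive0; last first.
    by apply/rowP=> k; rewrite !mxE eq_rlshift andbF.
  exact: rmorph0 (phi4 Wy).
apply: etrans (sfun_derE (x := rsubmx y) _ _ Wy) _; rewrite /partial; congr ('D_ _ _ _).
by apply/rowP=> k; rewrite !mxE (inj_eq (@rshift_inj 1 3)).
Qed.

Let G4 : 'M[A]_(1 + 3) := block_mx (- w)%:M 0 0 G.
Let H4 : 'M[A]_(1 + 3) := block_mx (- sfun_inv w0)%:M 0 0 H.

Let GH4 : G4 *m H4 = 1%:M.
Proof.
rewrite mulmx_block !mulmx0 !mul0mx !addr0 !add0r GH.
by rewrite -scalar_mxM mulrNN [w * _]mulrC sfun_mulV -scalar_mx_block.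
Qed.

Let g4G i j (y : 'rV[R]_(1 + 3)) : W4 y -> static_metric U g y i j = ev4 (G4 i j) y.
Proof.
move=> Wy; rewrite (ev4E Wy).
have -> : phi4 Wy (G4 i j) = (map_mx (phi4 Wy) G4) i j by rewrite [RHS]mxE.
have wy : phi4 Wy (- w) = - expR (2 * U (rsubmx y)).
  by rewrite rmorphN; congr (- _); exact: wE.
rewrite map_block_mx map_scalar_mx !map_mx0 [map_mx _ G]map_metric_sfun.
exact: (congr1 (fun c : R => block_mx c%:M 0 0 (g (rsubmx y)) i j) (esym wy)).
Qed.

Lemma static_metric_unit (y : 'rV[R]_(1 + 3)) : W4 y ->
  static_metric U g y \in unitmx.
Proof.
move=> Wy.
have gE : static_metric U g y = map_mx (phi4 Wy) G4.
  by apply/matrixP=> i j; rewrite g4G // [RHS]mxE.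
have : static_metric U g y *m map_mx (phi4 Wy) H4 = 1%:M.
  by rewrite gE -map_mxM GH4 map_mx1.
by case/mulmx1_unit.
Qed.

Let ricci4E i j (y : 'rV[R]_(1 + 3)) : W4 y ->
  @ricci R 3 (static_metric U g) y i j = fricci D4 half G4 H4 i j (rsubmx y).
Proof.
move=> Wy.
exact: (@transfer_ricci R 3 A D4 half G4 H4 W4 open_spacetime_domain ev4 phi4
  ev4E ev4D hlf GH4 (static_metric U g) g4G i j y Wy).
Qed.

Lemma static_vacuum_ricci :
  (forall T x, W x -> @ricci R 3 (static_metric U g) (spacetime_point T x) = 0) ->
  forall i j, Ric i j = fhessian D half G H Ua i j + D i Ua * D j Ua.
Proof.
move=> R0 i j.
have : fricci D4 half G4 H4 (rshift 1 i) (rshift 1 j) = 0.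
  apply: sfunP => x Wx.
  have W4x : W4 (spacetime_point 0 x) by rewrite /W4 /= row_mxKr.
  have := ricci4E (rshift 1 i) (rshift 1 j) W4x.
  rewrite R0 // mxE row_mxKr => <-; exact: esym (rmorph0 (sfun_eval Wx)).
rewrite (static_ricci_rr G H hlf DC (sfun_mulV w0) Dw) => E.
by apply: (lincomb1 (c := 1) E); ring.
Qed.

Lemma ricci_static_vacuum :
  (forall i j, Ric i j = fhessian D half G H Ua i j + D i Ua * D j Ua) ->
  \sum_i \sum_j H i j * Ric i j = 0 ->
  forall T x, W x -> @ricci R 3 (static_metric U g) (spacetime_point T x) = 0.
Proof.
move=> RicE tr0 T x Wx.
have W4x : W4 (spacetime_point T x) by rewrite /W4 /= row_mxKr.
apply/matrixP=> i j; rewrite (ricci4E i j W4x) mxE row_mxKr.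
suff -> : fricci D4 half G4 H4 i j = 0 by exact: rmorph0 (sfun_eval Wx).
have Fzz := static_ricci_zz hlf DM GH GT (sfun_mulV w0) Dw.
have Fzr := static_ricci_zr G H hlf (sfun_mulV w0) Dw.
have Frz := static_ricci_rz G H hlf (sfun_mulV w0) Dw.
have Frr := static_ricci_rr G H hlf DC (sfun_mulV w0) Dw.
case: (@split_ordP 1 3 i) => i' ->; case: (@split_ordP 1 3 j) => j' ->; rewrite ?(ord1 i') ?(ord1 j').
- rewrite Fzz (_ : \sum_k _ = 0) ?mulr0 // -[RHS]tr0.
  by apply: eq_bigr => k _; apply: eq_bigr => l _; rewrite RicE.
- exact: Fzr.
- exact: Frz.
- by rewrite Frr RicE; ring.
Qed.

End StaticSpacetime.
End LocalMetric.

(** * Cube roots and type D metrics with a smooth axis *)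

Section CubeRoot.
Context {R : realType}.
Implicit Types (c s : R).

(** Where the sign [s] is constant, this form shows the cube root to be smooth and to have the sign
    [s]. *)
Lemma cbrt_signed c s : s * s = 1 -> 0 < s * c ->
  cbrt c = s * expR (3^-1 * ln (s * c)).
Proof.
move=> ss; have /eqP : (s - 1) * (s + 1) = 0 by rewrite -subr_sqr expr2 ss expr1n subrr.
rewrite mulf_eq0 subr_eq0 addr_eq0 => /orP[] /eqP ->.
  by rewrite mul1r => c0; rewrite /cbrt gtr0_sg // gtr0_norm // /powR gt_eqF.
rewrite mulN1r oppr_gt0 => c0.
by rewrite /cbrt ltr0_sg // ltr0_norm // /powR gt_eqF // oppr_gt0.
Qed.

Lemma cbrt_cube c : cbrt c * cbrt c * cbrt c = c.
Proof.
rewrite /cbrt; set p := `|c| `^ _.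
have pE : p * p * p = `|c|.
  rewrite -expr2 -exprSr -powR_mulrn ?powR_ge0 // -powRrM mulVf // powRr1 //.
have [->|c0] := eqVneq c 0; first by rewrite sgr0 !mul0r.
rewrite (_ : _ * _ * _ = (Num.sg c * Num.sg c) * Num.sg c * (p * p * p)); last by ring.
by rewrite pE -expr2 sqr_sg c0 mul1r -numEsg.
Qed.

End CubeRoot.

Section SfunChain.
Context {R : realType} {n : nat} {O : set 'rV[R]_n.+1} {oO : open O}.
Local Notation A := (sfun oO).

Lemma sfun_der_comp (phi : R -> R) (a b d : A) i :
  (forall x, O x -> b x = phi (a x)) ->
  (forall x, O x -> is_derive (a x) 1 phi (d x)) ->
  sfun_der oO i b = d * sfun_der oO i a.
Proof.
move=> bE dphi; apply: sfunP => x Ox; rewrite sfun_mulE // !sfun_derE //.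
rewrite (partial_eq oO (g := phi \o a) _ bE Ox).
by have [_ ->] := partial_comp i (sfun_differentiable a Ox) (dphi x Ox).
Qed.

End SfunChain.

(* [e] is the unit eigenvector of the simple eigenvalue, with its index lowered,
   and [s] is the sign of [mu]. *)
Section TypeDLocal.
Context {R : realType} {W : set 'rV[R]_3} (oW : open W).
Variable g : 'rV[R]_3 -> 'M[R]_3.
Hypothesis gs : forall i j, smooth_on W (fun x => g x i j).
Hypothesis gT : forall x, W x -> (g x)^T = g x.
Hypothesis g_pos : forall x (v : 'rV[R]_3), W x -> v != 0 ->
  0 < (v *m g x *m v^T) 0 0.
Variables (mu : 'rV[R]_3 -> R) (s : R) (e : 'I_3 -> 'rV[R]_3 -> R).
Hypothesis smu : smooth_on W mu.
Hypothesis ss : s * s = 1.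
Hypothesis s_mu : forall x, W x -> 0 < s * mu x.
Hypothesis se : forall i, smooth_on W (e i).
Let er x : 'rV[R]_3 := \row_i e i x.
Hypothesis ricci_mu : forall x i j, W x ->
  ricci g x i j = mu x * (g x i j - 3 * (e i x * e j x)).
Hypothesis e_unit : forall x, W x -> (er x *m invmx (g x) *m (er x)^T) 0 0 = 1.
Hypothesis inv : forall x, W x -> typeD_invariants (ricci_endo g x) (mu x).

Local Notation A := (sfun oW).
Local Notation D := (@sfun_der R 2 W oW).
Local Notation half := (sfun_cst oW 2^-1).
Local Notation third := (sfun_cst oW 3^-1).
Local Notation G := (metric_sfun oW gs).
Local Notation H := (cometric_sfun oW gs g_pos).
Local Notation Ric := (fricci D half G H).

Let GH := metric_mulV oW gs g_pos.
Let GT := metric_sfunT oW gs gT.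
Let hlf := @sfun_half R 2 W oW.
Let thd := @sfun_third R 2 W oW.
Let DM := @sfun_derM R 2 W oW.
Let DC := @sfun_derC R 2 W oW.
Let red := @sfun_reduced R 2 W oW.

Lemma mu_neq0 x : W x -> mu x != 0.
Proof. by move=> /s_mu; apply: contraTneq => ->; rewrite mulr0 ltxx. Qed.

Let metric_unit x : W x -> g x \in unitmx.
Proof. by move=> Wx; apply: posdef_unit => v; exact: g_pos. Qed.

Let M : A := sfun_of oW smu.
Let ME x : W x -> M x = mu x. Proof. exact: sfun_ofE. Qed.
Let M0 x : W x -> M x != 0. Proof. by move=> Wx; rewrite ME // mu_neq0. Qed.
Let ea : 'rV[A]_3 := \row_i sfun_of oW (se i).
Let eaE i x : W x -> ea 0 i x = e i x. Proof. by move=> Wx; rewrite mxE sfun_ofE. Qed.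

Let map_ea x (Wx : W x) : map_mx (sfun_eval Wx) ea = er x.
Proof. by apply/rowP=> i; rewrite mxE [RHS]mxE; exact: eaE. Qed.

Let ea_unit : cometric H ea ea = 1.
Proof.
apply: sfunP => x Wx; rewrite sfun_1E // (cometric_transfer gs g_pos _ _ Wx).
by rewrite map_ea e_unit.
Qed.

Let RicE i j : Ric i j = M * (G i j - 3 * (ea 0 i * ea 0 j)).
Proof.
apply: sfunP => x Wx; rewrite -(ricciE oW gs g_pos) // ricci_mu //.
rewrite sfun_mulE // sfun_addE // sfun_oppE // !sfun_mulE // sfun_natE //.
by rewrite ME // metric_sfunE // !eaE.
Qed.

Definition omega_root x := cbrt ((18 * mu x)^-1).
Local Notation F := omega_root.

Let s_F x : W x -> 0 < s * (18 * mu x)^-1.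
Proof.
move=> Wx; have s0 := s_mu Wx; have m0 := mu_neq0 Wx.
have -> : s * (18 * mu x)^-1 = (s * mu x) / (18 * (mu x * mu x)).
  by field; rewrite m0.
by rewrite divr_gt0 // mulr_gt0 // -expr2 exprn_even_gt0.
Qed.

Let sF : smooth_on W F.
Proof.
apply: (smooth_eq oW (f := fun x => s * expR (3^-1 * ln (s * (18 * mu x)^-1)))).
  by move=> x Wx; rewrite /F (cbrt_signed ss) //; exact: s_F.
have s18 : smooth_on W (fun x => 18 * mu x).
  by apply: smoothM => //; exact: smooth_cst.
have s18V : smooth_on W (fun x => s * (18 * mu x)^-1).
  apply: smoothM => //; first exact: smooth_cst.
  apply: (smooth_inv oW s18) => x Wx.
  by rewrite mulf_neq0 ?mu_neq0 ?pnatr_eq0.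
have sl := smooth_ln oW s18V s_F.
have s3l := smoothM oW (smooth_cst oW 3^-1) sl.
exact (smoothM oW (smooth_cst oW s) (smooth_exp oW s3l)).
Qed.

Let Fa : A := sfun_of oW sF.
Let FaE x : W x -> Fa x = F x. Proof. exact: sfun_ofE. Qed.

Lemma omega_root_cube x : F x * F x * F x = (18 * mu x)^-1.
Proof. exact: cbrt_cube. Qed.

Lemma omega_root_neq0 x : W x -> F x != 0.
Proof.
move=> Wx; apply/negP => /eqP F0; have := omega_root_cube x.
rewrite F0 !mul0r => /esym/eqP.
by rewrite invr_eq0 mulf_eq0 pnatr_eq0 (negPf (mu_neq0 Wx)).
Qed.

Let Fa0 x : W x -> Fa x != 0.
Proof. by move=> Wx; rewrite FaE // omega_root_neq0. Qed.

Let FV : A := sfun_inv Fa0.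
Let FVE : FV * Fa = 1. Proof. exact: sfun_mulV. Qed.
Let FVx x : W x -> FV x = (F x)^-1.
Proof. by move=> Wx; rewrite /FV sfun_invE // FaE. Qed.

Let MV : A := sfun_inv M0.
Let MVE : MV * M = 1. Proof. exact: sfun_mulV. Qed.

Let cubeA : 18 * M * Fa * Fa * Fa = 1.
Proof.
apply: sfunP => x Wx; rewrite !sfun_mulE // sfun_natE // ME // FaE // sfun_1E //.
rewrite (_ : _ * _ * _ = (18 * mu x) * (F x * F x * F x)); last by ring.
by rewrite omega_root_cube mulfV // mulf_neq0 ?mu_neq0 ?pnatr_eq0.
Qed.

(** Differentiate 18 mu F^3 = 1 and cancel 18 F^2, a unit with inverse F mu. *)
Let DFa i : 3 * M * D i Fa = - Fa * D i M.
Proof.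
have nat0 k : D i k%:R = 0 by rewrite raddfMn (derivation1 DM) mul0rn.
have := congr1 (D i) cubeA; rewrite !DM nat0 (derivation1 DM) => E.
have x18 : (Fa * M) * (18 * Fa * Fa) = 1.
  by apply: etrans cubeA; ring.
apply: (cancel_unit x18).
by apply: (lincomb1 (c := 1) E); ring.
Qed.

(** This is e(mu), e being given as a covector. *)
Definition axis_derivative x : R :=
  (er x *m invmx (g x) *m (diff_row mu x)^T) 0 0.

Let axis_derivativeE x : W x ->
  (\sum_j raise H (ea 0) j * D j M) x = axis_derivative x.
Proof.
move=> Wx.
have -> : \sum_j raise H (ea 0) j * D j M = cometric H ea (differential D M).
  by rewrite (cometricE GH GT); apply: eq_bigr => j _; rewrite [X in _ = _ * X]mxE.
rewrite (cometric_transfer gs g_pos _ _ Wx) map_ea.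
by rewrite (map_differential Wx (f := mu)) // => z Wz; rewrite ME.
Qed.

Let tr2 x : tr_ricci2 g x = \tr (ricci_endo g x *m ricci_endo g x).
Proof. by rewrite /tr_ricci2 expr2. Qed.

Let tr3 x : tr_ricci3 g x = \tr (ricci_endo g x *m ricci_endo g x *m ricci_endo g x).
Proof. by rewrite /tr_ricci3 !exprS expr0 mulr1 mulrA. Qed.

Lemma tr_ricci2_mu x : W x -> tr_ricci2 g x = 6 * mu x ^+ 2.
Proof. by move=> Wx; have [_ t2 _] := inv Wx; rewrite tr2. Qed.

Lemma tr_ricci3_mu x : W x -> tr_ricci3 g x = - (6 * mu x ^+ 3).
Proof. by move=> Wx; have [_ _ t3] := inv Wx; rewrite tr3. Qed.

Lemma Omega_mu x : W x -> Omega g x = (18 * mu x)^-1.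
Proof.
move=> Wx; rewrite /Omega tr_ricci2_mu // tr_ricci3_mu //.
by field; rewrite mu_neq0.
Qed.

Let Omega_F x : W x -> Omega g x = (Fa * Fa * Fa) x.
Proof. by move=> Wx; rewrite !sfun_mulE // FaE // omega_root_cube Omega_mu. Qed.

Lemma Ptensor_mu x : W x ->
  Ptensor g x = (18 * mu x ^+ 2) *: ((er x)^T *m er x).
Proof.
move=> Wx; rewrite /Ptensor tr_ricci2_mu //.
have RE : ricci g x = mu x *: (g x - 3 *: ((er x)^T *m er x)).
  by apply/matrixP=> i j; rewrite ricci_mu // !(addmxE, oppmxE, scalemxE) mxE big_ord1 !mxE.
have u1 : er x *m invmx (g x) *m (er x)^T = 1%:M.
  by rewrite [LHS]mx11_scalar e_unit.
have u := metric_unit Wx.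
rewrite RE -scalemxAl -scalemxAr -scalemxAl.
have -> : (g x - 3 *: ((er x)^T *m er x)) *m invmx (g x) *m (g x - 3 *: ((er x)^T *m er x))
   = g x + 3 *: ((er x)^T *m er x).
  rewrite mulmxBl mulmxV // mulmxBl mul1mx -!scalemxAl mulmxBr mulmxKV //.
  rewrite -scalemxAr -!mulmxA (mulmxA (invmx _)) (mulmxA (er x)) (mulmxA (er x)) u1.
  rewrite mul1mx; apply/matrixP=> i j; rewrite !(addmxE, oppmxE, scalemxE); ring.
by apply/matrixP=> i j; rewrite !(addmxE, oppmxE, scalemxE); ring.
Qed.

(** The factor 216 mu^3 is the product of 18 mu^2 from P and 12 mu from ds, as s = 6 mu^2. *)
Lemma Pcontract_mu x : W x ->
  Pcontract g (tr_ricci2 g) x = (216 * mu x ^+ 3 * axis_derivative x) *: er x.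
Proof.
move=> Wx.
have ds : diff_row (tr_ricci2 g) x = (12 * mu x) *: diff_row mu x.
  apply/rowP=> i; rewrite !mxE.
  rewrite (partial_eq oW (g := fun y => (6 * mu y) * mu y) _ _ Wx); last first.
    by move=> y Wy; rewrite tr_ricci2_mu //; ring.
  have dmu := smooth_differentiable smu Wx.
  have dc : differentiable (cst 6 : 'rV[R]_3 -> R) x by exact: differentiable_cst.
  have d6 : differentiable (fun y => 6 * mu y) x by exact: differentiableM.
  by rewrite (partialM _ d6 dmu) (partialM _ dc dmu) partial_cst; ring.
rewrite /Pcontract Ptensor_mu // ds linearZ /= -scalemxAr -!scalemxAl.
rewrite -!mulmxA (mulmxA (er x)) -/(axis_derivative x).
rewrite [er x *m _ *m _]mx11_scalar -/(axis_derivative x) mul_mx_scalar.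
rewrite !linearZ /= trmxK !scalerA; congr (_ *: _); ring.
Qed.

Lemma Pcontract_eq0 x : W x ->
  Pcontract g (tr_ricci2 g) x = 0 <-> axis_derivative x = 0.
Proof.
move=> Wx; rewrite Pcontract_mu //; split=> [|->]; last by rewrite mulr0 scale0r.
have er0 : er x != 0.
  apply/eqP => er0; have := e_unit Wx; rewrite er0 !mul0mx mxE => /esym/eqP.
  by rewrite oner_eq0.
have c0 : 216 * mu x ^+ 3 != 0 by rewrite mulf_neq0 ?pnatr_eq0 ?expf_neq0 ?mu_neq0.
by move/eqP; rewrite scaler_eq0 (negPf er0) orbF mulf_eq0 (negPf c0) => /eqP.
Qed.

Lemma hessian_condition x : W x ->
  let f := fun y => cbrt (Omega g y) in
  ricci g x = (f x)^-1 *: hessian g f x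
    - (2 * (Omega g x + sqnorm_diff g (Omega g) x)) *: Ptensor g x <->
  forall i j, fhessian D half G H Fa i j x =
    (Fa * (Ric i j + (2 * M + FV * FV * cometric H (differential D Fa) (differential D Fa))
       * (ea 0 i * ea 0 j))) x.
Proof.
move=> Wx f.
have fE y : W y -> f y = Fa y by move=> Wy; rewrite /f Omega_mu // FaE.
set d2 := cometric _ _ _.
have sqE : sqnorm_diff g (Omega g) x = 9 * F x ^+ 4 * d2 x.
  rewrite (sqnorm_diffE gs g_pos Omega_F Wx).
  have -> : differential D (Fa * Fa * Fa) = (3 * Fa * Fa) *: differential D Fa.
    by apply/rowP=> i; rewrite !mxE !DM; ring.
  have -> : cometric H ((3 * Fa * Fa) *: differential D Fa) ((3 * Fa * Fa) *: differential D Fa)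
     = 9 * (Fa * Fa * Fa * Fa) * d2.
    have cZ u w a : cometric H (a *: u) w = a * cometric H u w.
      by rewrite /cometric -!scalemxAl scalemxE.
    by rewrite cZ (cometricC GH GT) cZ -/d2; ring.
  by rewrite !sfun_mulE // sfun_natE // FaE //; ring.
have F0 := omega_root_neq0 Wx; have m0 := mu_neq0 Wx.
have F3 : mu x = (18 * F x ^+ 3)^-1.
  have := omega_root_cube x; rewrite (_ : F x * F x * F x = F x ^+ 3); last by ring.
  by move=> ->; field.
have HE i j : hessian g f x i j = fhessian D half G H Fa i j x.
  exact: hessianE.
have PE i j : Ptensor g x i j = 18 * mu x ^+ 2 * (e i x * e j x).
  by rewrite Ptensor_mu // scalemxE mxE big_ord1 !mxE.
have RE i j : ricci g x i j = Ric i j x by exact: ricciE.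
have rhsE i j : (Fa * (Ric i j + (2 * M + FV * FV * d2) * (ea 0 i * ea 0 j))) x
    = F x * (ricci g x i j + (2 * mu x + (F x)^-1 * (F x)^-1 * d2 x) * (e i x * e j x)).
  rewrite sfun_mulE // FaE // sfun_addE // -RE; congr (_ * (_ + _)).
  by rewrite sfun_mulE // sfun_addE // !sfun_mulE // sfun_natE // ME // FVx // !eaE.
have fx : f x = F x by rewrite fE // FaE.
have OmE : Omega g x = F x ^+ 3 by rewrite Omega_F // !sfun_mulE // FaE //; ring.
rewrite sqE fx OmE; move: (Ptensor g x) (hessian g f x) PE HE => P N PE HE.
split=> [E i j|E].
  rewrite rhsE E !(addmxE, oppmxE, scalemxE) HE PE F3; field.
  by [].
apply/matrixP=> i j; rewrite !(addmxE, oppmxE, scalemxE) HE PE.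
rewrite E rhsE F3; field.
by [].
Qed.

Let axis_derivative0 : (forall x, W x -> axis_derivative x = 0) ->
  \sum_j raise H (ea 0) j * D j M = 0.
Proof.
move=> a0; apply: sfunP => x Wx; rewrite axis_derivativeE // a0 //.
exact: esym (rmorph0 (sfun_eval Wx)).
Qed.

Let hessian_ln (N : A) U (sU : smooth_on W U) i j :
  (forall x, W x -> N x = expR (U x)) ->
  let Ua := potential_sfun oW sU in
  fhessian D half G H N i j = N * (fhessian D half G H Ua i j + D i Ua * D j Ua).
Proof.
move=> NU Ua; apply: (hessian_exp _ _ _ DM) => k.
apply: (sfun_der_comp (phi := expR)) => x Wx; first by rewrite NU // sfun_ofE.
by rewrite NU // sfun_ofE //; exact: is_derive_expR.
Qed.

Lemma hessian_condition_of_vacuum U : static_vacuum W U g ->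
  (forall x, W x -> axis_derivative x = 0) -> forall x, W x ->
  let f := fun y => cbrt (Omega g y) in
  ricci g x = (f x)^-1 *: hessian g f x
    - (2 * (Omega g x + sqnorm_diff g (Omega g) x)) *: Ptensor g x.
Proof.
move=> [sU vac] a0 x Wx; apply/hessian_condition => // i j.
pose N : A := sfun_of oW (smooth_exp oW sU).
have N0 y : W y -> N y != 0 by move=> Wy; rewrite sfun_ofE // gt_eqF // expR_gt0.
have hN k l : fhessian D half G H N k l = N * Ric k l.
  rewrite (static_vacuum_ricci oW gs g_pos sU vac); apply: hessian_ln => y Wy.
  by rewrite sfun_ofE.
by rewrite (hessian_F_of_potential hlf thd DM DC GH GT MVE ea_unit RicE FVE DFa
  (axis_derivative0 a0) (sfun_mulV N0) hN).
Qed.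

Section Reconstruction.
Hypothesis a0 : forall x, W x -> axis_derivative x = 0.
Hypothesis hess : forall x, W x ->
  let f := fun y => cbrt (Omega g y) in
  ricci g x = (f x)^-1 *: hessian g f x
    - (2 * (Omega g x + sqnorm_diff g (Omega g) x)) *: Ptensor g x.

Let d2 := cometric H (differential D Fa) (differential D Fa).

Let hessF i j : fhessian D half G H Fa i j =
  Fa * (Ric i j + (2 * M + FV * FV * d2) * (ea 0 i * ea 0 j)).
Proof. by apply: sfunP => x Wx; move/hessian_condition: (hess Wx); apply. Qed.

Lemma axis_form_smooth i : smooth_on W (fun x => (F x)^-1 * e i x).
Proof.
apply: (smooth_eq oW) (sfun_smooth (FV * ea 0 i)) => x Wx.
by rewrite sfun_mulE // FVx // eaE.
Qed.

Let axis_formE i x : W x -> (F x)^-1 * e i x = (FV * ea 0 i) x.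
Proof. by move=> Wx; rewrite sfun_mulE // FVx // eaE. Qed.

Lemma axis_form_closed i j x : W x ->
  partial j (fun x => (F x)^-1 * e i x) x = partial i (fun x => (F x)^-1 * e j x) x.
Proof.
move=> Wx; rewrite !(partial_eq oW _ (axis_formE _) Wx) -!sfun_derE //.
by rewrite (e_over_F_closed hlf thd DM DC GH GT MVE ea_unit RicE FVE DFa
  (axis_derivative0 a0) red hessF).
Qed.

(* The constant kappa in the equation c'' = - kappa c for exp U = F c. *)
Definition typeD_energy x := 2 * mu x * F x * F x + sqnorm_diff g F x.

Let kappa : A := 2 * M * Fa * Fa + d2.

Let kappaE x : W x -> kappa x = typeD_energy x.
Proof.
move=> Wx; have FE y : W y -> F y = Fa y by move=> Wy; rewrite FaE.
rewrite /typeD_energy (sqnorm_diffE gs g_pos FE Wx) sfun_addE // !sfun_mulE //.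
by rewrite sfun_natE // ME // FaE.
Qed.

Let Dkappa i : D i kappa = 0.
Proof.
exact: (kappa_const hlf thd DM GH GT MVE RicE FVE DFa
  (axis_derivative0 a0) hessF).
Qed.

(** Both F and c have the sign s, so N = F c is positive and has a logarithm. *)
Let vacuum_of_warping (theta c c1 : A) :
  (forall i, D i theta = FV * ea 0 i) ->
  (forall x, W x -> 0 < s * c x) ->
  (forall k, D k c = c1 * D k theta) ->
  (forall k, D k c1 = - kappa * c * D k theta) ->
  exists U, static_vacuum W U g.
Proof.
move=> Dth sc Dc Dc1.
pose N : A := Fa * c.
have N0 x : W x -> 0 < N x.
  move=> Wx; rewrite sfun_mulE //.
  have sF0 : 0 < s * Fa x.
    rewrite FaE // /F (cbrt_signed ss); last exact: s_F.
    by rewrite mulrA ss mul1r expR_gt0.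
  have := mulr_gt0 sF0 (sc _ Wx).
  by rewrite mulrACA ss mul1r.
have sU := smooth_ln oW (sfun_smooth N) N0.
exists (fun x => ln (N x)); split=> //.
move=> T x; apply: (ricci_static_vacuum gT (sU := sU)).
  move=> i j.
  have Nn x' : W x' -> N x' != 0 by move=> Wx'; rewrite gt_eqF // N0.
  apply: (cancel_unit (sfun_mulV Nn)).
  rewrite -(@hessian_ln N _ sU i j); last by move=> y Wy; rewrite lnK // posrE N0.
  rewrite (potential_of_hessian_F hlf thd DM DC GH GT MVE ea_unit RicE FVE DFa
    (axis_derivative0 a0) red hessF i j (erefl _) Dth Dc Dc1).
  by [].
exact: (scalar_curvature0 GH GT ea_unit RicE).
Qed.

(** The hypothesis on the cosine concerns a nonnegative energy. For a negative one [Num.sqrt]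
    returns 0, so the hypothesis reads 0 < cos 0, and the exponential solution is positive
    anyway. *)
Lemma static_potential theta x0 r : W = ball x0 r -> W x0 -> smooth_on W theta ->
  (forall i x, W x -> partial i theta x = (F x)^-1 * e i x) ->
  (forall x, W x -> 0 < cos (Num.sqrt (typeD_energy x0) * theta x)) ->
  exists U, static_vacuum W U g.
Proof.
move=> WB Wx0 sth pth cos_gt0; pose th : A := sfun_of oW sth.
have thE x : W x -> th x = theta x by exact: sfun_ofE.
have Dth i : D i th = FV * ea 0 i.
  apply: sfunP => x Wx; rewrite sfun_derE // -axis_formE // -pth //.
  exact: (partial_eq oW) Wx.
(* Vanishing partial derivatives give a constant because the domain is a ball. *)
have kc x : W x -> kappa x = typeD_energy x0.
  move=> Wx; rewrite -kappaE //.
  apply: (@partial0_constant R 2 kappa x0 r); last by rewrite -WB.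
    by move=> y; rewrite -WB; exact: sfun_differentiable.
  move=> i y; rewrite -WB => Wy; rewrite -sfun_derE // Dkappa.
  exact: (rmorph0 (sfun_eval Wy)).
have [k0|k0] := leP 0 (typeD_energy x0).
  pose a := Num.sqrt (typeD_energy x0).
  have aa : a * a = typeD_energy x0 by rewrite -expr2 sqr_sqrtr.
  have sath := smoothM oW (smooth_cst oW a) sth.
  pose c : A := sfun_cst oW s * sfun_of oW (smooth_cos oW sath).
  pose c1 : A := - (sfun_cst oW (s * a) * sfun_of oW (smooth_sin oW sath)).
  apply: (@vacuum_of_warping th c c1) => // [x Wx|k|k].
  - by rewrite sfun_mulE // sfun_cstE // sfun_ofE // mulrA ss mul1r cos_gt0.
  - apply: (sfun_der_comp (phi := fun t => s * cos (a * t))) => x Wx.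
      by rewrite sfun_mulE // sfun_cstE // sfun_ofE // thE.
    rewrite sfun_oppE // sfun_mulE // sfun_cstE // sfun_ofE // -thE //.
    by apply: is_derive_eq; rewrite /GRing.scale /=; ring.
  - apply: (sfun_der_comp (phi := fun t => - (s * a * sin (a * t)))) => x Wx.
      by rewrite sfun_oppE // sfun_mulE // sfun_cstE // sfun_ofE // thE.
    rewrite sfun_mulE // sfun_oppE // kc // sfun_mulE // sfun_cstE // sfun_ofE // -thE // -aa.
    by apply: is_derive_eq; rewrite /GRing.scale /=; ring.
pose a := Num.sqrt (- typeD_energy x0).
have aa : a * a = - typeD_energy x0 by rewrite -expr2 sqr_sqrtr // oppr_ge0 ltW.
have sath := smoothM oW (smooth_cst oW a) sth.
pose c : A := sfun_cst oW s * sfun_of oW (smooth_exp oW sath).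
pose c1 : A := sfun_cst oW a * c.
have cE x : W x -> c x = s * expR (a * th x).
  by move=> Wx; rewrite sfun_mulE // sfun_cstE // sfun_ofE // thE.
have Dc k : D k c = c1 * D k th.
  apply: (sfun_der_comp (phi := fun t => s * expR (a * t))) => x Wx; first exact: cE.
  rewrite sfun_mulE // sfun_cstE // cE //.
  by apply: is_derive_eq; rewrite /GRing.scale /=; ring.
apply: (@vacuum_of_warping th c c1) => // [x Wx|k].
  by rewrite cE // mulrA ss mul1r expR_gt0.
have Da : D k (sfun_cst oW a) = 0.
  apply: sfunP => x Wx; rewrite sfun_derE // (partial_eq oW (g := fun=> a) _ _ Wx).
    by rewrite partial_cst; exact: esym (rmorph0 (sfun_eval Wx)).
  by move=> y Wy; rewrite sfun_cstE.
rewrite DM Da Dc mul0r add0r mulrA; congr (_ * _).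
apply: sfunP => x Wx; rewrite !sfun_mulE // sfun_oppE // kc // sfun_cstE // mulrA aa.
by [].
Qed.

End Reconstruction.

End TypeDLocal.

(** * Principal planes and local choice of the axis *)

Section PrincipalPlanes.
Context {R : realType} {W : set 'rV[R]_3} (oW : open W).
Variable g : 'rV[R]_3 -> 'M[R]_3.
Hypothesis gs : forall i j, smooth_on W (fun x => g x i j).
Hypothesis gT : forall x, W x -> (g x)^T = g x.
Hypothesis g_pos : forall x (v : 'rV[R]_3), W x -> v != 0 ->
  0 < (v *m g x *m v^T) 0 0.
Variables (mu : 'rV[R]_3 -> R) (e : 'I_3 -> 'rV[R]_3 -> R).
Let er x : 'rV[R]_3 := \row_i e i x.
Hypothesis mu0 : forall x, W x -> mu x != 0.
Hypothesis ricci_mu : forall x i j, W x ->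
  ricci g x i j = mu x * (g x i j - 3 * (e i x * e j x)).
Hypothesis e_unit : forall x, W x -> (er x *m invmx (g x) *m (er x)^T) 0 0 = 1.

(** The metric lowers the index that [gradient] has raised, so the condition pairs dmu with the two
    spanning vectors; the pairing with the time direction vanishes because mu is static. *)
Lemma spacelike_gradient U T x v : smooth_on W U -> W x ->
  let y := spacetime_point T x in
  in_spacelike_principal_plane (static_metric U g y) v
    (@gradient R 3 (static_metric U g) (fun z : 'rV[R]_(1 + 3) => mu (rsubmx z)) y)
  <-> diff_row mu x *m v^T = 0.
Proof.
move=> sU Wx y; have Wy : @spacetime_domain R W y by rewrite /spacetime_domain /= row_mxKr.
have u := static_metric_unit oW gs g_pos sU Wy.
rewrite /in_spacelike_principal_plane /gradient.
have -> : @diff_row R 3 (fun z : 'rV[R]_(1 + 3) => mu (rsubmx z)) y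
    = row_mx 0 (diff_row mu x) :> 'rV[R]_(1 + 3).
  apply/rowP=> i; rewrite mxE; apply: etrans (@derive_rsubmx R 1 2 mu (delta_mx 0 i) y) _.
  rewrite row_mxKr; case: (@split_ordP 1 3 i) => j ->.
    rewrite row_mxEl mxE (_ : rsubmx (delta_mx 0 (lshift 3 j)) = 0 :> 'rV[R]_3) ?derive0 //.
    by apply/rowP=> k; rewrite !mxE eq_rlshift andbF.
  rewrite row_mxEr mxE /partial; congr ('D_ _ _ _).
  by apply/rowP=> k; rewrite !mxE (inj_eq (@rshift_inj 1 3)).
rewrite (mulmxKV u) tr_col_mx mul_mx_row.
rewrite !tr_row_mx !mul_row_col !trmx0 !mul0mx !mulmx0 !add0r.
split=> [E|->]; last by rewrite row_mx0.
by have := congr1 rsubmx E; rewrite row_mxKr linear0.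
Qed.

Lemma ricci_axis x : W x ->
  ricci g x = mu x *: (g x - 3 *: ((er x)^T *m er x)).
Proof.
move=> Wx; apply/matrixP=> i j; rewrite ricci_mu // !(addmxE, oppmxE, scalemxE).
by rewrite [X in _ = _ * (_ - _ * X)]mxE big_ord1 !mxE.
Qed.

Let gu x : W x -> g x \in unitmx.
Proof. by move=> Wx; apply: posdef_unit => v; exact: g_pos. Qed.

Let e_unitM x : W x -> er x *m invmx (g x) *m (er x)^T = 1%:M.
Proof. by move=> Wx; rewrite [LHS]mx11_scalar e_unit. Qed.

Lemma axis_unit_simple_eigenvector x : W x ->
  unit_simple_eigenvector g x (mu x) (er x *m invmx (g x)).
Proof.
move=> Wx; have u := gu Wx; have hT := invmx_sym (gT Wx); split.
  by rewrite (mulmxKV u) trmx_mul hT mulmxA e_unitM.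
rewrite /ricci_endo mulmxA ricci_axis // [RHS]scalemxAl; congr (_ *m _).
rewrite -scalemxAr mulmxBr (mulmxKV u) -scalemxAr mulmxA e_unitM // mul1mx.
by apply/rowP=> i; rewrite !(addmxE, oppmxE, scalemxE); ring.
Qed.

(** The definition of a B-metric quantifies over all unit eigenvectors. With c = e(v), the
    eigenvalue equation reads v - 3 c e = - 2 v after lowering the index, whence v = c e. *)
Lemma unit_simple_eigenvector_axis x v : W x ->
  unit_simple_eigenvector g x (mu x) v ->
  exists c : R, v = c *: (er x *m invmx (g x)).
Proof.
move=> Wx [_ vL]; have u := gu Wx.
have [c cE] : exists c, v *m (er x)^T = c%:M by eexists; exact: mx11_scalar.
exists c.
apply: (can_inj (mulmxK u)); rewrite -scalemxAl (mulmxKV u).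
have : v *m ricci g x = (- 2 * mu x) *: (v *m g x).
  by rewrite scalemxAl -vL /ricci_endo mulmxA (mulmxKV u).
rewrite ricci_axis // -scalemxAr mulmxBr -scalemxAr mulmxA cE.
rewrite mul_scalar_mx; move: (v *m g x) => w E.
apply/rowP=> i; have := congr1 (fun X : 'rV[R]_3 => X 0 i) E.
have m0 := mu0 Wx; rewrite !(addmxE, oppmxE, scalemxE) => E1.
have m3 : 3 * mu x != 0 by rewrite mulf_neq0 ?pnatr_eq0.
apply: (mulfI m3); apply: (lincomb1 (c := 1) E1); ring.
Qed.

Lemma axis_derivativeM x : W x ->
  diff_row mu x *m (er x *m invmx (g x))^T = (axis_derivative g mu e x)%:M.
Proof.
move=> Wx; rewrite -[LHS]trmxK trmx_mul trmxK.
by rewrite [X in X^T = _]mx11_scalar tr_scalar_mx.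
Qed.

Lemma spacelike_gradientP U : smooth_on W U ->
  (forall T x v, W x -> unit_simple_eigenvector g x (mu x) v ->
     let y := spacetime_point T x in
     in_spacelike_principal_plane (static_metric U g y) v
       (@gradient R 3 (static_metric U g)
          (fun z : 'rV[R]_(1 + 3) => mu (rsubmx z)) y)) <->
  (forall x, W x -> axis_derivative g mu e x = 0).
Proof.
move=> sU; split=> [plane x Wx|a0 T x v Wx ev].
  have := plane 0 _ _ Wx (axis_unit_simple_eigenvector Wx).
  move/(spacelike_gradient _ _ sU Wx); rewrite axis_derivativeM // => E.
  by have := congr1 (fun X : 'M[R]_1 => X 0 0) E; rewrite !mxE eqxx mulr1n.
apply/spacelike_gradient => //.
have [c ->] := unit_simple_eigenvector_axis Wx ev.
by rewrite linearZ /= -scalemxAr axis_derivativeM // a0 // -scalemx1 scale0r scaler0.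
Qed.

End PrincipalPlanes.

Lemma smooth_onS (R : realType) n (O W : set 'rV[R]_n.+1) f :
  W `<=` O -> smooth_on O f -> smooth_on W f.
Proof. by move=> WO sf s x /WO; exact: sf. Qed.

Lemma continuous_gt0 (R : realType) n (O : set 'rV[R]_n.+1) f x :
  open O -> smooth_on O f -> O x -> 0 < f x -> \forall y \near x, 0 < f y.
Proof.
move=> oO sf Ox f0; have /differentiable_continuous cf := smooth_differentiable sf Ox.
exact: (cf _ (lt_nbhsr f0)).
Qed.

(** The axis is a row of [axis_projection] divided by the square root of its diagonal entry: by rank
    one, the products of its components are the entries of the projection. The construction lives
    where that entry stays positive. *)
Lemma local_axis (R : realType) (W : set 'rV[R]_3) (g : 'rV[R]_3 -> 'M[R]_3)
    (mu : 'rV[R]_3 -> R) x0 :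
  open W -> (forall i j, smooth_on W (fun x => g x i j)) ->
  (forall x, W x -> (g x)^T = g x) ->
  (forall x (v : 'rV[R]_3), W x -> v != 0 -> 0 < (v *m g x *m v^T) 0 0) ->
  smooth_on W mu -> (forall x, W x -> mu x != 0) ->
  (forall x, W x -> typeD_invariants (ricci_endo g x) (mu x)) -> W x0 ->
  exists r s (e : 'I_3 -> 'rV[R]_3 -> R),
    [/\ 0 < r, ball x0 r `<=` W, s * s = 1,
      forall i, smooth_on (ball x0 r) (e i) &
      forall x, ball x0 r x -> [/\ 0 < s * mu x,
        forall i j, ricci g x i j = mu x * (g x i j - 3 * (e i x * e j x)) &
        ((\row_i e i x) *m invmx (g x) *m (\row_i e i x)^T) 0 0 = 1]].
Proof.
move=> oW gs gT g_pos smu mu0 inv Wx0.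
pose Q x := axis_projection (g x) (ricci g x) (mu x).
have pos x (Wx : W x) (v : 'rV[R]_3) : v != 0 -> 0 < (v *m g x *m v^T) 0 0 by exact: g_pos.
have RT x (Wx : W x) := ricci_sym oW gs gT g_pos Wx.
have sQ i j : smooth_on W (fun x => Q x i j).
  have sd : smooth_on W (fun x => mu x * g x i j - ricci g x i j).
    apply: smoothD => //; first exact (smoothM oW smu (gs i j)).
    exact (smoothN oW (ricci_smooth oW gs g_pos i j)).
  have s3 : smooth_on W (fun x => (3 * mu x)^-1).
    apply: smooth_inv => // [|x Wx]; last by rewrite mulf_neq0 ?pnatr_eq0 ?mu0.
    exact (smoothM oW (smooth_cst oW 3) smu).
  apply: (smooth_eq oW) (smoothM oW s3 sd) => x _.
  by rewrite /Q /axis_projection !(addmxE, oppmxE, scalemxE).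
have [k Qk] := axis_projection_gt0 (gT _ Wx0) (pos _ Wx0) (RT _ Wx0) (mu0 _ Wx0) (inv _ Wx0).
pose s := Num.sg (mu x0).
have ss : s * s = 1 by rewrite -expr2 sqr_sg mu0.
have ssmu : smooth_on W (fun x => s * mu x) := smoothM oW (smooth_cst oW s) smu.
have smu0 : 0 < s * mu x0 by rewrite /s -normrEsg normr_gt0 mu0.
have [r /= r0 B] : exists2 r : R, 0 < r & forall x, ball x0 r x -> [/\ W x, 0 < Q x k k & 0 < s * mu x].
  have : \forall x \near x0, [/\ W x, 0 < Q x k k & 0 < s * mu x].
    near=> x; split; near: x.
    - exact: near_open.
    - exact: continuous_gt0 (sQ k k) Wx0 Qk.
    - exact: continuous_gt0 ssmu Wx0 smu0.
  by move=> /nbhs_ballP[r /= r0 B]; exists r.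
have BW : ball x0 r `<=` W by move=> x /B[].
exists r, s, (fun i x => Q x k i / Num.sqrt (Q x k k)); split=> // [i|x /B[Wx Qx smux]].
  have oB : open (ball x0 r) by exact: ball_open.
  have Qk_gt0 x : ball x0 r x -> 0 < Q x k k by case/B.
  have sq := smooth_sqrt oB (smooth_onS BW (sQ k k)) Qk_gt0.
  have sq0 x : ball x0 r x -> Num.sqrt (Q x k k) != 0.
    by move=> /Qk_gt0 Qx; rewrite gt_eqF // sqrtr_gt0.
  exact (smoothM oB (smooth_onS BW (sQ k i)) (smooth_inv oB sq sq0)).
have QE i j : Q x k i / Num.sqrt (Q x k k) * (Q x k j / Num.sqrt (Q x k k)) = Q x i j.
  have QT : Q x i k = Q x k i.
    have QT : (Q x)^T = Q x by exact: axis_projection_sym (gT _ Wx) (RT _ Wx).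
    by rewrite -[in LHS]QT mxE.
  have := axis_projection_rank1 (gT _ Wx) (pos _ Wx) (RT _ Wx) (mu0 _ Wx) (inv _ Wx) k i j k.
  rewrite -!/(Q x) QT => E.
  rewrite mulrACA -invfM -expr2 sqr_sqrtr ?ltW // mulrC [Q x k i * _]mulrC E.
  by rewrite mulrA mulVf ?mul1r // gt_eqF.
split=> // [i j|].
  rewrite QE; have := axis_projection_ricci (g x) (ricci g x) (mu0 _ Wx).
  by rewrite -/(Q x) => {1}->; rewrite !(addmxE, oppmxE, scalemxE).
have <- : \tr (Q x *m invmx (g x)) = 1.
  exact: axis_projection_trace (pos _ Wx) (mu0 _ Wx) (inv _ Wx).
rewrite -trace_mx11 mxtrace_mulC mulmxA; congr (\tr (_ *m _)).
apply/matrixP=> i j; apply: etrans _ (QE i j); rewrite mxE big_ord1.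
by rewrite [X in X * _]mxE; congr (_ * _); rewrite mxE.
Unshelve. all: by end_near.
Qed.

(** * B-metrics *)

Section LocalTheorem.
Context {R : realType} {O : set 'rV[R]_3} (oO : open O).
Variable g : 'rV[R]_3 -> 'M[R]_3.
Hypothesis gs : forall i j, smooth_on O (fun x => g x i j).
Hypothesis gT : forall x, O x -> (g x)^T = g x.
Hypothesis g_pos : forall x (v : 'rV[R]_3), O x -> v != 0 ->
  0 < (v *m g x *m v^T) 0 0.

Definition B_conditions x :=
  let f := fun y => cbrt (Omega g y) in
  [/\ tr_ricci g x = 0, 6 * tr_ricci3 g x ^+ 2 = tr_ricci2 g x ^+ 3,
      Pcontract g (tr_ricci2 g) x = 0
    & ricci g x = (f x)^-1 *: hessian g f x
        - (2 * (Omega g x + sqnorm_diff g (Omega g) x)) *: Ptensor g x].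

Let tr_smooth :
  (forall x, O x -> tr_ricci2 g x != 0) ->
  smooth_on O (fun x => - tr_ricci3 g x / tr_ricci2 g x).
Proof.
move=> t0; have s2 := tr_ricci2_smooth oO gs g_pos.
exact (smoothM oO (smoothN oO (tr_ricci3_smooth oO gs g_pos)) (smooth_inv oO s2 t0)).
Qed.

Lemma conditions_of_B_metric U : B_metric O U g -> forall x, O x -> B_conditions x.
Proof.
move=> [[sU vac] [mu [ev plane]]] x0 Ox0.
have mu0 x : O x -> mu x != 0 by move=> /ev[].
have inv x : O x -> typeD_invariants (ricci_endo g x) (mu x).
  by move=> /ev[_ /typeD_char_poly].
(* The eigenvalue is given merely as a function; it is smooth because it equals - t / s. *)
have smu : smooth_on O mu.
  apply: (smooth_eq oO) (tr_smooth _) => x Ox.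
    rewrite (tr_ricci2_mu inv Ox) (tr_ricci3_mu inv Ox); field.
    exact: mu0.
  by rewrite (tr_ricci2_mu inv Ox) mulf_neq0 ?pnatr_eq0 // expf_neq0 // mu0.
have [r [s [e [r0 BO ss se eP]]]] := local_axis oO gs gT g_pos smu mu0 inv Ox0.
set W := ball x0 r in BO se eP.
have oW : open W by exact: ball_open.
have Wx0 : W x0 by exact: ballxx.
have gs' i j := smooth_onS BO (gs i j).
have gT' x (Wx : W x) := gT (BO _ Wx).
have g_pos' x v (Wx : W x) := g_pos (v := v) (BO _ Wx).
have inv' x (Wx : W x) := inv _ (BO _ Wx).
have mu0' x (Wx : W x) := mu0 _ (BO _ Wx).
have smu' := smooth_onS BO smu.
have s_mu x : W x -> 0 < s * mu x by case/eP.
have ricci_mu x i j : W x -> ricci g x i j = mu x * (g x i j - 3 * (e i x * e j x)).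
  by case/eP.
have e_unit x : W x -> ((\row_i e i x) *m invmx (g x) *m (\row_i e i x)^T) 0 0 = 1.
  by case/eP.
have sU' := smooth_onS BO sU.
have vac' : static_vacuum W U g by split=> // T x /BO; exact: vac.
have a0 : forall x, W x -> axis_derivative g mu e x = 0.
  apply/(spacelike_gradientP oW gs' gT' g_pos' mu0' ricci_mu e_unit sU').
  by move=> T x v /BO; exact: plane.
have [t1 _ _] := inv _ Ox0.
split=> //.
- by rewrite (tr_ricci2_mu inv Ox0) (tr_ricci3_mu inv Ox0); ring.
- exact/(Pcontract_eq0 oW g_pos' smu' s_mu ricci_mu e_unit inv' Wx0)/a0.
- exact: (hessian_condition_of_vacuum oW gs' gT' g_pos' smu' ss s_mu se ricci_mu
    e_unit inv' vac' a0 Wx0).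
Qed.

(** The neighbourhood shrinks three times: to a ball with a smooth axis, to one where F^-1 e has a
    primitive theta, and to one where the cosine is positive. *)
Lemma B_metric_of_conditions x0 :
  (forall x, O x -> ricci g x <> 0) -> (forall x, O x -> B_conditions x) -> O x0 ->
  exists V : set 'rV[R]_3, [/\ open V, V x0, V `<=` O & exists U, B_metric V U g].
Proof.
move=> ric0 cond Ox0.
pose mu x := - tr_ricci3 g x / tr_ricci2 g x.
have muP x : O x -> mu x != 0 /\ typeD_invariants (ricci_endo g x) (mu x).
  move=> Ox; have [t1 t23 _ _] := cond x Ox.
  have := typeD_of_tensors (gT Ox) (fun v => g_pos (v := v) Ox)
    (ricci_sym oO gs gT g_pos Ox) (ric0 _ Ox) t1.
  have e2 : tr_ricci2 g x = \tr (ricci_endo g x *m ricci_endo g x).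
    by rewrite /tr_ricci2 expr2.
  have e3 : tr_ricci3 g x = \tr (ricci_endo g x *m ricci_endo g x *m ricci_endo g x).
    by rewrite /tr_ricci3 !exprS expr0 mulr1 mulrA.
  by move: t23; rewrite /mu e2 e3; move=> t23 /(_ t23).
have mu0 x : O x -> mu x != 0 by case/muP.
have inv x : O x -> typeD_invariants (ricci_endo g x) (mu x) by case/muP.
have smu : smooth_on O mu.
  apply: tr_smooth => x Ox.
  by rewrite (tr_ricci2_mu inv Ox) mulf_neq0 ?pnatr_eq0 // expf_neq0 // mu0.
have [r [s [e [r0 BO ss se eP]]]] := local_axis oO gs gT g_pos smu mu0 inv Ox0.
have oW : open (ball x0 r) by exact: ball_open.
have s_mu x : ball x0 r x -> 0 < s * mu x by case/eP.
have ricci_mu x i j : ball x0 r x ->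
    ricci g x i j = mu x * (g x i j - 3 * (e i x * e j x)) by case/eP.
have e_unit x : ball x0 r x ->
    ((\row_i e i x) *m invmx (g x) *m (\row_i e i x)^T) 0 0 = 1 by case/eP.
have a0 x : ball x0 r x -> axis_derivative g mu e x = 0.
  move=> Wx; have [_ _ P0 _] := cond x (BO _ Wx).
  have [P_a0 _] := Pcontract_eq0 oW (fun x v Wx => g_pos (v := v) (BO x Wx))
    (smooth_onS BO smu) s_mu ricci_mu e_unit (fun x Wx => inv x (BO x Wx)) Wx.
  exact: P_a0.
have sw := axis_form_smooth oW (smooth_onS BO smu) ss s_mu se.
have cw i j x (Wx : ball x0 r x) := axis_form_closed oW (fun i j => smooth_onS BO (gs i j))
  (fun x Wx => gT (BO x Wx)) (fun x v Wx => g_pos (v := v) (BO x Wx))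
  (smooth_onS BO smu) ss s_mu se ricci_mu e_unit (fun x Wx => inv _ (BO x Wx)) a0
  (fun x Wx => let: And4 _ _ _ h := cond x (BO x Wx) in h) i j Wx.
have [r1 [theta [r1_gt0 B1 sth th0 pth]]] := Poincare_lemma oW (ballxx x0 r0) sw cw.
have oB1 : open (ball x0 r1) by exact: ball_open.
have sc := smooth_cos oB1 (smoothM oB1 (smooth_cst oB1 (Num.sqrt (typeD_energy g mu x0))) sth).
have c0 : 0 < cos (Num.sqrt (typeD_energy g mu x0) * theta x0).
  by rewrite th0 mulr0 cos0.
have [r2 /= r2_gt0 B2] : exists2 r2 : R, 0 < r2 & forall x, ball x0 r2 x ->
    ball x0 r1 x /\ 0 < cos (Num.sqrt (typeD_energy g mu x0) * theta x).
  have : \forall x \near x0, ball x0 r1 x /\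
      0 < cos (Num.sqrt (typeD_energy g mu x0) * theta x).
    near=> x; split; near: x.
      exact: near_open (ballxx x0 r1_gt0).
    exact: continuous_gt0 oB1 sc (ballxx x0 r1_gt0) c0.
  by move=> /nbhs_ballP[r2 /= r2_gt0 B2]; exists r2.
set V := ball x0 r2 in B2.
have V1 : V `<=` ball x0 r1 by move=> x /B2[].
have VW : V `<=` ball x0 r by move=> x /V1/B1.
have VO : V `<=` O by move=> x /VW/BO.
have oV : open V by exact: ball_open.
have Vx0 : V x0 by exact: ballxx.
have gs' i j := smooth_onS VO (gs i j).
have gT' x (Vx : V x) := gT (VO _ Vx).
have g_pos' x v (Vx : V x) := g_pos (v := v) (VO _ Vx).
have inv' x (Vx : V x) := inv _ (VO _ Vx).
have mu0' x (Vx : V x) := mu0 _ (VO _ Vx).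
have smu' := smooth_onS VO smu.
have ricci_mu' x i j (Vx : V x) := ricci_mu x i j (VW _ Vx).
have e_unit' x (Vx : V x) := e_unit x (VW _ Vx).
have a0' x (Vx : V x) := a0 x (VW _ Vx).
exists V; split=> //.
have [U [sU vac]] : exists U, static_vacuum V U g.
  apply: (static_potential oV gs' gT' g_pos' smu' ss (fun x Vx => s_mu x (VW _ Vx))
    (fun i => smooth_onS VW (se i)) ricci_mu' e_unit' inv' a0' _ (erefl V) Vx0
    (smooth_onS V1 sth)).
  - by move=> x /VO/cond[].
  - by move=> i x /V1; exact: pth.
  - by move=> x /B2[].
exists U; split=> //; exists mu; split=> [x Vx|].
  by split; [exact: mu0' | apply/typeD_char_poly; exact: inv'].
exact/(spacelike_gradientP oV gs' gT' g_pos' mu0' ricci_mu' e_unit' sU).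
Unshelve. all: by end_near.
Qed.

End LocalTheorem.

Theorem theorem3 (R : realType) (M : manifold R 2) (gam : riemannian_metric M)
  (ricci_neq0 : forall (p : M) (a : atlas M), chart_dom a p ->
     ricci (gam a) (chart a p) <> 0) :
  locally_spatial_metric_of_B_metric gam <->
  forall (p : M) (a : atlas M), chart_dom a p ->
    let g := gam a in
    let x := chart a p in
    let s := tr_ricci2 g in
    let t := tr_ricci3 g in
    let Om := Omega g in
    let f := fun y => cbrt (Om y) in
    [/\ tr_ricci g x = 0,
        6 * t x ^+ 2 = s x ^+ 3,
        Pcontract g s x = 0
      & ricci g x = (f x)^-1 *: hessian g f x
          - (2 * (Om x + sqnorm_diff g Om x)) *: Ptensor g x].
Proof.
split=> [B p a pa|cond p a pa].
  have [V [oV Vp VO [U BV]]] := B p a pa.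
  apply: (conditions_of_B_metric oV _ _ _ BV Vp) => [i j|x Vx|x v Vx].
  - exact: smooth_onS VO (metric_smooth gam i j).
  - exact: (Defs.metric_sym gam (VO _ Vx)).
  - exact: (metric_pos gam (VO _ Vx)).
(* The conditions are differentiated in the construction, so they are supplied on the whole image of
   the chart and not only at the image of [p]. *)
apply: (B_metric_of_conditions (g := gam a) (@chart_image_open _ _ M a)) => [i j|x Ox|x v Ox|x [q qa <-]|x [q qa <-]|].
- exact: metric_smooth.
- exact: (Defs.metric_sym gam Ox).
- exact: (metric_pos gam Ox).
- exact: ricci_neq0.
- exact: cond.
- by exists p.
Qed.
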